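(* Let $X$ be a second countable compact Hausdorff space, let $A$ be a separable continuous $C(X)$-algebra with non-zero fibres and let $a\in A_+$ be a strictly positive contraction. Consider the following assertions: (a) For every $x\in X$, the operator $a_x$ is properly infinite in $A_x$. (b) The operator $a$ is properly infinite in $A$. (c) The multiplier C$^*$-algebra $\mathcal{M}(A)$ is a unital properly infinite C$^*$-algebra. Then (c)$\Rightarrow$(b)$\Rightarrow$(a). But (a)$\not\Rightarrow$(b) and (b)$\not\Rightarrow$(c) in general: there exist a second countable compact Hausdorff space $X$, a separable continuous $C(X)$-algebra $A$ with non-zero fibres and a strictly positive contraction $a\in A_+$ for which (a) holds and (b) fails, and there exist a second countable compact Hausdorff space $X$, a separable continuous $C(X)$-algebra $A$ with non-zero fibres and a strictly positive contraction $a\in A_+$ for which (b) holds and (c) fails.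
   Context: For a compact Hausdorff space $X$, a $C(X)$-algebra is a C$^*$-algebra $A$ (not necessarily unital) with a unital $*$-homomorphism from $C(X)$ to the centre of the multiplier algebra $\mathcal{M}(A)$. The fibre of $A$ at $x\in X$ is $A_x:=A/(C_0(X\setminus\{x\})\cdot A)$, and $a_x$ is the image of $a\in A$ in $A_x$. $A$ is continuous if $x\mapsto\|a_x\|$ is continuous on $X$ for every $a\in A$. For positive elements $c\in M_k(B)$, $d\in M_l(B)$ over a C$^*$-algebra $B$, write $c\precsim d$ if there is a sequence $(r_n)$ in $M_{k,l}(B)$ with $r_n d r_n^*\to c$ in norm. A positive element $b\in B$ is properly infinite in $B$ (Kirchberg-Rørdam) if it is non-zero and $b\oplus b\precsim b$. A unital C$^*$-algebra is properly infinite if it contains two isometries with mutually orthogonal range projections. *)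

(* Defs.v *)
From HB Require Import structures.
From mathcomp Require Import all_boot all_order all_algebra.
From mathcomp Require Import generic_quotient ring_quotient.
From mathcomp Require Import all_classical all_reals all_analysis.
From mathcomp.real_closed Require Import complex.

Set Implicit Arguments.
Unset Strict Implicit.
Unset Printing Implicit Defensive.

Import Order.TTheory GRing.Theory Num.Theory.
Import numFieldNormedType.Exports.

Local Open Scope classical_set_scope.
Local Open Scope ring_scope.
Local Open Scope complex_scope.

Local Obligation Tactic := idtac.

(* R[i] is a numFieldType; this makes its norm topology canonical. *)
HB.instance Definition _ (R : realType) :=
  NormedModule.copy R[i] (R[i] : numFieldType).

Reserved Notation "a ⋅ b" (at level 40, left associativity).
Reserved Notation "a ^†" (at level 2, format "a ^†").

(* Norms over R[i] take their (real, nonnegative) values in R[i].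
   Algebras are not assumed to be unital. *)
HB.mixin Record NormedModule_isStarAlgebra (R : realType) A
    of NormedModule R[i] A := {
  amul : A -> A -> A;
  star : A -> A;
  amulA : associative amul;
  amulDl : left_distributive amul +%R;
  amulDr : right_distributive amul +%R;
  amulZl : forall (k : R[i]) (a b : A), amul (k *: a) b = k *: amul a b;
  amulZr : forall (k : R[i]) (a b : A), amul a (k *: b) = k *: amul a b;
  starK : involutive star;
  starD : {morph star : a b / a + b};
  starZ : forall (k : R[i]) (a : A), star (k *: a) = Num.conj k *: star a;
  starM : forall a b, star (amul a b) = amul (star b) (star a);
  norm_amul : forall a b : A, `|amul a b| <= `|a| * `|b|;
  norm_star : forall a : A, `|star a| = `|a|
}.

#[short(type="normedStarAlgType")]
HB.structure Definition NormedStarAlgebra (R : realType) :=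
  {A of NormedModule R[i] A & NormedModule_isStarAlgebra R A}.

Notation "a ⋅ b" := (amul a b) : ring_scope.
Notation "a ^†" := (star a) : ring_scope.

HB.mixin Record NormedStarAlgebra_isCStar (R : realType) A
    of NormedStarAlgebra R A := {
  cstar_identity : forall a : A, `|a^† ⋅ a| = `|a| ^+ 2
}.

#[short(type="cstarAlgType")]
HB.structure Definition CStarAlgebra (R : realType) :=
  {A of CompleteNormedModule R[i] A & NormedStarAlgebra R A
      & NormedStarAlgebra_isCStar R A}.

Section StarAlgebraTheory.
Context {R : realType} {A : normedStarAlgType R}.
Implicit Types a b c : A.

Lemma amul0r a : 0 ⋅ a = 0.
Proof. by have := amulZl 0 0 a; rewrite !scale0r. Qed.

Lemma amulr0 a : a ⋅ 0 = 0.
Proof. by have := amulZr 0 a 0; rewrite !scale0r. Qed.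

Lemma amulNl a b : (- a) ⋅ b = - (a ⋅ b).
Proof. by rewrite -scaleN1r amulZl scaleN1r. Qed.

Lemma amulNr a b : a ⋅ (- b) = - (a ⋅ b).
Proof. by rewrite -scaleN1r amulZr scaleN1r. Qed.

Lemma star0 : (0 : A)^† = 0.
Proof. by have := starZ 0 (0 : A); rewrite rmorph0 !scale0r. Qed.

Lemma starN a : (- a)^† = - a^†.
Proof. by rewrite -scaleN1r starZ rmorphN rmorph1 scaleN1r. Qed.

Lemma lipschitz_continuous (h : A -> A) (K : R[i]) : 0 <= K ->
  (forall a b, `|h a - h b| <= K * `|a - b|) -> continuous h.
Proof.
move=> K0 hK a; apply/cvgrPdist_le => e e0.
have K1 : 0 < K + 1 by rewrite ltr_wpDl.
near=> b.
rewrite (le_trans (hK _ _))// (@le_trans _ _ ((K + 1) * `|a - b|))//.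
  by rewrite ler_wpM2r// lerDl.
rewrite mulrC -ler_pdivlMr//; near: b.
by apply: cvgr_dist_le; [exact: cvg_id | exact: divr_gt0].
Unshelve. all: by end_near. Qed.

Lemma amul_continuousr a : continuous (amul a).
Proof.
apply: (@lipschitz_continuous _ `|a|) => // b c.
by rewrite -amulNr -amulDr norm_amul.
Qed.

Lemma amul_continuousl a : continuous (amul^~ a).
Proof.
apply: (@lipschitz_continuous _ `|a|) => // b c.
by rewrite -amulNl -amulDl mulrC norm_amul.
Qed.

Lemma star_continuous : continuous (@star R A).
Proof.
apply: (@lipschitz_continuous _ 1) => // b c.
by rewrite mul1r -starN -starD norm_star.
Qed.

End StarAlgebraTheory.

Section Elements.
Context {R : realType} {A : normedStarAlgType R}.

Definition positive (a : A) := exists b : A, a = b^† ⋅ b.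

(* The hereditary C*-subalgebra generated by a, the closure of a A a, is all
   of A. *)
Definition strictly_positive (a : A) :=
  positive a /\ dense (range (fun b : A => a ⋅ b ⋅ a)).

Definition separable := exists2 D : set A, countable D & dense D.

End Elements.
Arguments separable {R} A.

Section Comparison.
Context {R : realType} {B : normedStarAlgType R}.

Definition amulmx m n p (M : 'M[B]_(m, n)) (N : 'M[B]_(n, p)) : 'M[B]_(m, p) :=
  \matrix_(i, j) \sum_k (M i k ⋅ N k j).

Definition starmx m n (M : 'M[B]_(m, n)) : 'M[B]_(n, m) :=
  \matrix_(i, j) (M j i)^†.

(* The limit is taken in the topology of 'M[B]_k, i.e. entrywise: this is the
   norm topology of the C*-algebra M_k(B), whose norm lies between
   max |c i j| and \sum_(i, j) |c i j|. *)
Definition cuntz_le k l (c : 'M[B]_k) (d : 'M[B]_l) :=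
  exists r : nat -> 'M[B]_(k, l),
    (fun n => amulmx (amulmx (r n) d) (starmx (r n))) @ \oo --> c.

Definition mx11 (b : B) : 'M[B]_1 := const_mx b.

Definition mxdsum k l (c : 'M[B]_k) (d : 'M[B]_l) : 'M[B]_(k + l) :=
  block_mx c 0 0 d.

Definition properly_infinite (b : B) :=
  b != 0 /\ cuntz_le (mxdsum (mx11 b) (mx11 b)) (mx11 b).

End Comparison.

Section Multiplier.
Context {R : realType} {A : normedStarAlgType R}.

(* Double centralizers (L, R). Only the unital *-algebra structure of M(A) is
   set up: neither unital *-homomorphisms into it nor isometries in it refer to
   its norm. *)
Record multiplier : Type := Multiplier {
  lact : A -> A;
  ract : A -> A;
  lact_linear : linear lact;
  ract_linear : linear ract;
  lact_continuous : continuous lact;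
  ract_continuous : continuous ract;
  lactM : forall a b, lact (a ⋅ b) = lact a ⋅ b;
  ractM : forall a b, ract (a ⋅ b) = a ⋅ ract b;
  centralizer : forall a b, ract a ⋅ b = a ⋅ lact b
}.

Implicit Types m : multiplier.

Lemma multiplier_ext m1 m2 :
  lact m1 =1 lact m2 -> ract m1 =1 ract m2 -> m1 = m2.
Proof.
case: m1 m2 => [l1 r1 p1 p2 p3 p4 p5 p6 p7] [l2 r2 q1 q2 q3 q4 q5 q6 q7] /=.
move=> /funext l12 /funext r12; subst l2 r2.
by congr Multiplier; exact: Prop_irrelevance.
Qed.

Lemma lactD m a b : lact m (a + b) = lact m a + lact m b.
Proof. by have := lact_linear m 1 a b; rewrite !scale1r. Qed.

Lemma ractD m a b : ract m (a + b) = ract m a + ract m b.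
Proof. by have := ract_linear m 1 a b; rewrite !scale1r. Qed.

Lemma lact0 m : lact m 0 = 0.
Proof. by apply: (addrI (lact m 0)); rewrite -lactD !addr0. Qed.

Lemma ract0 m : ract m 0 = 0.
Proof. by apply: (addrI (ract m 0)); rewrite -ractD !addr0. Qed.

Lemma lactZ m k a : lact m (k *: a) = k *: lact m a.
Proof. by have := lact_linear m k a 0; rewrite lact0 !addr0. Qed.

Lemma ractZ m k a : ract m (k *: a) = k *: ract m a.
Proof. by have := ract_linear m k a 0; rewrite ract0 !addr0. Qed.

Program Definition mult_zero :=
  @Multiplier (fun=> 0) (fun=> 0) _ _ _ _ _ _ _.
Next Obligation. by move=> k a b /=; rewrite scaler0 addr0. Qed.
Next Obligation. by move=> k a b /=; rewrite scaler0 addr0. Qed.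
Next Obligation. by move=> a; exact: cvg_cst. Qed.
Next Obligation. by move=> a; exact: cvg_cst. Qed.
Next Obligation. by move=> a b /=; rewrite amul0r. Qed.
Next Obligation. by move=> a b /=; rewrite amulr0. Qed.
Next Obligation. by move=> a b /=; rewrite amul0r amulr0. Qed.

Program Definition mult_opp m :=
  @Multiplier (fun a => - lact m a) (fun a => - ract m a) _ _ _ _ _ _ _.
Next Obligation.
by move=> m k a b /=; rewrite lactD lactZ opprD scalerN. Qed.
Next Obligation.
by move=> m k a b /=; rewrite ractD ractZ opprD scalerN. Qed.
Next Obligation. by move=> m a; apply: cvgN; exact: lact_continuous. Qed.
Next Obligation. by move=> m a; apply: cvgN; exact: ract_continuous. Qed.
Next Obligation. by move=> m a b /=; rewrite lactM amulNl. Qed.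
Next Obligation. by move=> m a b /=; rewrite ractM amulNr. Qed.
Next Obligation. by move=> m a b /=; rewrite amulNl amulNr centralizer. Qed.

Program Definition mult_add m1 m2 :=
  @Multiplier (fun a => lact m1 a + lact m2 a)
              (fun a => ract m1 a + ract m2 a) _ _ _ _ _ _ _.
Next Obligation.
by move=> m1 m2 k a b /=; rewrite !lactD !lactZ scalerDr addrACA. Qed.
Next Obligation.
by move=> m1 m2 k a b /=; rewrite !ractD !ractZ scalerDr addrACA. Qed.
Next Obligation. by move=> m1 m2 a; apply: cvgD; exact: lact_continuous. Qed.
Next Obligation. by move=> m1 m2 a; apply: cvgD; exact: ract_continuous. Qed.
Next Obligation. by move=> m1 m2 a b /=; rewrite !lactM amulDl. Qed.
Next Obligation. by move=> m1 m2 a b /=; rewrite !ractM amulDr. Qed.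
Next Obligation.
by move=> m1 m2 a b /=; rewrite amulDl amulDr !centralizer. Qed.

Program Definition mult_scale (k : R[i]) m :=
  @Multiplier (fun a => k *: lact m a) (fun a => k *: ract m a) _ _ _ _ _ _ _.
Next Obligation.
by move=> k m l a b /=; rewrite lactD lactZ scalerDr !scalerA mulrC. Qed.
Next Obligation.
by move=> k m l a b /=; rewrite ractD ractZ scalerDr !scalerA mulrC. Qed.
Next Obligation. by move=> k m a; apply: cvgZr; exact: lact_continuous. Qed.
Next Obligation. by move=> k m a; apply: cvgZr; exact: ract_continuous. Qed.
Next Obligation. by move=> k m a b /=; rewrite lactM amulZl. Qed.
Next Obligation. by move=> k m a b /=; rewrite ractM amulZr. Qed.
Next Obligation. by move=> k m a b /=; rewrite amulZl amulZr centralizer. Qed.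

Program Definition mult_one := @Multiplier id id _ _ _ _ _ _ _.
Next Obligation. by []. Qed.
Next Obligation. by []. Qed.
Next Obligation. by move=> a; exact: cvg_id. Qed.
Next Obligation. by move=> a; exact: cvg_id. Qed.
Next Obligation. by []. Qed.
Next Obligation. by []. Qed.
Next Obligation. by []. Qed.

Program Definition mult_mul m1 m2 :=
  @Multiplier (lact m1 \o lact m2) (ract m2 \o ract m1) _ _ _ _ _ _ _.
Next Obligation. by move=> m1 m2 k a b /=; rewrite !lactD !lactZ. Qed.
Next Obligation. by move=> m1 m2 k a b /=; rewrite !ractD !ractZ. Qed.
Next Obligation.
by move=> m1 m2 a; apply: continuous_comp; exact: lact_continuous. Qed.
Next Obligation.
by move=> m1 m2 a; apply: continuous_comp; exact: ract_continuous. Qed.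
Next Obligation. by move=> m1 m2 a b /=; rewrite !lactM. Qed.
Next Obligation. by move=> m1 m2 a b /=; rewrite !ractM. Qed.
Next Obligation. by move=> m1 m2 a b /=; rewrite !centralizer. Qed.

Program Definition mult_star m :=
  @Multiplier (fun a => (ract m a^†)^†) (fun a => (lact m a^†)^†) _ _ _ _ _ _ _.
Next Obligation.
by move=> m k a b /=; rewrite starD starZ ractD ractZ starD starZ conjCK. Qed.
Next Obligation.
by move=> m k a b /=; rewrite starD starZ lactD lactZ starD starZ conjCK. Qed.
Next Obligation.
move=> m a; apply: (@continuous_comp _ _ _ star (fun b => (ract m b)^†)).
  exact: star_continuous.
by apply: continuous_comp; [exact: ract_continuous | exact: star_continuous].
Qed.
Next Obligation.
move=> m a; apply: (@continuous_comp _ _ _ star (fun b => (lact m b)^†)).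
  exact: star_continuous.
by apply: continuous_comp; [exact: lact_continuous | exact: star_continuous].
Qed.
Next Obligation. by move=> m a b /=; rewrite starM ractM starM starK. Qed.
Next Obligation. by move=> m a b /=; rewrite starM lactM starM starK. Qed.
Next Obligation.
move=> m a b /=; apply: (can_inj (@starK R A)).
by rewrite !starM !starK centralizer.
Qed.

HB.instance Definition _ := gen_eqMixin multiplier.
HB.instance Definition _ := gen_choiceMixin multiplier.

Lemma mult_addA : associative mult_add.
Proof. by move=> m1 m2 m3; apply: multiplier_ext => a /=; rewrite addrA. Qed.

Lemma mult_addC : commutative mult_add.
Proof. by move=> m1 m2; apply: multiplier_ext => a /=; rewrite addrC. Qed.

Lemma mult_add0 : left_id mult_zero mult_add.
Proof. by move=> m; apply: multiplier_ext => a /=; rewrite add0r. Qed.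

Lemma mult_addN : left_inverse mult_zero mult_opp mult_add.
Proof. by move=> m; apply: multiplier_ext => a /=; rewrite addNr. Qed.

HB.instance Definition _ := GRing.isZmodule.Build multiplier
  mult_addA mult_addC mult_add0 mult_addN.

Lemma mult_mulA : associative mult_mul.
Proof. by move=> m1 m2 m3; exact: multiplier_ext. Qed.

Lemma mult_mul1 : left_id mult_one mult_mul.
Proof. by move=> m; exact: multiplier_ext. Qed.

Lemma mult_mulr1 : right_id mult_one mult_mul.
Proof. by move=> m; exact: multiplier_ext. Qed.

Lemma mult_mulDl : left_distributive mult_mul +%R.
Proof. by move=> m1 m2 m3; apply: multiplier_ext => a //=; rewrite ractD. Qed.

Lemma mult_mulDr : right_distributive mult_mul +%R.
Proof. by move=> m1 m2 m3; apply: multiplier_ext => a //=; rewrite lactD. Qed.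

HB.instance Definition _ := GRing.Zmodule_isPzRing.Build multiplier
  mult_mulA mult_mul1 mult_mulr1 mult_mulDl mult_mulDr.

Lemma mult_scaleA k l m : mult_scale k (mult_scale l m) = mult_scale (k * l) m.
Proof. by apply: multiplier_ext => a /=; rewrite scalerA. Qed.

Lemma mult_scale1 : left_id 1 mult_scale.
Proof. by move=> m; apply: multiplier_ext => a /=; rewrite scale1r. Qed.

Lemma mult_scaleDr : right_distributive mult_scale +%R.
Proof. by move=> k m1 m2; apply: multiplier_ext => a /=; rewrite scalerDr. Qed.

Lemma mult_scaleDl m : {morph mult_scale^~ m : k l / k + l}.
Proof. by move=> k l; apply: multiplier_ext => a /=; rewrite scalerDl. Qed.

HB.instance Definition _ := GRing.Zmodule_isLmodule.Build R[i] multiplier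
  mult_scaleA mult_scale1 mult_scaleDr mult_scaleDl.

Definition multiplier_properly_infinite :=
  exists s t : multiplier,
    [/\ mult_star s * s = 1, mult_star t * t = 1 &
        (s * mult_star s) * (t * mult_star t) = 0].

End Multiplier.
Arguments multiplier {R} A.
Arguments multiplier_properly_infinite {R} A.

Section Quotient.
Context {R : realType} {A : normedStarAlgType R}.

Record closed_ideal : Type := ClosedIdeal {
  ideal_set :> A -> Prop;
  ideal_closed : closed (ideal_set : set A);
  ideal0 : ideal_set 0;
  idealD : forall a b, ideal_set a -> ideal_set b -> ideal_set (a + b);
  idealZ : forall (k : R[i]) a, ideal_set a -> ideal_set (k *: a);
  idealMl : forall a b, ideal_set b -> ideal_set (a ⋅ b);
  idealMr : forall a b, ideal_set a -> ideal_set (a ⋅ b);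
  ideal_star : forall a, ideal_set a -> ideal_set a^†
}.

Variable I : closed_ideal.

Lemma idealN a : I a -> I (- a).
Proof. by move=> Ia; rewrite -scaleN1r; exact: idealZ. Qed.

Lemma idealB a b : I a -> I b -> I (a - b).
Proof. by move=> Ia Ib; apply: idealD => //; exact: idealN. Qed.

Definition ideal_pred : {pred A} := fun a => `[< I a >].

Lemma ideal_zmod_closed : zmod_closed ideal_pred.
Proof.
split; first by apply/asboolP; exact: ideal0.
by move=> a b /asboolP Ia /asboolP Ib; apply/asboolP; exact: idealB.
Qed.

HB.instance Definition _ := GRing.isZmodClosed.Build A ideal_pred
  ideal_zmod_closed.

Definition quot_alg : Type := Quotient.quot ideal_pred.

HB.instance Definition _ := GRing.Zmodule.on quot_alg.

Definition quot_pi (a : A) : quot_alg := (\pi_(Quotient.quot ideal_pred) a)%qT.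

Definition quot_repr (q : quot_alg) : A :=
  repr (q : Quotient.quot ideal_pred).

Lemma quot_reprK q : quot_pi (quot_repr q) = q.
Proof. exact: reprK. Qed.

Lemma quot_piP a b : quot_pi a = quot_pi b <-> I (a - b).
Proof.
have := Quotient.idealrBE ideal_pred a b; rewrite /quot_pi unfold_in => E.
split=> [ab|/asboolP]; first by apply/asboolP; rewrite E ab.
by rewrite E => /eqP.
Qed.

Lemma quot_repr_pi a : I (quot_repr (quot_pi a) - a).
Proof. by apply/quot_piP; rewrite quot_reprK. Qed.

Lemma quot_piD a b : quot_pi (a + b) = quot_pi a + quot_pi b.
Proof. exact: raddfD. Qed.

Lemma quot_pi0 : quot_pi 0 = 0.
Proof. exact: raddf0. Qed.

Definition quot_scale (k : R[i]) (q : quot_alg) := quot_pi (k *: quot_repr q).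

Definition quot_mul (p q : quot_alg) := quot_pi (quot_repr p ⋅ quot_repr q).

Definition quot_star (q : quot_alg) := quot_pi (quot_repr q)^†.

Lemma quot_scaleE k a : quot_scale k (quot_pi a) = quot_pi (k *: a).
Proof.
by apply/quot_piP; rewrite -scalerBr; apply: idealZ; exact: quot_repr_pi.
Qed.

Lemma quot_mulE a b : quot_mul (quot_pi a) (quot_pi b) = quot_pi (a ⋅ b).
Proof.
apply/quot_piP; set a' := quot_repr _; set b' := quot_repr _.
have -> : a' ⋅ b' - a ⋅ b = (a' - a) ⋅ b' + a ⋅ (b' - b).
  by rewrite amulDl amulDr amulNl amulNr addrA subrK.
by apply: idealD; [apply: idealMr | apply: idealMl]; exact: quot_repr_pi.
Qed.

Lemma quot_starE a : quot_star (quot_pi a) = quot_pi a^†.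
Proof.
apply/quot_piP; rewrite -starN -starD.
by apply: ideal_star; exact: quot_repr_pi.
Qed.

Lemma quot_ind (P : quot_alg -> Prop) :
  (forall a, P (quot_pi a)) -> forall q, P q.
Proof. by move=> Ppi q; rewrite -(quot_reprK q). Qed.

Lemma quot_scaleA k l q : quot_scale k (quot_scale l q) = quot_scale (k * l) q.
Proof. by elim/quot_ind: q => a; rewrite !quot_scaleE scalerA. Qed.

Lemma quot_scale1 : left_id 1 quot_scale.
Proof. by elim/quot_ind => a; rewrite quot_scaleE scale1r. Qed.

Lemma quot_scaleDr : right_distributive quot_scale +%R.
Proof.
move=> k; elim/quot_ind => a; elim/quot_ind => b.
by rewrite -quot_piD !quot_scaleE scalerDr quot_piD.
Qed.

Lemma quot_scaleDl q : {morph quot_scale^~ q : k l / k + l}.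
Proof.
elim/quot_ind: q => a k l.
by rewrite /= !quot_scaleE scalerDl quot_piD.
Qed.

HB.instance Definition _ := GRing.Zmodule_isLmodule.Build R[i] quot_alg
  quot_scaleA quot_scale1 quot_scaleDr quot_scaleDl.

Lemma quot_piZ k a : quot_pi (k *: a) = k *: quot_pi a.
Proof. by rewrite -quot_scaleE. Qed.

Let rnorm (a : A) : R := complex.Re `|a|.

Let rnormE a : `|a| = (rnorm a)%:C.
Proof. by rewrite /rnorm RRe_real// ger0_real. Qed.

Let rnorm_ge0 a : 0 <= rnorm a.
Proof. by rewrite -ler0c -rnormE. Qed.

Definition quot_rnorm (q : quot_alg) : R :=
  inf [set complex.Re `|a| | a in [set a : A | quot_pi a = q]].

Definition quot_norm (q : quot_alg) : R[i] := (quot_rnorm q)%:C.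

Let rnorm_has_inf q :
  has_inf [set complex.Re `|a| | a in [set a : A | quot_pi a = q]].
Proof.
split; last by exists 0 => _ [a _ <-]; exact: rnorm_ge0.
by exists (rnorm (quot_repr q)), (quot_repr q) => //=; exact: quot_reprK.
Qed.

Let qrnorm_le a : quot_rnorm (quot_pi a) <= rnorm a.
Proof. by apply: ge_inf; [case: (rnorm_has_inf (quot_pi a))|exists a]. Qed.

Let qrnorm_ge q x :
  (forall a, quot_pi a = q -> x <= rnorm a) -> x <= quot_rnorm q.
Proof.
move=> xle; apply: lb_le_inf; first by case: (rnorm_has_inf q).
by move=> _ [a /= aq <-]; exact: xle.
Qed.

Let qrnorm_ge0 q : 0 <= quot_rnorm q.
Proof. by apply: qrnorm_ge => a _; exact: rnorm_ge0. Qed.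

Lemma quot_normD p q : quot_norm (p + q) <= quot_norm p + quot_norm q.
Proof.
rewrite /quot_norm -rmorphD lecR -lerBlDr; apply: qrnorm_ge => a <-.
rewrite lerBlDl -lerBlDr; apply: qrnorm_ge => b <-.
rewrite lerBlDr -quot_piD (le_trans (qrnorm_le _))// addrC.
by rewrite -lecR rmorphD/= -!rnormE ler_normD.
Qed.

Lemma quot_normZ k q : quot_norm (k *: q) = `|k| * quot_norm q.
Proof.
have le_normZ l p : l != 0 -> quot_norm (l *: p) <= `|l| * quot_norm p.
  move=> l0; have l1 : 0 < complex.Re `|l|.
    by rewrite -ltcR rmorph0 RRe_real ?ger0_real// normr_gt0.
  have lE : `|l| = (complex.Re `|l|)%:C by rewrite RRe_real// ger0_real.
  rewrite lE /quot_norm -rmorphM lecR mulrC -ler_pdivrMr//.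
  apply: qrnorm_ge => a <-; rewrite ler_pdivrMr// -quot_piZ.
  rewrite (le_trans (qrnorm_le _))// -lecR rmorphM/= -!rnormE -lE.
  by rewrite mulrC normrZ.
have [->|k0] := eqVneq k 0.
  rewrite scale0r normr0 mul0r /quot_norm; congr (_%:C); apply/eqP.
  rewrite eq_le qrnorm_ge0 andbT -quot_pi0 (le_trans (qrnorm_le _))//.
  by rewrite /rnorm normr0.
apply/eqP; rewrite eq_le le_normZ//=.
rewrite mulrC -ler_pdivlMr ?normr_gt0// mulrC -normfV.
by rewrite -{1}(scalerK k0 q) le_normZ// invr_eq0.
Qed.

Lemma quot_norm0_eq0 q : quot_norm q = 0 -> q = 0.
Proof.
elim/quot_ind: q => a; rewrite /quot_norm => /(congr1 (@complex.Re R))/= qa0.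
rewrite -quot_pi0; apply/quot_piP; rewrite subr0.
apply: (ideal_closed (c := I)) => B /nbhs_ballP[e/= e0 Be].
have e1 : e = (complex.Re e)%:C by rewrite RRe_real// gtr0_real.
have re0 : 0 < complex.Re e by rewrite -ltcR rmorph0 -e1.
have [_ [b/= ba <-] /=] := inf_adherent re0 (rnorm_has_inf (quot_pi a)).
rewrite -/(quot_rnorm _) qa0 add0r => be.
exists (a - b); split; first exact/quot_piP.
apply: Be; rewrite -ball_normE /= opprB addrC subrK.
by rewrite rnormE e1 ltcR.
Qed.

HB.instance Definition _ := Lmodule_isNormed.Build R[i] quot_alg
  quot_normD quot_normZ quot_norm0_eq0.

Lemma quot_mulA : associative quot_mul.
Proof.
elim/quot_ind => a; elim/quot_ind => b; elim/quot_ind => c.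
by rewrite !quot_mulE amulA.
Qed.

Lemma quot_mulDl : left_distributive quot_mul +%R.
Proof.
elim/quot_ind => a; elim/quot_ind => b; elim/quot_ind => c.
by rewrite -quot_piD !quot_mulE amulDl quot_piD.
Qed.

Lemma quot_mulDr : right_distributive quot_mul +%R.
Proof.
elim/quot_ind => a; elim/quot_ind => b; elim/quot_ind => c.
by rewrite -quot_piD !quot_mulE amulDr quot_piD.
Qed.

Lemma quot_mulZl k p q : quot_mul (k *: p) q = k *: quot_mul p q.
Proof.
elim/quot_ind: p => a; elim/quot_ind: q => b.
by rewrite -quot_piZ !quot_mulE amulZl quot_piZ.
Qed.

Lemma quot_mulZr k p q : quot_mul p (k *: q) = k *: quot_mul p q.
Proof.
elim/quot_ind: p => a; elim/quot_ind: q => b.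
by rewrite -quot_piZ !quot_mulE amulZr quot_piZ.
Qed.

Lemma quot_starK : involutive quot_star.
Proof. by elim/quot_ind => a; rewrite !quot_starE starK. Qed.

Lemma quot_starD : {morph quot_star : p q / p + q}.
Proof.
elim/quot_ind => a; elim/quot_ind => b.
by rewrite -quot_piD !quot_starE starD quot_piD.
Qed.

Lemma quot_starZ k q : quot_star (k *: q) = Num.conj k *: quot_star q.
Proof. by elim/quot_ind: q => a; rewrite -quot_piZ !quot_starE starZ quot_piZ. Qed.

Lemma quot_starM p q : quot_star (quot_mul p q) = quot_mul (quot_star q) (quot_star p).
Proof.
elim/quot_ind: p => a; elim/quot_ind: q => b.
by rewrite !(quot_mulE, quot_starE) starM.
Qed.

Let le_mul_inf (x y : R) q : 0 <= y ->
  (forall a, quot_pi a = q -> x <= y * rnorm a) -> x <= y * quot_rnorm q.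
Proof.
move=> y0 xle; have [y00|yn0] := eqVneq y 0.
  by have := xle _ (quot_reprK q); rewrite y00 !mul0r.
have y1 : 0 < y by rewrite lt_def yn0.
rewrite mulrC -ler_pdivrMr//; apply: qrnorm_ge => a /xle.
by rewrite ler_pdivrMr// mulrC.
Qed.

Lemma quot_norm_mul (p q : quot_alg) : `|quot_mul p q| <= `|p| * `|q|.
Proof.
have normE r : `|r| = quot_norm r by [].
rewrite !normE /quot_norm -rmorphM lecR.
apply: le_mul_inf => // b <-; rewrite mulrC.
apply: le_mul_inf => // a <-; rewrite quot_mulE (le_trans (qrnorm_le _))//.
by rewrite mulrC -lecR rmorphM/= -!rnormE norm_amul.
Qed.

Lemma quot_norm_star (q : quot_alg) : `|quot_star q| = `|q|.
Proof.
have le_star p : quot_rnorm (quot_star p) <= quot_rnorm p.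
  apply: qrnorm_ge => a <-; rewrite quot_starE (le_trans (qrnorm_le _))//.
  by rewrite /rnorm norm_star.
have normE r : `|r| = quot_norm r by [].
rewrite !normE /quot_norm; congr (_%:C).
by apply/eqP; rewrite eq_le le_star -{1}(quot_starK q) le_star.
Qed.

HB.instance Definition _ := NormedModule_isStarAlgebra.Build R quot_alg
  quot_mulA quot_mulDl quot_mulDr quot_mulZl quot_mulZr
  quot_starK quot_starD quot_starZ quot_starM quot_norm_mul quot_norm_star.

End Quotient.
Arguments closed_ideal {R} A.

Section ContinuousFunctions.
Context {R : realType} {X : topologicalType}.
Implicit Types f g : continuousType X R[i].

Lemma cts_add f g : continuous (fun x => f x + g x).
Proof. by move=> x; apply: cvgD; apply: (@cts_fun X R[i]). Qed.

Lemma cts_mul f g : continuous (fun x => f x * g x).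
Proof. by move=> x; apply: cvgM; apply: (@cts_fun X R[i]). Qed.

Lemma cts_scale k f : continuous (fun x => k * f x).
Proof. by move=> x; apply: cvgM; [exact: cvg_cst | apply: (@cts_fun X R[i])]. Qed.

Lemma cts_conj f : continuous (fun x => Num.conj (f x)).
Proof.
move=> x; apply/cvgrPdist_lt => e e0; near=> y.
rewrite -rmorphB norm_conjC; near: y.
by apply: cvgr_dist_lt => //; apply: (@cts_fun X R[i]).
Unshelve. all: by end_near. Qed.

Definition ctsD f g : continuousType X R[i] := mkcts (@cts_add f g).
Definition ctsM f g : continuousType X R[i] := mkcts (@cts_mul f g).
Definition ctsZ k f : continuousType X R[i] := mkcts (@cts_scale k f).
Definition ctsJ f : continuousType X R[i] := mkcts (@cts_conj f).
Definition cts1 : continuousType X R[i] := cst 1.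

End ContinuousFunctions.

(* cx_hom is the unital *-homomorphism from C(X) to the centre of M(A). *)
Record cxAlgType (R : realType) (X : topologicalType) := CxAlg {
  cx_alg :> cstarAlgType R;
  cx_hom : continuousType X R[i] -> multiplier cx_alg;
  cx_homD : forall f g, cx_hom (ctsD f g) = cx_hom f + cx_hom g;
  cx_homZ : forall k f, cx_hom (ctsZ k f) = k *: cx_hom f;
  cx_homM : forall f g, cx_hom (ctsM f g) = cx_hom f * cx_hom g;
  cx_homJ : forall f, cx_hom (ctsJ f) = mult_star (cx_hom f);
  cx_hom1 : cx_hom cts1 = 1;
  cx_hom_central : forall f (m : multiplier cx_alg),
    m * cx_hom f = cx_hom f * m
}.

Section Fibre.
Context {R : realType} {X : topologicalType} (A : cxAlgType R X) (x : X).
Implicit Types (f : continuousType X R[i]) (a b : A).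

Definition cx_act f a : A := lact (cx_hom A f) a.

Definition fibre_span : set A :=
  [set \sum_(p <- s) cx_act p.1 p.2 | s in
    [set s : seq (continuousType X R[i] * A) |
      forall p, p \in s -> (p.1 : continuousType X R[i]) x = 0]].

(* C_0(X \ {x}) A as a closed linear span; by Cohen's factorization theorem
   this is also just the set of the products f a with f(x) = 0. *)
Definition fibre_set : set A := closure fibre_span.

Lemma closure_stable (S : set A) (h : A -> A) : continuous h ->
  (forall a, S a -> closure S (h a)) -> forall a, closure S a -> closure S (h a).
Proof.
move=> hc hS a Sa; apply: (@closed_closure _ S) => B /hc /Sa [b [Sb Bb]].
by exists (h b); split => //; exact: hS.
Qed.

Lemma fibre_span_gen f a : f x = 0 -> fibre_span (cx_act f a).
Proof.
move=> fx0; exists [:: (f, a)]; last by rewrite big_seq1.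
by move=> p; rewrite inE => /eqP ->.
Qed.

Lemma fibre_spanD a b : fibre_span a -> fibre_span b -> fibre_span (a + b).
Proof.
move=> [s sx <-] [t tx <-]; exists (s ++ t); last by rewrite big_cat.
by move=> p; rewrite mem_cat => /orP[/sx|/tx].
Qed.

Lemma fibre_span0 : fibre_span 0.
Proof. by exists [::] => //; rewrite big_nil. Qed.

Lemma fibre_span_stable (h : A -> A) : {morph h : a b / a + b} ->
  (forall f a, f x = 0 -> fibre_span (h (cx_act f a))) ->
  forall a, fibre_span a -> fibre_span (h a).
Proof.
move=> hD hS _ [s sx <-]; elim: s sx => [_|p s IH sx].
  rewrite big_nil (_ : h 0 = 0); first exact: fibre_span0.
  by apply: (addrI (h 0)); rewrite -hD !addr0.
rewrite big_cons hD; apply: fibre_spanD.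
  by apply: hS; apply: sx; rewrite inE eqxx.
by apply: IH => q qs; apply: sx; rewrite inE qs orbT.
Qed.

Lemma fibre_set_stable (h : A -> A) : continuous h -> {morph h : a b / a + b} ->
  (forall f a, f x = 0 -> fibre_span (h (cx_act f a))) ->
  forall a, fibre_set a -> fibre_set (h a).
Proof.
move=> hc hD hS; apply: closure_stable => // a Sa.
by apply: subset_closure; exact: fibre_span_stable.
Qed.

Program Definition inner_mult (a : A) : multiplier A :=
  @Multiplier R A (amul a) (amul^~ a) _ _ _ _ _ _ _.
Next Obligation. by move=> a k b c; rewrite amulDr amulZr. Qed.
Next Obligation. by move=> a k b c; rewrite amulDl amulZl. Qed.
Next Obligation. exact: amul_continuousr. Qed.
Next Obligation. exact: amul_continuousl. Qed.
Next Obligation. by move=> a b c; rewrite amulA. Qed.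
Next Obligation. by move=> a b c; rewrite amulA. Qed.
Next Obligation. by move=> a b c; rewrite amulA. Qed.

Lemma cx_act_amulr f a b : a ⋅ cx_act f b = cx_act f (a ⋅ b).
Proof.
by have /(congr1 (fun m => lact m b)) := cx_hom_central f (inner_mult a).
Qed.

Lemma amulIr (a b : A) : (forall c, a ⋅ c = b ⋅ c) -> a = b.
Proof.
move=> ab; apply/eqP; rewrite -subr_eq0 -normr_eq0 -norm_star.
have := cstar_identity (a - b)^†; rewrite starK amulDl amulNl ab subrr normr0.
by move=> /esym/eqP; rewrite expf_eq0.
Qed.

Lemma cx_ract f a : ract (cx_hom A f) a = cx_act f a.
Proof.
apply: amulIr => b; rewrite centralizer -[lact _ b]/(cx_act f b).
by rewrite cx_act_amulr /cx_act lactM.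
Qed.

Lemma cx_act_star f a : (cx_act f a)^† = cx_act (ctsJ f) a^†.
Proof.
rewrite {2}/cx_act cx_homJ/= starK; congr (_^†).
by rewrite -cx_ract.
Qed.

Program Definition fibre_ideal : closed_ideal A :=
  @ClosedIdeal R A fibre_set _ _ _ _ _ _ _.
Next Obligation. exact: closed_closure. Qed.
Next Obligation. by apply: subset_closure; exact: fibre_span0. Qed.
Next Obligation.
move=> a b Sa; have addc (c : A) : continuous (fun b : A => b + c).
  by move=> d; apply: cvgD; [exact: cvg_id | exact: cvg_cst].
rewrite addrC; apply: (@closure_stable _ (fun b => b + a)) => // c Sc.
rewrite addrC; apply: (@closure_stable _ (fun b => b + c)) => // d Sd.
by apply: subset_closure; exact: fibre_spanD.
Qed.
Next Obligation.
move=> k; apply: fibre_set_stable; first exact: scaler_continuous.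
  by move=> a b; rewrite scalerDr.
by move=> f a fx0; rewrite /cx_act -lactZ; exact: fibre_span_gen.
Qed.
Next Obligation.
move=> a; apply: fibre_set_stable; first exact: amul_continuousr.
  by move=> b c; rewrite amulDr.
by move=> f b fx0; rewrite cx_act_amulr; exact: fibre_span_gen.
Qed.
Next Obligation.
move=> a b; apply: (@fibre_set_stable (amul^~ b)).
- exact: amul_continuousl.
- by move=> c d; rewrite amulDl.
- by move=> f c fx0; rewrite /cx_act -lactM; exact: fibre_span_gen.
Qed.
Next Obligation.
apply: fibre_set_stable; first exact: star_continuous.
  exact: starD.
move=> f a fx0; rewrite cx_act_star; apply: fibre_span_gen.
by rewrite /= /mkcts fx0 rmorph0.
Qed.

Definition fibre : normedStarAlgType R := quot_alg fibre_ideal.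

Definition fibre_pi (a : A) : fibre := quot_pi fibre_ideal a.

End Fibre.

Definition continuous_cxAlg (R : realType) (X : topologicalType)
    (A : cxAlgType R X) :=
  forall a : A, continuous (fun x => `|fibre_pi x a| : R[i]).

Definition nonzero_fibres (R : realType) (X : topologicalType)
    (A : cxAlgType R X) :=
  forall x : X, exists b : fibre A x, b != 0.

(* As usual topological spaces are non-empty: over the empty space the only
   algebra is 0, which vacuously has non-zero fibres. *)
Definition standing_hyp (R : realType) (X : topologicalType)
    (A : cxAlgType R X) (a : A) :=
  [/\ [/\ [set: X] !=set0, @second_countable X, compact [set: X] &
          hausdorff_space X],
      separable A, continuous_cxAlg A, nonzero_fibres A &
      strictly_positive a /\ `|a| <= 1].

(* Main.v *)
(** (c) => (b): if h is the square root of a in A and s, t are isometries of M(A) with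
    orthogonal ranges, the column x = (h s^*, h t^* )^T satisfies x x^* = a (+) a, and x is
    a limit of columns r_n h because A h is dense in A. (b) => (a): push r_n to the quotient.

    (a) =/=> (b), after Dixmier and Douady: X is the unit ball of l^2 with its weak
    topology; for zeta in X put h(zeta) = G (1 - |zeta><zeta|) G with G = diag(1/(k+1)),
    which is norm continuous in zeta. A is the hereditary subalgebra of C(X, B(l^2))
    generated by h, and a = h^4. Since h(zeta) has at most a one-dimensional kernel, there
    are infinite families y_j with h(zeta)^3 y_j orthonormal, which make each fibre of a
    properly infinite. If a were properly infinite, the witnesses u, v applied to two basis
    vectors would give a continuous w : X -> l^2 with h w nowhere zero, hence, after
    truncation, a continuous eta : X -> C^N nowhere proportional to zeta. This contradicts
    the Poincare-Miranda theorem for x - eta/|eta| on a finite-dimensional ball; that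
    theorem is derived from a mod 2 cup product computation on a subdivided cube.

    (b) =/=> (c): X is a point. Let p be the projection onto a hyperplane orthogonal to
    e_0; A consists of sequences F in B(l^2) converging in norm to an element of a separable
    properly infinite C*-subalgebra of p B(l^2) p, and a(n) = p + (n+1)^-2 |e_0><e_0|. The
    compression of a multiplier to e_0 is asymptotically multiplicative, which excludes two
    isometries with orthogonal ranges. *)

Require Import Defs.
From HB Require Import structures.
From mathcomp Require Import all_boot all_order all_algebra.
From mathcomp Require Import all_classical all_reals all_analysis.
From mathcomp.real_closed Require Import complex.
From mathcomp Require Import ring lra.

Set Implicit Arguments.
Unset Strict Implicit.
Unset Printing Implicit Defensive.

Import Order.TTheory GRing.Theory Num.Theory.
Import numFieldNormedType.Exports.

Local Open Scope classical_set_scope.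
Local Open Scope ring_scope.
Local Open Scope complex_scope.

(** Since [positive] only means of the form b^† b, the self-adjoint square root contains the theorem
    that such elements have no negative part. It is proved by an iteration and norm estimates alone,
    without spectra, inside the unital algebra of adjointable operators on A. The obstruction to (b)
    in the bundle example is global. In one fibre there is always an infinite orthonormal supply of
    vectors. But h w = G (1 - |zeta><zeta|) G w, so a nowhere zero h w is a nowhere zero section of
    the field of orthogonal complements of zeta, and that field has none. Since zeta is only weakly
    continuous, the compact injective G is put on both sides to make h norm continuous. In the other
    example the gap comes from the order of quantifiers. Proper infiniteness allows an error, so for
    each N the direction e_0 can be served by hand for n < N and neglected beyond, where its weight
    is small. A multiplier must serve all n at once; as it maps the corner p into elements of A,
    which are small on e_0 for large n, it acts there almost as a scalar. *)

(** * Linear identities and real-valued norms *)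

(* Reflexive decision procedure for linear identities in a module: compare the coefficients
   of both sides on the list of atoms. *)
Inductive lexp (K : Type) :=
  | LVar of nat | LZero | LAdd of lexp K & lexp K | LOpp of lexp K
  | LScale of K & lexp K.
Arguments LVar {K}.
Arguments LZero {K}.

Section LinearReflection.
Context {K : nzRingType} {V : lmodType K}.

Fixpoint leval (env : seq V) (t : lexp K) : V :=
  match t with
  | LVar i => env`_i
  | LZero => 0
  | LAdd s t => leval env s + leval env t
  | LOpp t => - leval env t
  | LScale k t => k *: leval env t
  end.

Fixpoint lcoef (t : lexp K) (i : nat) : K :=
  match t with
  | LVar j => if j == i then 1 else 0
  | LZero => 0
  | LAdd s t => lcoef s i + lcoef t i
  | LOpp t => - lcoef t i
  | LScale k t => k * lcoef t i
  end.

Lemma leval_coef env t : leval env t = \sum_(i < size env) lcoef t i *: env`_i.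
Proof.
elim: t => /= [j||s -> t ->|t ->|k t ->].
- have [jn|jn] := ltnP j (size env).
    rewrite (bigD1 (Ordinal jn))//= eqxx scale1r big1 ?addr0// => i ij.
    rewrite (_ : (j == i) = false) ?scale0r//; apply/negbTE.
    by rewrite eq_sym; exact: ij.
  rewrite nth_default// big1// => i _; rewrite (_ : (j == i) = false) ?scale0r//.
  by apply/negbTE; rewrite gtn_eqF// (leq_trans (ltn_ord i)).
- by rewrite big1// => i _; rewrite scale0r.
- by rewrite -big_split/=; apply: eq_bigr => i _; rewrite scalerDl.
- by rewrite -sumrN; apply: eq_bigr => i _; rewrite scaleNr.
- by rewrite scaler_sumr; apply: eq_bigr => i _; rewrite scalerA.
Qed.

Lemma leval_eq env s t :
  foldr (fun i P => lcoef s i = lcoef t i /\ P) True (iota 0 (size env)) ->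
  leval env s = leval env t.
Proof.
move=> st; rewrite !leval_coef; apply: eq_bigr => i _; congr (_ *: _).
have : (i : nat) \in iota 0 (size env) by rewrite mem_iota add0n ltn_ord.
elim: (iota 0 _) st => //= j l IH [jst st]; rewrite inE => /orP[/eqP ->//|].
exact: IH.
Qed.

End LinearReflection.

Ltac lin_index x l :=
  lazymatch l with
  | x :: _ => constr:(0%N)
  | _ :: ?l' => let n := lin_index x l' in constr:(n.+1)
  end.

(** The inner [match] relies on backtracking: [lin_index] fails on an atom that is not yet listed,
    and only then is the atom added. *)
Ltac lin_atoms t l :=
  lazymatch t with
  | (?a + ?b)%R => let l1 := lin_atoms a l in lin_atoms b l1
  | (- ?a)%R => lin_atoms a l
  | (?k *: ?a)%R => lin_atoms a l
  | 0%R => l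
  | ?x => match l with
          | _ => let n := lin_index x l in l
          | _ => constr:(x :: l)
          end
  end.

Ltac lin_reify K t l :=
  lazymatch t with
  | (?a + ?b)%R =>
      let s1 := lin_reify K a l in
      let s2 := lin_reify K b l in constr:(@LAdd K s1 s2)
  | (- ?a)%R => let s := lin_reify K a l in constr:(@LOpp K s)
  | (?k *: ?a)%R => let s := lin_reify K a l in constr:(@LScale K k s)
  | 0%R => constr:(@LZero K)
  | ?x => let n := lin_index x l in constr:(@LVar K n)
  end.

Ltac lin_goal :=
  lazymatch goal with
  | [ |- @eq ?T ?a ?b ] =>
      let l0 := constr:(@nil T) in
      let l1 := lin_atoms a l0 in
      let l := lin_atoms b l1 in
      lazymatch goal with
      | [ R : realType |- _ ] =>
        let K := constr:(R[i]) in
        let s := lin_reify K a l in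
        let t := lin_reify K b l in
        apply: (@leval_eq _ _ l s t); rewrite /=
      end
  end.

Ltac lin := lin_goal; do ?[split]; rewrite ?(mulr0, mulr1, addr0, add0r, oppr0); try by [ring | field].

Lemma ltr0c (R : realType) (e : R) : (0 < e%:C) = (0 < e).
Proof. by rewrite -[RHS]ltcR rmorph0. Qed.

Lemma conj_real (R : realType) (r : R) : Num.conj r%:C = r%:C.
Proof. exact: conjc_real. Qed.

Section RealNorm.
Context {R : realType} {V : normedModType R[i]}.
Implicit Types x y : V.

(** Norms take values in [R[i]], whose order is only partial. Estimates are made with this real
    form, to which [lra] and [nra] apply. *)
Definition nr x : R := complex.Re `|x|.

Lemma nrE x : `|x| = (nr x)%:C.
Proof. by rewrite /nr RRe_real// ger0_real. Qed.

Lemma nr_ge0 x : 0 <= nr x.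
Proof. by rewrite -ler0c -nrE. Qed.

Lemma nr0 : nr 0 = 0.
Proof. by rewrite /nr normr0. Qed.

Lemma nr_eq0 x : nr x = 0 -> x = 0.
Proof. by move=> x0; apply/normr0_eq0; rewrite nrE x0. Qed.

Lemma nrN x : nr (- x) = nr x.
Proof. by rewrite /nr normrN. Qed.

Lemma nrB x y : nr (x - y) = nr (y - x).
Proof. by rewrite -nrN opprB. Qed.

Lemma nrD x y : nr (x + y) <= nr x + nr y.
Proof. by rewrite -lecR rmorphD /= -!nrE ler_normD. Qed.

Lemma nr_triangle z x y : nr (x - y) <= nr (x - z) + nr (z - y).
Proof. by rewrite (le_trans _ (nrD _ _))// addrA subrK. Qed.

Lemma nrDB x y : nr x <= nr y + nr (x - y).
Proof. by rewrite (le_trans _ (nrD _ _))// addrC subrK. Qed.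

Lemma nr_dist x y : `|nr x - nr y| <= nr (x - y).
Proof.
rewrite ler_norml lerNl opprB !lerBlDr !(addrC (nr (x - y))) nrDB andbT.
by rewrite nrB nrDB.
Qed.

Lemma nr_le x (e : R) : (nr x <= e) = (`|x| <= e%:C).
Proof. by rewrite nrE lecR. Qed.

Lemma nr_small x : (forall e, 0 < e -> nr x < e) -> x = 0.
Proof.
move=> xe; apply: nr_eq0; apply/eqP; rewrite eq_le nr_ge0 andbT leNgt.
by apply/negP => /xe; rewrite ltxx.
Qed.

Lemma gtr0_cplx (e : R[i]) : 0 < e -> e = (complex.Re e)%:C.
Proof. by move=> e0; rewrite RRe_real// gtr0_real. Qed.

Lemma nr_cvgP {T} (F : set_system T) {FF : Filter F} (f : T -> V) (l : V) :
  f @ F --> l <-> forall e : R, 0 < e -> \forall t \near F, nr (f t - l) < e.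
Proof.
split=> [/cvgrPdist_lt fl e e0|fl].
  have := fl e%:C; rewrite ltr0c => /(_ e0); apply: filterS => t.
  by rewrite distrC nrE ltcR.
apply/cvgrPdist_lt => e e0; have e1 := gtr0_cplx e0.
move: e0; rewrite e1 ltr0c => /fl; apply: filterS => t.
by rewrite distrC nrE ltcR.
Qed.

Lemma nr_cvgnP (u : nat -> V) (l : V) :
  u @ \oo --> l <->
  forall e : R, 0 < e -> exists N, forall n, (N <= n)%N -> nr (u n - l) < e.
Proof.
rewrite nr_cvgP; split=> ul e /ul.
  by move=> [N _ uN]; exists N => n; exact: uN.
by move=> [N uN]; exists N => // n; exact: uN.
Qed.

Lemma nr_continuousP (T : topologicalType) (f : T -> V) :
  continuous f <->
  forall (x : T) (e : R), 0 < e -> \forall y \near x, nr (f y - f x) < e.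
Proof. by split=> fc x; [apply/nr_cvgP; exact: fc | apply/nr_cvgP; exact: fc]. Qed.

Lemma nr_closureP (S : set V) x :
  closure S x <-> forall e : R, 0 < e -> exists2 y, S y & nr (y - x) < e.
Proof.
split=> [Sx e e0|Sx B /nbhs_ballP[e/= e0 Be]].
  have [|y [Sy]] := Sx (ball x e%:C).
    by apply: nbhsx_ballx; rewrite ltr0c.
  by rewrite -ball_normE /= nrE ltcR nrB => yx; exists y.
have e1 := gtr0_cplx e0.
have [|y Sy yx] := Sx (complex.Re e); first by rewrite -ltr0c -e1.
exists y; split => //; apply: Be; rewrite -ball_normE /= e1 nrE ltcR.
by rewrite nrB.
Qed.

Definition nr_cauchy (u : nat -> V) := forall e : R, 0 < e ->
  exists N, forall m n, (N <= m)%N -> (N <= n)%N -> nr (u m - u n) < e.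

(** The uniformity has a countable base, so sequences suffice: choose [u n] such that the ball of
    radius 1/(n+1) about it belongs to [F]. Any two of these balls meet, hence [u] is Cauchy, and
    [F] converges to its limit. *)
Lemma nr_complete :
  (forall u : nat -> V, nr_cauchy u -> exists l : V, u @ \oo --> l) ->
  forall F : set_system V, ProperFilter F -> cauchy F -> cvg F.
Proof.
move=> Vc F FF /cauchyP Fc.
have inv0 n : 0 < n.+1%:R^-1 :> R by rewrite invr_gt0.
have Fn n : exists x, F (ball x (n.+1%:R^-1 : R)%:C).
  by apply: Fc; rewrite ltr0c.
have [u uF] := choice Fn.
have small (e : R) : 0 < e -> exists N, N.+1%:R^-1 < e :> R.
  by move=> /ltr_add_invr[N]; rewrite add0r; exists N.
have uu m n : nr (u m - u n) < m.+1%:R^-1 + n.+1%:R^-1.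
  have [y [my ny]] := filter_ex (filterI (uF m) (uF n)).
  move: my ny; rewrite -ball_normE /= !nrE !ltcR => my ny.
  by rewrite (le_lt_trans (nr_triangle y _ _))// ltrD// nrB.
have anti (N n : nat) : (N <= n)%N -> n.+1%:R^-1 <= N.+1%:R^-1 :> R.
  by move=> Nn; rewrite lef_pV2 ?posrE// ler_nat.
have [|l ul] := Vc u.
  move=> e e0; have e2 : 0 < e / 2 by rewrite divr_gt0.
  have [N Ne] := small _ e2.
  exists N => m n Nm Nn; rewrite (lt_trans (uu m n))// [e]splitr.
  by rewrite ltrD// (le_lt_trans _ Ne)// anti.
apply/cvg_ex; exists l; apply/cvgrPdist_lt => e e0.
have e1 := gtr0_cplx e0; move: e0; rewrite e1 ltr0c => e0.
have e2 : 0 < complex.Re e / 2 by rewrite divr_gt0.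
have [N Ne] := small _ e2.
have [M uM] := (iffLR (nr_cvgnP _ _)) ul _ e2.
apply: (filterS _ (uF (maxn N M))) => y.
rewrite -ball_normE /= !nrE !ltcR => uy.
rewrite (le_lt_trans (nr_triangle (u (maxn N M)) _ _))// (splitr (complex.Re e)).
rewrite ltrD//; first by rewrite nrB uM// leq_maxr.
by rewrite (lt_le_trans uy)// (le_trans _ (ltW Ne))// anti// leq_maxl.
Qed.

End RealNorm.

Lemma nrZ (R : realType) (V : normedModType R[i]) (k : R[i]) (x : V) :
  nr (k *: x) = nr k * nr x.
Proof.
have kE : `|k| = (nr k)%:C by exact: nrE.
by apply: complexI; rewrite rmorphM /= -!nrE normrZ kE.
Qed.

Lemma nrZR (R : realType) (V : normedModType R[i]) (k : R) (x : V) :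
  nr (k%:C *: x) = `|k| * nr x.
Proof.
rewrite nrZ; congr (_ * _); apply: complexI; rewrite -nrE normc_def /=.
by rewrite expr0n /= addr0 sqrtr_sqr.
Qed.

Lemma nr_cauchy_cvg (R : realType) (V : completeNormedModType R[i])
  (u : nat -> V) : nr_cauchy u -> exists l : V, u @ \oo --> l.
Proof.
move=> uc; have uex : cauchy_ex (u @ \oo).
  move=> e e0; have e1 := gtr0_cplx e0; move: e0; rewrite e1 ltr0c => /uc[N uN].
  exists (u N); exists N => // n /= Nn.
  by rewrite -ball_normE /= nrE ltcR uN.
have [l ul] := iffLR (cvg_ex (u @ \oo)) (@cauchy_cvg V _ _ (cauchy_exP _ uex)).
by exists l.
Qed.

(** * Adjointable operators *)

(* Common framework for the Hilbert space l^2 ([D] the scalars) and for a C*-algebra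
   seen as a Hilbert module over itself ([D] the algebra). *)
Record hilbForm (R : realType) (E D : normedModType R[i]) := HilbForm {
  ip :> E -> E -> D;
  ipDl : forall x y z, ip (x + y) z = ip x z + ip y z;
  ipDr : forall x y z, ip x (y + z) = ip x y + ip x z;
  ipZl : forall (k : R[i]) x y, ip (k *: x) y = Num.conj k *: ip x y;
  ipZr : forall (k : R[i]) x y, ip x (k *: y) = k *: ip x y;
  nr_ip : forall x y, nr (ip x y) <= nr x * nr y;
  nr_ipxx : forall x, nr (ip x x) = nr x ^+ 2
}.

Section HilbFormTheory.
Context {R : realType} {E D : normedModType R[i]} (H : hilbForm E D).
Implicit Types x y z : E.

Lemma ipNl x y : H (- x) y = - H x y.
Proof. by rewrite -scaleN1r ipZl rmorphN rmorph1 scaleN1r. Qed.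

Lemma ipNr x y : H x (- y) = - H x y.
Proof. by rewrite -scaleN1r ipZr scaleN1r. Qed.

Lemma ip0l y : H 0 y = 0.
Proof. by rewrite -(scale0r (0 : E)) ipZl rmorph0 scale0r. Qed.

Lemma ip0r y : H y 0 = 0.
Proof. by rewrite -(scale0r (0 : E)) ipZr scale0r. Qed.

Lemma ip_injl x y : (forall z, H x z = H y z) -> x = y.
Proof.
move=> xy; apply/eqP; rewrite -subr_eq0; apply/eqP/nr_eq0/eqP.
rewrite -sqrf_eq0 -(nr_ipxx H) ipDl ipNl xy.
by rewrite subrr nr0.
Qed.

(** The adjoint is data because operators on a Hilbert module need not have one; it is determined by
    [ap], see [adj_ext]. Linearity is not a field, since it follows from the adjoint relation and
    the nondegeneracy of the form. *)
Record adj : Type := Adj {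
  ap :> E -> E;
  ad : E -> E;
  adP : forall x y, H (ap x) y = H x (ad y);
  adP' : forall x y, H (ad x) y = H x (ap y);
  ap_bounded : exists C : R, forall x, nr (ap x) <= C * nr x
}.

Implicit Types S T : adj.

Lemma ad_bound T (C : R) : 0 <= C ->
  (forall x, nr (T x) <= C * nr x) -> forall x, nr (ad T x) <= C * nr x.
Proof.
move=> C0 TC x; have [->|x0] := eqVneq (nr (ad T x)) 0.
  by rewrite mulr_ge0// nr_ge0.
have x1 : 0 < nr (ad T x) by rewrite lt_def x0 nr_ge0.
rewrite -(ler_pM2r x1) -expr2 -(nr_ipxx H) -adP (le_trans (nr_ip _ _ _))//.
by rewrite mulrAC ler_wpM2r// nr_ge0.
Qed.

Lemma adj_ext S T : S =1 T -> S = T.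
Proof.
case: S T => [s s' p1 p2 p3] [t t' q1 q2 q3] /= /funext st; subst t.
have st : s' = t'.
  by apply/funext => x; apply: ip_injl => z; rewrite p2 q2.
by subst t'; congr Adj; exact: Prop_irrelevance.
Qed.

Lemma apD T x y : T (x + y) = T x + T y.
Proof. by apply: ip_injl => z; rewrite adP !ipDl !adP. Qed.

Lemma apZ T k x : T (k *: x) = k *: T x.
Proof. by apply: ip_injl => z; rewrite adP !ipZl !adP. Qed.

Lemma ap0 T : T 0 = 0.
Proof. by have := apZ T 0 0; rewrite !scale0r. Qed.

Lemma apN T x : T (- x) = - T x.
Proof. by rewrite -scaleN1r apZ scaleN1r. Qed.

Lemma apB T x y : T (x - y) = T x - T y.
Proof. by rewrite apD apN. Qed.

Lemma ap_bounded_pos T : exists2 C : R, 0 <= C & forall x, nr (T x) <= C * nr x.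
Proof.
have [C TC] := ap_bounded T; exists `|C| => // x.
by rewrite (le_trans (TC x))// ler_wpM2r ?nr_ge0// ler_norm.
Qed.

Definition opn T : R := inf [set C | 0 <= C /\ forall x, nr (T x) <= C * nr x].

Lemma opn_has_inf T :
  has_inf [set C | 0 <= C /\ forall x, nr (T x) <= C * nr x].
Proof.
split; last by exists 0 => C [].
by have [C C0 TC] := ap_bounded_pos T; exists C.
Qed.

Lemma opn_ge0 T : 0 <= opn T.
Proof. by apply: lb_le_inf; [case: (opn_has_inf T) | move=> C []]. Qed.

Lemma opn_le T C : 0 <= C -> (forall x, nr (T x) <= C * nr x) -> opn T <= C.
Proof. by move=> C0 TC; apply: ge_inf => //; case: (opn_has_inf T). Qed.

Lemma ap_le T x : nr (T x) <= opn T * nr x.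
Proof.
have [x0|x0] := eqVneq (nr x) 0.
  by rewrite (nr_eq0 x0) ap0 nr0 mulr0.
have x1 : 0 < nr x by rewrite lt_def x0 nr_ge0.
rewrite -ler_pdivrMr//; apply: lb_le_inf; first by case: (opn_has_inf T).
by move=> C [C0 TC]; rewrite ler_pdivrMr.
Qed.

Lemma ad_le T x : nr (ad T x) <= opn T * nr x.
Proof. by apply: ad_bound; [exact: opn_ge0 | exact: ap_le]. Qed.

Program Definition adj_zero := @Adj (fun=> 0) (fun=> 0) _ _ _.
Next Obligation. by move=> x y; rewrite ip0l ip0r. Qed.
Next Obligation. by move=> x y; rewrite ip0l ip0r. Qed.
Next Obligation. by exists 0 => x; rewrite nr0 mul0r. Qed.

Program Definition adj_one := @Adj id id _ _ _.
Next Obligation. by []. Qed.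
Next Obligation. by []. Qed.
Next Obligation. by exists 1 => x; rewrite mul1r. Qed.

Program Definition adjN T := @Adj (fun x => - T x) (fun x => - ad T x) _ _ _.
Next Obligation. by move=> T x y; rewrite ipNl ipNr adP. Qed.
Next Obligation. by move=> T x y; rewrite ipNl ipNr adP'. Qed.
Next Obligation.
by move=> T; exists (opn T) => x; rewrite nrN; exact: ap_le. Qed.

Program Definition adjD S T :=
  @Adj (fun x => S x + T x) (fun x => ad S x + ad T x) _ _ _.
Next Obligation. by move=> S T x y; rewrite ipDl ipDr !adP. Qed.
Next Obligation. by move=> S T x y; rewrite ipDl ipDr !adP'. Qed.
Next Obligation.
move=> S T; exists (opn S + opn T) => x.
by rewrite (le_trans (nrD _ _))// mulrDl lerD// ap_le.
Qed.

Program Definition adjZ (k : R[i]) T :=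
  @Adj (fun x => k *: T x) (fun x => Num.conj k *: ad T x) _ _ _.
Next Obligation. by move=> k T x y; rewrite ipZl ipZr adP. Qed.
Next Obligation. by move=> k T x y; rewrite ipZl ipZr adP' conjCK. Qed.
Next Obligation.
move=> k T; exists (nr k * opn T) => x.
by rewrite nrZ -mulrA ler_wpM2l ?nr_ge0// ap_le.
Qed.

Program Definition adjM S T :=
  @Adj (fun x => S (T x)) (fun x => ad T (ad S x)) _ _ _.
Next Obligation. by move=> S T x y; rewrite !adP. Qed.
Next Obligation. by move=> S T x y; rewrite !adP'. Qed.
Next Obligation.
move=> S T; exists (opn S * opn T) => x.
by rewrite (le_trans (ap_le _ _))// -mulrA ler_wpM2l ?opn_ge0// ap_le.
Qed.

Program Definition adjS T := @Adj (ad T) T _ _ _.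
Next Obligation. by move=> T x y; rewrite adP'. Qed.
Next Obligation. by move=> T x y; rewrite adP. Qed.
Next Obligation. by move=> T; exists (opn T); exact: ad_le. Qed.

HB.instance Definition _ := gen_eqMixin adj.
HB.instance Definition _ := gen_choiceMixin adj.

Lemma adj_addA : associative adjD.
Proof. by move=> S T U; apply: adj_ext => x /=; rewrite addrA. Qed.

Lemma adj_addC : commutative adjD.
Proof. by move=> S T; apply: adj_ext => x /=; rewrite addrC. Qed.

Lemma adj_add0 : left_id adj_zero adjD.
Proof. by move=> S; apply: adj_ext => x /=; rewrite add0r. Qed.

Lemma adj_addN : left_inverse adj_zero adjN adjD.
Proof. by move=> S; apply: adj_ext => x /=; rewrite addNr. Qed.

HB.instance Definition _ := GRing.isZmodule.Build adj
  adj_addA adj_addC adj_add0 adj_addN.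

Lemma adj_scaleA k l T : adjZ k (adjZ l T) = adjZ (k * l) T.
Proof. by apply: adj_ext => x /=; rewrite scalerA. Qed.

Lemma adj_scale1 : left_id 1 adjZ.
Proof. by move=> T; apply: adj_ext => x /=; rewrite scale1r. Qed.

Lemma adj_scaleDr : right_distributive adjZ +%R.
Proof. by move=> k S T; apply: adj_ext => x /=; rewrite scalerDr. Qed.

Lemma adj_scaleDl T : {morph adjZ^~ T : k l / k + l}.
Proof. by move=> k l; apply: adj_ext => x /=; rewrite scalerDl. Qed.

HB.instance Definition _ := GRing.Zmodule_isLmodule.Build R[i] adj
  adj_scaleA adj_scale1 adj_scaleDr adj_scaleDl.

Definition adj_norm T : R[i] := (opn T)%:C.

Lemma adj_normD S T : adj_norm (S + T) <= adj_norm S + adj_norm T.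
Proof.
rewrite /adj_norm -rmorphD lecR; apply: opn_le.
  by rewrite addr_ge0// opn_ge0.
by move=> x; rewrite (le_trans (nrD _ _))// mulrDl lerD// ap_le.
Qed.

Lemma opnZ_le (k : R[i]) T : opn (k *: T) <= nr k * opn T.
Proof.
apply: opn_le; first by rewrite mulr_ge0 ?nr_ge0 ?opn_ge0.
by move=> x; rewrite nrZ -mulrA ler_wpM2l ?nr_ge0// ap_le.
Qed.

Lemma adj_normZ k T : adj_norm (k *: T) = `|k| * adj_norm T.
Proof.
have kE : `|k| = (nr k)%:C by exact: nrE.
rewrite kE /adj_norm -rmorphM; congr (_%:C).
apply/eqP; rewrite eq_le opnZ_le/=.
have [k0|k0] := eqVneq k 0.
  by rewrite k0 nr0 mul0r opn_ge0.
have nk : 0 < nr k by rewrite -ltr0c -kE normr_gt0.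
have := opnZ_le k^-1 (k *: T); rewrite scalerA mulVf// scale1r.
rewrite -(ler_pM2l nk) mulrA.
have -> : nr k * nr (k^-1 : R[i]) = 1.
  apply: complexI; rewrite rmorphM rmorph1 /=.
  have -> : (nr (k^-1 : R[i]))%:C = `|k^-1| by rewrite -nrE.
  by rewrite -kE -normrM mulfV// normr1.
by rewrite mul1r.
Qed.

Lemma adj_norm0_eq0 T : adj_norm T = 0 -> T = 0.
Proof.
move=> /(congr1 (@complex.Re R))/= T0; apply: adj_ext => x.
by apply: nr_eq0; apply/eqP; rewrite eq_le nr_ge0 andbT (le_trans (ap_le _ _))// T0 mul0r.
Qed.

HB.instance Definition _ := Lmodule_isNormed.Build R[i] adj
  adj_normD adj_normZ adj_norm0_eq0.

Lemma nr_ap T x : nr (T x) <= nr T * nr x.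
Proof. exact: ap_le. Qed.

Lemma nr_ad T x : nr (ad T x) <= nr T * nr x.
Proof. exact: ad_le. Qed.

Lemma nr_adj_le T C : 0 <= C -> (forall x, nr (T x) <= C * nr x) -> nr T <= C.
Proof. exact: opn_le. Qed.

Lemma adj_mulA : associative adjM.
Proof. by move=> S T U; exact: adj_ext. Qed.

Lemma adj_mulDl : left_distributive adjM +%R.
Proof. by move=> S T U; exact: adj_ext. Qed.

Lemma adj_mulDr : right_distributive adjM +%R.
Proof. by move=> S T U; apply: adj_ext => x /=; rewrite apD. Qed.

Lemma adj_mulZl k S T : adjM (k *: S) T = k *: adjM S T.
Proof. exact: adj_ext. Qed.

Lemma adj_mulZr k S T : adjM S (k *: T) = k *: adjM S T.
Proof. by apply: adj_ext => x /=; rewrite apZ. Qed.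

Lemma adj_starK : involutive adjS.
Proof. by move=> T; exact: adj_ext. Qed.

Lemma adj_starD : {morph adjS : S T / S + T}.
Proof. by move=> S T; exact: adj_ext. Qed.

Lemma adj_starZ (k : R[i]) T : adjS (k *: T) = Num.conj k *: adjS T.
Proof. exact: adj_ext. Qed.

Lemma adj_starM S T : adjS (adjM S T) = adjM (adjS T) (adjS S).
Proof. exact: adj_ext. Qed.

Lemma adj_norm_mul S T : `|adjM S T| <= `|S| * `|T|.
Proof.
rewrite !nrE -rmorphM lecR; apply: nr_adj_le.
  by rewrite mulr_ge0// nr_ge0.
move=> x; rewrite -mulrA (le_trans (nr_ap S (T x)))//.
by rewrite ler_wpM2l ?nr_ge0// nr_ap.
Qed.

Lemma adj_norm_star T : `|adjS T| = `|T|.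
Proof.
have le S : nr (adjS S) <= nr S.
  by apply: nr_adj_le; [exact: nr_ge0 | exact: ad_le].
rewrite !nrE; congr (_%:C); apply/eqP; rewrite eq_le le/=.
by rewrite -{1}(adj_starK T) le.
Qed.

HB.instance Definition _ := NormedModule_isStarAlgebra.Build R adj
  adj_mulA adj_mulDl adj_mulDr adj_mulZl adj_mulZr
  adj_starK adj_starD adj_starZ adj_starM adj_norm_mul adj_norm_star.

(** The essential inequality reads |T x|^2 = |<x, T^† T x>| as a bound on [T] by the square root of
    the norm of T^† T. *)
Lemma adj_cstar T : `|T^† ⋅ T| = `|T| ^+ 2.
Proof.
rewrite !nrE -rmorphXn; congr (_%:C); apply/eqP; rewrite eq_le.
apply/andP; split.
  have := norm_amul T^† T; rewrite norm_star !nrE -rmorphM lecR.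
  by rewrite -expr2.
have h x : nr (T x) ^+ 2 <= nr (T^† ⋅ T) * nr x ^+ 2.
  rewrite -(nr_ipxx H) adP (le_trans (nr_ip _ _ _))// mulrC expr2 mulrA.
  by rewrite ler_wpM2r ?nr_ge0//; exact: (nr_ap (T^† ⋅ T)).
rewrite -[leRHS]sqr_sqrtr ?nr_ge0// ler_sqr ?nnegrE ?nr_ge0 ?sqrtr_ge0//.
apply: nr_adj_le => [|x]; first exact: sqrtr_ge0.
rewrite -ler_sqr ?nnegrE ?nr_ge0 ?mulr_ge0 ?nr_ge0 ?sqrtr_ge0//.
by rewrite exprMn sqr_sqrtr ?nr_ge0.
Qed.

End HilbFormTheory.

Section HilbFormComplete.
Context {R : realType} {E : completeNormedModType R[i]} {D : normedModType R[i]}.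
Variable H : hilbForm E D.

Lemma nr_cvg_near (V : normedModType R[i]) (u : nat -> V) l (C e : R) :
  u @ \oo --> l -> 0 <= C -> 0 < e ->
  exists N, forall n, (N <= n)%N -> C * nr (u n - l) < e.
Proof.
move=> /nr_cvgnP ul C0 e0; have C1 : 0 < C + 1 by rewrite ltr_wpDl.
have [N uN] := ul _ (divr_gt0 e0 C1); exists N => n Nn.
rewrite (@le_lt_trans _ _ ((C + 1) * nr (u n - l)))//.
  by rewrite ler_wpM2r ?nr_ge0// lerDl.
by rewrite mulrC -ltr_pdivlMr// uN.
Qed.

Lemma hilb_limit_adjoint (s t : nat -> E) (a b x y : E) :
  s @ \oo --> a -> t @ \oo --> b ->
  (forall n, H (s n) y = H x (t n)) -> H a y = H x b.
Proof.
move=> sa tb st; apply/eqP; rewrite -subr_eq0; apply/eqP/nr_small => e e0.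
have e2 : 0 < e / 2 by rewrite divr_gt0.
have [N sN] := nr_cvg_near sa (nr_ge0 y) e2.
have [M tM] := nr_cvg_near tb (nr_ge0 x) e2.
pose n := maxn N M; rewrite (le_lt_trans (nr_triangle (H (s n) y) _ _))//.
rewrite (splitr e) ltrD//.
  rewrite -ipNl -ipDl (le_lt_trans (nr_ip _ _ _))// nrB mulrC sN//.
  exact: leq_maxl.
rewrite st -ipNr -ipDr (le_lt_trans (nr_ip _ _ _))// tM//.
exact: leq_maxr.
Qed.

Lemma nr_lim_le (V : normedModType R[i]) (u : nat -> V) l v (C : R) :
  u @ \oo --> l -> (exists N, forall n, (N <= n)%N -> nr (u n - v) <= C) ->
  nr (l - v) <= C.
Proof.
move=> /nr_cvgnP ul [N uN]; apply/ler_addgt0Pr => e /ul[M uM].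
pose n := maxn N M; rewrite (le_trans (nr_triangle (u n) _ _))// addrC.
by rewrite lerD ?uN ?leq_maxl// nrB ltW// uM// leq_maxr.
Qed.

Lemma adj_complete (F : set_system (adj H)) :
  ProperFilter F -> cauchy F -> cvg F.
Proof.
apply: nr_complete => u uc.
have uc1 x : nr_cauchy (fun n => u n x).
  move=> e e0; have x1 : 0 < nr x + 1 by rewrite ltr_wpDl ?nr_ge0.
  have [N uN] := uc _ (divr_gt0 e0 x1); exists N => m n Nm Nn.
  rewrite (le_lt_trans (nr_ap (u m - u n) x))//.
  rewrite (@le_lt_trans _ _ (nr (u m - u n) * (nr x + 1)))//.
    by rewrite ler_wpM2l ?nr_ge0// lerDl.
  by rewrite -ltr_pdivlMr// uN.
have uc2 x : nr_cauchy (fun n => ad (u n) x).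
  move=> e e0; have x1 : 0 < nr x + 1 by rewrite ltr_wpDl ?nr_ge0.
  have [N uN] := uc _ (divr_gt0 e0 x1); exists N => m n Nm Nn.
  rewrite (le_lt_trans (nr_ad (u m - u n) x))//.
  rewrite (@le_lt_trans _ _ (nr (u m - u n) * (nr x + 1)))//.
    by rewrite ler_wpM2l ?nr_ge0// lerDl.
  by rewrite -ltr_pdivlMr// uN.
have [l lE] := choice (fun x => nr_cauchy_cvg (uc1 x)).
have [l' l'E] := choice (fun x => nr_cauchy_cvg (uc2 x)).
have near_l (e : R) : 0 < e -> exists N, forall n, (N <= n)%N ->
    forall x, nr (l x - u n x) <= e * nr x.
  move=> e0; have [N uN] := uc _ e0; exists N => n Nn x.
  apply: (nr_lim_le (lE x)); exists N => m Nm.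
  rewrite (le_trans (nr_ap (u m - u n) x))//.
  by rewrite ler_wpM2r ?nr_ge0// ltW// uN.
have lP x y : H (l x) y = H x (l' y).
  by apply: hilb_limit_adjoint (lE x) (l'E y) _ => n; rewrite adP.
have lP' x y : H (l' x) y = H x (l y).
  by apply: hilb_limit_adjoint (l'E x) (lE y) _ => n; rewrite adP'.
have lB : exists C : R, forall x, nr (l x) <= C * nr x.
  have [N /(_ N (leqnn _)) uN] := near_l 1 ltr01.
  exists (nr (u N) + 1) => x; rewrite (le_trans (nrDB _ (u N x)))// mulrDl.
  by rewrite lerD ?uN ?nr_ap.
exists (Adj lP lP' lB); apply/nr_cvgnP => e e0.
have e2 : 0 < e / 2 by rewrite divr_gt0.
have [N uN] := near_l _ e2; exists N => n Nn.
rewrite (@le_lt_trans _ _ (e / 2))//; last by rewrite ltr_pdivrMr// ltr_pMr// ltr1n.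
by apply: nr_adj_le => [|x]; [exact: ltW | rewrite /= nrB uN].
Qed.

HB.instance Definition _ := Uniform_isComplete.Build (adj H) adj_complete.

HB.instance Definition _ := NormedStarAlgebra_isCStar.Build R (adj H) (@adj_cstar R E D H).

End HilbFormComplete.

Section SelfModule.
Context {R : realType} (A : cstarAlgType R).

Lemma self_ip_norm (a b : A) : nr (a^† ⋅ b) <= nr a * nr b.
Proof.
rewrite -lecR rmorphM /= -!nrE.
by rewrite -(norm_star a) norm_amul.
Qed.

Lemma self_ipDl (a b c : A) : (a + b)^† ⋅ c = a^† ⋅ c + b^† ⋅ c.
Proof. by rewrite starD amulDl. Qed.

Lemma self_ipZl (k : R[i]) (a b : A) : (k *: a)^† ⋅ b = Num.conj k *: (a^† ⋅ b).
Proof. by rewrite starZ amulZl. Qed.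

Lemma self_ipxx (a : A) : nr (a^† ⋅ a) = nr a ^+ 2.
Proof. by apply: complexI; rewrite -nrE cstar_identity nrE rmorphXn. Qed.

(** The adjointable operators for this form are a unital C*-algebra containing [A] isometrically by
    left multiplication; it replaces a unitization of [A] when roots are taken. *)
Definition self_form : hilbForm A A :=
  @HilbForm R A A (fun a b => a^† ⋅ b) self_ipDl (fun a b c => amulDr a^† b c)
    self_ipZl (fun k a b => amulZr k a^† b) self_ip_norm self_ipxx.

End SelfModule.

(** * Square roots of positive contractions *)

Section CStarNorm.
Context {R : realType} {A : normedStarAlgType R}.
Implicit Types a b : A.

Lemma nrM a b : nr (a ⋅ b) <= nr a * nr b.
Proof. by rewrite -lecR rmorphM /= -!nrE norm_amul. Qed.

Lemma nr_star a : nr a^† = nr a.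
Proof. by apply: complexI; rewrite -!nrE norm_star. Qed.

End CStarNorm.

Section CStarNorm2.
Context {R : realType} {A : cstarAlgType R}.
Implicit Types a b : A.

Lemma nr_cstar a : nr (a^† ⋅ a) = nr a ^+ 2.
Proof. exact: self_ipxx. Qed.

Lemma nr_sa_sqr a : a^† = a -> nr (a ⋅ a) = nr a ^+ 2.
Proof. by move=> sa; rewrite -nr_cstar sa. Qed.

End CStarNorm2.

Section SquareRoot.
Context {R : realType} (U : cstarAlgType R) (e : U).
Hypotheses (e1l : forall x, e ⋅ x = x) (e1r : forall x, x ⋅ e = x).
Implicit Types a b c d g h x y : U.

Lemma star_unit : e^† = e.
Proof. by rewrite -[LHS]e1r -{2}(starK e) -starM e1r starK. Qed.

Lemma nr_unit : nr e <= 1.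
Proof.
have := nr_cstar e; rewrite star_unit e1l; have := nr_ge0 e.
by move: (nr e) => r; nra.
Qed.

Fixpoint sqrt_iter h n : U :=
  if n is n'.+1 then (2^-1 : R)%:C *: (h + sqrt_iter h n' ⋅ sqrt_iter h n')
  else 0.

(** The same iteration for the number 1. It dominates the norms of the [sqrt_iter] and of their
    differences, so convergence is read off a bounded monotone real sequence, even when [h] has norm
    exactly 1. *)
Fixpoint sqrt_bound n : R :=
  if n is n'.+1 then 2^-1 * (1 + sqrt_bound n' ^+ 2) else 0.

Lemma sqrt_bound_ge0 n : 0 <= sqrt_bound n.
Proof. by case: n => //= n; rewrite mulr_ge0 ?invr_ge0// addr_ge0// sqr_ge0. Qed.

Lemma sqrt_bound_le1 n : sqrt_bound n <= 1.
Proof.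
elim: n => //= n IH; have := sqrt_bound_ge0 n.
move: (sqrt_bound n) IH => r; nra.
Qed.

Lemma sqrt_bound_nd : nondecreasing_seq sqrt_bound.
Proof.
apply/nondecreasing_seqP => n; elim: n => [|n IH].
  exact: (sqrt_bound_ge0 1).
have E m : sqrt_bound m.+1 = 2^-1 * (1 + sqrt_bound m ^+ 2) by [].
rewrite [leLHS](E n) [leRHS](E n.+1) ler_wpM2l ?invr_ge0// lerD2l.
by rewrite ler_sqr ?nnegrE ?sqrt_bound_ge0.
Qed.

Lemma sqrt_bound_cvg : sqrt_bound @ \oo --> (1 : R).
Proof.
have cv : cvgn sqrt_bound.
  apply: nondecreasing_is_cvgn; first exact: sqrt_bound_nd.
  by exists 1 => _ [n _ <-]; exact: sqrt_bound_le1.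
have /cvg_ex[l rl] := cv; suff -> : 1 = l by [].
have rS : (fun n => sqrt_bound n.+1) @ \oo --> l by rewrite cvg_shiftS.
have rS' : (fun n => sqrt_bound n.+1) @ \oo --> 2^-1 * (1 + l ^+ 2).
  apply: cvgM; first exact: cvg_cst.
  apply: cvgD; first exact: cvg_cst.
  by rewrite expr2; apply: cvgM.
have E := norm_cvg_unique rS rS'.
apply/eqP; rewrite eq_sym -subr_eq0 -sqrf_eq0; apply/eqP.
have : l * 2 = 1 + l ^+ 2 by rewrite [in LHS]E; field.
by lra.
Qed.

Lemma sqrt_iter_le h : nr h <= 1 -> forall n, nr (sqrt_iter h n) <= sqrt_bound n.
Proof.
move=> h1; elim=> [|n IH] /=; first by rewrite nr0.
rewrite nrZR ger0_norm ?invr_ge0// ler_wpM2l ?invr_ge0//.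
rewrite (le_trans (nrD _ _))// lerD// (le_trans (nrM _ _))// expr2.
by rewrite ler_pM// nr_ge0.
Qed.

Lemma sqrt_iter_dist h : nr h <= 1 -> forall n k,
  nr (sqrt_iter h (n + k) - sqrt_iter h n) <= sqrt_bound (n + k) - sqrt_bound n.
Proof.
move=> h1; elim=> [k|n IH k] /=; first by rewrite !subr0 sqrt_iter_le.
rewrite -scalerBr nrZR ger0_norm ?invr_ge0// -mulrBr ler_wpM2l ?invr_ge0//.
set s := sqrt_iter h (n + k); set t := sqrt_iter h n.
(* A factorisation that needs no commutativity and has the same shape as (p - q)(p + q) for the
   bounds. *)
have -> : h + s ⋅ s - (h + t ⋅ t) = (s - t) ⋅ s + t ⋅ (s - t).
  by rewrite amulDl amulDr amulNl amulNr; lin.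
rewrite (le_trans (nrD _ _))// (le_trans (lerD (nrM _ _) (nrM _ _)))//.
rewrite [nr t * _]mulrC -mulrDr.
have -> (p q : R) : 1 + p ^+ 2 - (1 + q ^+ 2) = (p - q) * (p + q) by ring.
by rewrite ler_pM ?addr_ge0 ?nr_ge0 ?IH// lerD// sqrt_iter_le.
Qed.

(* The limit [y] of [y_(n+1) = (h + y_n^2) / 2] satisfies [(e - y)^2 = e - h]. *)
Lemma cstar_sqrt h : h^† = h -> nr h <= 1 -> exists y,
  [/\ y^† = y, nr y <= 1, y + y = h + y ⋅ y,
      (forall x, x ⋅ h = h ⋅ x -> x ⋅ y = y ⋅ x) &
      forall S : set U, closed S -> (forall a b, S a -> S b -> S (a + b)) ->
        (forall (k : R[i]) a, S a -> S (k *: a)) ->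
        (forall a b, S a -> S b -> S (a ⋅ b)) -> S (e - h) -> S (e - y)].
Proof.
move=> sh h1; pose u := sqrt_iter h.
have bc : forall eps : R, 0 < eps -> exists N, forall n, (N <= n)%N ->
    1 - sqrt_bound n < eps.
  move=> eps eps0; have := sqrt_bound_cvg => /cvgrPdist_lt/(_ _ eps0)[N _ bN].
  by exists N => n /bN; rewrite ger0_norm// subr_ge0 sqrt_bound_le1.
have uc : nr_cauchy u.
  have step (eps : R) N m n : (forall n, (N <= n)%N -> 1 - sqrt_bound n < eps) ->
      (N <= m)%N -> (m <= n)%N -> nr (u n - u m) < eps.
    move=> bN Nm mn; rewrite -(subnKC mn) (le_lt_trans (sqrt_iter_dist h1 _ _))//.
    by rewrite (le_lt_trans _ (bN _ Nm))// lerB// sqrt_bound_le1.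
  move=> eps /bc[N bN]; exists N => m n Nm Nn.
  by case/orP: (leq_total m n) => mn; [rewrite nrB|]; apply: (step _ N).
have [y uy] := nr_cauchy_cvg uc.
have lim (f g : U -> U) : continuous f -> continuous g ->
    (forall n, f (u n) = g (u n)) -> f y = g y.
  move=> fc gc fg; apply: (@norm_cvg_unique _ _ (f \o u @ \oo)).
    by apply: cvg_comp uy _; exact: fc.
  rewrite (_ : f \o u = g \o u); last by apply/funext => n; exact: fg.
  by apply: cvg_comp uy _; exact: gc.
have uS : (fun n => u n.+1) @ \oo --> y by rewrite cvg_shiftS.
have sy : y^† = y.
  apply: (lim star id) => [|x|n]; [exact: star_continuous|exact: cvg_id|].
  elim: n => [|n IH] /=; first exact: star0.
  by rewrite /u /= starZ starD starM sh IH conj_real.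
have y1 : nr y <= 1.
  rewrite -[y]subr0; apply: nr_lim_le uy _; exists 0%N => n _.
  by rewrite subr0 (le_trans (sqrt_iter_le h1 n))// sqrt_bound_le1.
have yy : y + y = h + y ⋅ y.
  have uu : (fun n => (2^-1 : R)%:C *: (h + u n ⋅ u n)) @ \oo -->
      (2^-1 : R)%:C *: (h + y ⋅ y).
    apply: cvgZr; apply: cvgD; first exact: cvg_cst.
    apply/nr_cvgnP => eps eps0.
    have eps2 : 0 < eps / 2 by rewrite divr_gt0.
    have [N uN] := iffLR (nr_cvgnP _ _) uy _ eps2.
    exists N => n Nn.
    have -> : u n ⋅ u n - y ⋅ y = (u n - y) ⋅ u n + y ⋅ (u n - y).
      by rewrite amulDl amulDr amulNl amulNr addrA subrK.
    rewrite (le_lt_trans (nrD _ _))// (splitr eps) ltrD//.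
      rewrite (le_lt_trans (nrM _ _))// (le_lt_trans _ (uN _ Nn))//.
      rewrite ler_piMr ?nr_ge0// (le_trans (sqrt_iter_le h1 n))//.
      exact: sqrt_bound_le1.
    rewrite (le_lt_trans (nrM _ _))// (le_lt_trans _ (uN _ Nn))//.
    by rewrite ler_piMl ?nr_ge0.
  have E : y = (2^-1 : R)%:C *: (h + y ⋅ y).
    exact: norm_cvg_unique uS uu.
  rewrite {1 2}E -scalerDl -rmorphD.
  rewrite (_ : 2^-1 + 2^-1 = 1 :> R) ?rmorph1 ?scale1r//.
  by field.
exists y; split=> //.
- move=> x xh; apply: (lim (amul x) (amul^~ x)) => [||n].
  + exact: amul_continuousr.
  + exact: amul_continuousl.
  + elim: n => [|n IH]; first by rewrite amulr0 amul0r.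
    rewrite /u /= amulZr amulZl amulDr amulDl xh; congr (_ *: (_ + _)).
    by rewrite amulA IH -amulA IH amulA.
- move=> S Sc SD SZ SM Se.
  (* [S] need not contain [e]. With the scalar [sqrt_bound n] in front of [e], the difference is a
     polynomial in [e - h] without constant term; the scalar tends to 1. *)
  have Su n : S ((sqrt_bound n)%:C *: e - u n).
    elim: n => [|n IH] /=.
      rewrite rmorph0 scale0r subrr; have := SZ 0 _ Se.
      by rewrite scale0r.
    set r := sqrt_bound n; set v := u n.
    have -> : (2^-1 * (1 + r ^+ 2))%:C *: e - u n.+1 = (2^-1 : R)%:C *:
        ((e - h) + ((2 * r)%:C *: (r%:C *: e - v) +
          (-1) *: ((r%:C *: e - v) ⋅ (r%:C *: e - v)))).
      rewrite (_ : u n.+1 = (2^-1 : R)%:C *: (h + v ⋅ v))//.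
      rewrite !(amulDl, amulDr, amulNl, amulNr, amulZl, amulZr, e1l, e1r).
      lin.
    apply: (SZ); apply: (SD) => //; apply: (SD); first exact: SZ.
    by apply: (SZ); exact: SM.
  rewrite (closure_id S).1//; apply/nr_closureP => eps eps0.
  have eps2 : 0 < eps / 2 by rewrite divr_gt0.
  have [N bN] := bc _ eps2.
  have [M uM] := iffLR (nr_cvgnP _ _) uy _ eps2.
  pose n := maxn N M; exists ((sqrt_bound n)%:C *: e - u n) => //.
  have -> : (sqrt_bound n)%:C *: e - u n - (e - y) =
      (sqrt_bound n - 1)%:C *: e - (u n - y) by lin.
  rewrite (le_lt_trans (nrD _ _))// (splitr eps) ltrD//; last first.
    by rewrite nrN uM// leq_maxr.
  rewrite nrZR distrC ger0_norm ?subr_ge0 ?sqrt_bound_le1//.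
  rewrite (le_lt_trans _ (bN n (leq_maxl _ _)))//.
  by rewrite ler_piMr ?nr_unit// subr_ge0 sqrt_bound_le1.
Qed.

End SquareRoot.

Section PositiveSquares.
Context {R : realType} (U : cstarAlgType R) (e : U).
Hypotheses (e1l : forall x, e ⋅ x = x) (e1r : forall x, x ⋅ e = x).
Implicit Types a b c d g h x y : U.

Let amE := (@amulDl R U, @amulDr R U, @amulNl R U, @amulNr R U, @amulZl R U,
  @amulZr R U, e1l, e1r).

Lemma nr_i (R' : realType) : nr ('i : R'[i]) = 1.
Proof. by apply: complexI; rewrite -nrE normCi. Qed.

Lemma star_unit_sub x : (e - x)^† = e - x^†.
Proof. by rewrite starD starN (star_unit e1r). Qed.

(** With d a self-adjoint root of e - h^2 commuting with h, the element u = h + i d satisfies u^† u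
    = e. Its imaginary part d is therefore a contraction, and so is d^2. *)
Lemma nr_sub_sqr h : h^† = h -> nr h <= 1 -> nr (e - h ⋅ h) <= 1.
Proof.
move=> sh h1.
have shh : (h ⋅ h)^† = h ⋅ h by rewrite starM sh.
have hh1 : nr (h ⋅ h) <= 1.
  by rewrite (le_trans (nrM _ _))// mulr_ile1 ?nr_ge0.
have [y [sy _ yy hy _]] := cstar_sqrt e1l e1r shh hh1.
have {}hy : h ⋅ y = y ⋅ h by apply: hy; rewrite amulA.
pose d := e - y; have sd : d^† = d by rewrite star_unit_sub sy.
have dd : d ⋅ d = e - h ⋅ h.
  rewrite /d !amE; have -> : h ⋅ h = y + y - y ⋅ y by rewrite yy addrK.
  lin.
have hd : h ⋅ d = d ⋅ h by rewrite /d !amE hy.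
clearbody d.
pose u := h + 'i *: d.
have su : u^† = h - 'i *: d by rewrite /u starD starZ sh sd conjCi scaleNr.
have uu : u^† ⋅ u = e.
  by rewrite su /u !amE hd dd !scalerA -expr2 sqrCi; lin.
have u1 : nr u <= 1.
  rewrite -(@ler_pXn2r _ 2)// ?nnegrE ?nr_ge0// -nr_cstar uu expr1n.
  exact: nr_unit.
have d1 : nr d <= 1.
  have -> : d = (2^-1 : R)%:C *: ((- 'i) *: (u - u^†)).
    rewrite su /u; have -> : h + 'i *: d - (h - 'i *: d) = (2 : R)%:C *: ('i *: d) by lin.
    rewrite !scalerA; set k := _ * _; suff -> : k = 1 by rewrite scale1r.
    have -> : k = - ((2^-1 : R) * 2)%:C * ('i * 'i) by rewrite /k; ring.
    by rewrite -expr2 sqrCi mulVf// rmorph1 mulrNN mulr1.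
  rewrite nrZR ger0_norm ?invr_ge0// nrZ nrN nr_i mul1r.
  rewrite ler_pdivrMl// mulr1 (le_trans (nrD _ _))// nrN nr_star.
  by rewrite (le_trans (lerD u1 u1)).
by rewrite -dd nr_sa_sqr// exprn_ile1 ?nr_ge0.
Qed.

(** Two applications of [cstar_sqrt]: if y is the limit for e - a^2, then k = e - y is the absolute
    value of a; if z is the limit for y, then l = e - z is the square root of k. *)
Lemma cstar_abs a : a^† = a -> nr a <= 1 -> exists k l,
  [/\ l^† = l, l ⋅ l = k, k ⋅ k = a ⋅ a, nr k <= 2 /\ a ⋅ l = l ⋅ a &
      forall S : set U, closed S -> (forall a b, S a -> S b -> S (a + b)) ->
        (forall (k : R[i]) a, S a -> S (k *: a)) ->
        (forall a b, S a -> S b -> S (a ⋅ b)) -> S (a ⋅ a) -> S l].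
Proof.
move=> sa a1.
have sh : (e - a ⋅ a)^† = e - a ⋅ a by rewrite star_unit_sub starM sa.
have [y [sy y1 yy hy Sy]] := cstar_sqrt e1l e1r sh (nr_sub_sqr sa a1).
have [z [sz z1 zz hz Sz]] := cstar_sqrt e1l e1r sy y1.
exists (e - y), (e - z); split; [| | |split|].
- by rewrite star_unit_sub sz.
- rewrite !amE; have -> : y = z + z - z ⋅ z by rewrite zz addrK.
  lin.
- rewrite !amE; have -> : a ⋅ a = e - (y + y - y ⋅ y) by rewrite yy; lin.
  lin.
- rewrite (le_trans (nrD _ _))// nrN (le_trans (lerD (nr_unit e1l e1r) y1))//.
- rewrite !amE; congr (_ - _); apply: hz; apply: hy.
  by rewrite !amE amulA.
- move=> S Sc SD SZ SM Sa; apply: Sz => //; apply: Sy => //.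
  by rewrite opprB addrC subrK.
Qed.

(** Let d be self-adjoint with d^2 = e - (e + g^2)^2, commuting with g, and w = d + i sqrt(2) g.
    Then w^† w = - g^4, so |w| = |g|^2, whereas the skew part of w gives sqrt(2) |g| <= |w|. As |g|
    <= 1, this leaves only g = 0. *)
Lemma sqr_contraction_eq0 g :
  g^† = g -> nr g <= 1 -> nr (e + g ⋅ g) <= 1 -> g = 0.
Proof.
move=> sg g1 v1; pose v := e + g ⋅ g.
have sv : v^† = v by rewrite starD (star_unit e1r) starM sg.
have svv : (v ⋅ v)^† = v ⋅ v by rewrite starM sv.
have vv1 : nr (v ⋅ v) <= 1 by rewrite (le_trans (nrM _ _))// mulr_ile1 ?nr_ge0.
have [y [sy _ yy hy _]] := cstar_sqrt e1l e1r svv vv1.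
have gv : g ⋅ v = v ⋅ g by rewrite /v !amE amulA.
have {}hy : g ⋅ y = y ⋅ g by apply: hy; rewrite amulA gv -amulA gv amulA.
pose d := e - y; have sd : d^† = d by rewrite star_unit_sub sy.
pose q := g ⋅ g.
have dd : d ⋅ d = - (q + q + q ⋅ q).
  rewrite /d !amE; have -> : y ⋅ y = y + y - v ⋅ v by rewrite yy addrC addKr.
  by rewrite /v -/q !amE; lin.
have gd : g ⋅ d = d ⋅ g by rewrite /d !amE hy.
clearbody d.
pose s : R := Num.sqrt 2.
have ss : s * s = 2 by rewrite -expr2 sqr_sqrtr.
have [t tt tJ] : exists2 t : R[i], t * t = - (2 : R)%:C & Num.conj t = - t /\ nr t = s.
  exists ('i * s%:C).
    by rewrite mulrACA -expr2 sqrCi -rmorphM ss mulN1r.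
  have -> (z1 z2 : R[i]) : Num.conj (z1 * z2) = Num.conj z1 * Num.conj z2.
    exact: rmorphM.
  rewrite conjCi conj_real mulNr; split=> //.
  have := nrZ 'i (s%:C : R[i]); rewrite nr_i mul1r => ->.
  have := nrZR s (1 : R[i]); rewrite /GRing.scale/= mulr1 => ->.
  by rewrite /nr normr1 mulr1 ger0_norm// sqrtr_ge0.
case: tJ => tJ nt.
pose w := d + t *: g.
have sw : w^† = d - t *: g by rewrite /w starD starZ sg sd tJ scaleNr.
have ww : w^† ⋅ w = - (q ⋅ q).
  rewrite sw /w !amE gd dd -/q !scalerA tt.
  by lin.
have sq : q^† = q by rewrite starM sg.
have nw : nr w = nr g ^+ 2.
  apply/eqP; rewrite -(@eqrXn2 _ 2) ?nr_ge0 ?sqr_ge0//.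
  by rewrite -(nr_cstar w) ww nrN nr_sa_sqr// /q nr_sa_sqr.
have : nr ((2 : R)%:C *: (t *: g)) <= nr w + nr w.
  have -> : (2 : R)%:C *: (t *: g) = w - w^† by rewrite sw /w; lin.
  by rewrite (le_trans (nrD _ _))// nrN nr_star.
have s0 : 0 <= s by rewrite sqrtr_ge0.
rewrite nrZR nrZ nt ger0_norm// nw => H.
apply: nr_eq0; have := nr_ge0 g; move: (nr g) g1 H => r r1 H r0.
by nra.
Qed.

(** Solving for q^2 gives e + q^2/5 = ((e - p^2) + 2 (e - r^2) + 2 (e - s^2))/5. By [nr_sub_sqr] its
    norm is at most (1 + 2 + 2)/5 = 1, so the previous lemma applies to q / sqrt(5). *)
Lemma nr_sum_sqr_eq0 (p q r s : U) :
  p^† = p -> q^† = q -> r^† = r -> s^† = s ->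
  nr p <= 1 -> nr q <= 1 -> nr r <= 1 -> nr s <= 1 ->
  q ⋅ q + p ⋅ p + (2 : R)%:C *: (r ⋅ r) + (2 : R)%:C *: (s ⋅ s) = 0 -> q = 0.
Proof.
move=> sp sq sr ss p1 q1 r1 s1 E.
pose k : R := (Num.sqrt 5)^-1.
have k0 : 0 <= k by rewrite invr_ge0 sqrtr_ge0.
have kk : k * k = 5^-1 by rewrite -expr2 exprVn sqr_sqrtr.
have kq : k%:C *: q = 0.
  apply: sqr_contraction_eq0.
  - by rewrite starZ conj_real sq.
  - rewrite nrZR ger0_norm//.
    have k1 : k <= 1 by nra.
    by rewrite mulr_ile1 ?nr_ge0.
  - rewrite !amE scalerA -rmorphM kk.
    have -> : q ⋅ q = - (p ⋅ p) - (2 : R)%:C *: (r ⋅ r) - (2 : R)%:C *: (s ⋅ s).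
      by apply/eqP; rewrite -subr_eq0 -E; apply/eqP; lin.
    have -> : e + 5^-1%:C *: (- (p ⋅ p) - (2 : R)%:C *: (r ⋅ r) - (2 : R)%:C *: (s ⋅ s)) =
      5^-1%:C *: ((e - p ⋅ p) + ((2 : R)%:C *: (e - r ⋅ r) + (2 : R)%:C *: (e - s ⋅ s))).
      by lin.
    rewrite nrZR ger0_norm ?invr_ge0// ler_pdivrMl// mulr1.
    have P : nr (e - p ⋅ p) <= 1 by exact: nr_sub_sqr.
    have P2 : nr (e - r ⋅ r) <= 1 by exact: nr_sub_sqr.
    have P3 : nr (e - s ⋅ s) <= 1 by exact: nr_sub_sqr.
    rewrite (le_trans (nrD _ _))// (le_trans (lerD P (nrD _ _)))//.
    by rewrite !nrZR ger0_norm//; lra.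
have : (k^-1)%:C *: (k%:C *: q) = 0 by rewrite kq scaler0.
by rewrite scalerA -rmorphM mulVf ?rmorph1 ?scale1r// invr_eq0 sqrtr_eq0 -ltNge.
Qed.

(* With [D = c y] and [P = c c^*], the self-adjoint squares [P^2] and [y^4] add up with
   [D D^* + D^* D] to zero. *)
Lemma cstar_neg_sqr_eq0 c y : nr c <= 1 -> y^† = y -> c^† ⋅ c = - (y ⋅ y) -> c = 0.
Proof.
move=> c1 sy E.
have ny : nr y = nr c.
  apply/eqP; rewrite -(@eqrXn2 _ 2) ?nr_ge0//.
  by rewrite -nr_sa_sqr// -(nr_cstar c) E nrN.
pose D := c ⋅ y; pose P := c ⋅ c^†.
have nD : nr D <= 1 by rewrite (le_trans (nrM _ _))// mulr_ile1 ?nr_ge0 ?ny.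
(* Up to sign the real and imaginary parts of D, so that D D^† + D^† D = 2 r^2 + 2 s^2. *)
pose r := (2^-1 : R)%:C *: (D + D^†); pose s := (2^-1 : R)%:C *: ('i *: (D - D^†)).
have sr : r^† = r by rewrite /r starZ conj_real starD starK addrC.
have ss : s^† = s.
  by rewrite /s !starZ conj_real conjCi starD starN starK scaleNr -scalerN opprB addrC.
have r1 : nr r <= 1.
  rewrite nrZR ger0_norm ?invr_ge0// ler_pdivrMl// mulr1 (le_trans (nrD _ _))//.
  by rewrite nr_star; lra.
have s1 : nr s <= 1.
  rewrite nrZR ger0_norm ?invr_ge0// ler_pdivrMl// mulr1 nrZ nr_i mul1r.
  by rewrite (le_trans (nrD _ _))// nrN nr_star; lra.
have sP : P^† = P by rewrite starM starK.
have P1 : nr P <= 1 by rewrite (le_trans (nrM _ _))// nr_star mulr_ile1 ?nr_ge0.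
have Q1 : nr (y ⋅ y) <= 1 by rewrite (le_trans (nrM _ _))// ny mulr_ile1 ?nr_ge0.
have DD : D ⋅ D^† = - (P ⋅ P).
  rewrite /D starM sy /P -!amulA (amulA c^† c) E amulNl amulNr opprK.
  by rewrite -!amulA.
have DD' : D^† ⋅ D = - ((y ⋅ y) ⋅ (y ⋅ y)).
  by rewrite /D starM sy -!amulA (amulA c^† c) E amulNl amulNr -!amulA.
have yy0 : y ⋅ y = 0.
  apply: (@nr_sum_sqr_eq0 P _ r s) => //; first by rewrite starM sy.
  have -> : P ⋅ P = - (D ⋅ D^†) by rewrite DD opprK.
  have -> : y ⋅ y ⋅ (y ⋅ y) = - (D^† ⋅ D) by rewrite DD' opprK.
  have -> : r ⋅ r = (4^-1 : R)%:C *: ((D + D^†) ⋅ (D + D^†)).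
    rewrite /r amulZl amulZr scalerA -rmorphM; congr (_%:C *: _).
    by field.
  have -> : s ⋅ s = - ((4^-1 : R)%:C *: ((D - D^†) ⋅ (D - D^†))).
    rewrite /s !amulZl !amulZr !scalerA -scaleNr; congr (_ *: _).
    transitivity ((2^-1 * 2^-1 : R)%:C * ('i * 'i) : R[i]); first by ring.
    by rewrite -(expr2 'i) sqrCi mulrN1; congr (- (_%:C)); field.
  by rewrite !amE; lin.
apply: nr_eq0; rewrite -ny; apply/eqP; rewrite -sqrf_eq0 -nr_sa_sqr//.
by rewrite yy0 nr0.
Qed.

(** Let k be the absolute value of a = b^† b and n = k - a, twice the negative part of a. Then n a n
    = - (l n)^2, so c = b n satisfies c^† c = - (l n)^2 and vanishes by [cstar_neg_sqr_eq0]. Hence a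
    n = 0, which with n^2 = 2 k n forces n = 0. *)
Lemma cstar_positive_sqrt b : nr b <= 1 -> exists l,
  [/\ l^† = l, l ⋅ l = b^† ⋅ b &
      forall S : set U, closed S -> (forall a b, S a -> S b -> S (a + b)) ->
        (forall (k : R[i]) a, S a -> S (k *: a)) ->
        (forall a b, S a -> S b -> S (a ⋅ b)) ->
        S (b^† ⋅ b ⋅ (b^† ⋅ b)) -> S l].
Proof.
move=> b1; pose a := b^† ⋅ b.
have sa : a^† = a by rewrite /a starM starK.
have a1 : nr a <= 1 by rewrite nr_cstar exprn_ile1 ?nr_ge0.
have aD : a = b^† ⋅ b by [].
rewrite -aD; clearbody a.
have [k [l [sl ll kk [k2 al] Sl]]] := cstar_abs sa a1.
exists l; split=> //.
pose n := k - a.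
have ak : a ⋅ k = k ⋅ a by rewrite -ll amulA al -!amulA al.
have sk : k^† = k by rewrite -ll starM sl.
have sn : n^† = n by rewrite /n starD starN sk sa.
have an : a ⋅ n = n ⋅ a by rewrite /n !amE ak.
have kn : k ⋅ n = n ⋅ k by rewrite /n !amE ak.
have kl : k ⋅ l = l ⋅ k by rewrite -ll amulA.
have ln : l ⋅ n = n ⋅ l by rewrite /n !amE kl al.
have nn : n ⋅ n = k ⋅ n + k ⋅ n by rewrite /n !amE ak -kk; lin.
have aE : a = k - n by rewrite /n opprB addrC subrK.
have n3 : nr n <= 3 by rewrite (le_trans (nrD _ _))// nrN; lra.
clearbody n.
have nan : n ⋅ a ⋅ n = - ((l ⋅ n) ⋅ (l ⋅ n)).
  have -> : l ⋅ n ⋅ (l ⋅ n) = k ⋅ (k ⋅ n) + k ⋅ (k ⋅ n).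
    by rewrite -amulA (amulA n) -ln -amulA amulA ll nn amulDr.
  rewrite -an -amulA nn {1}aE !amE.
  have -> : n ⋅ (k ⋅ n) = k ⋅ (k ⋅ n) + k ⋅ (k ⋅ n).
    by rewrite amulA -kn -amulA nn amulDr.
  by lin.
have bn0 : b ⋅ n = 0.
  (* [cstar_neg_sqr_eq0] asks for a contraction, and n is bounded by 3. *)
  have c0 : (3^-1 : R)%:C *: (b ⋅ n) = 0.
    apply: (@cstar_neg_sqr_eq0 _ ((3^-1 : R)%:C *: (l ⋅ n))).
    - rewrite nrZR ger0_norm ?invr_ge0// ler_pdivrMl// mulr1.
      rewrite (le_trans (nrM _ _))//.
      by have := nr_ge0 b; have := nr_ge0 n; nra.
    - by rewrite starZ conj_real starM sl sn ln.
    - rewrite starZ conj_real !amE starM sn -amulA (amulA b^†) -aD amulA nan.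
      by rewrite !scalerA scalerN.
  have : (3 : R)%:C *: ((3^-1 : R)%:C *: (b ⋅ n)) = 0 by rewrite c0 scaler0.
  by rewrite scalerA -rmorphM mulfV// rmorph1 scale1r.
have an0 : a ⋅ n = 0 by rewrite aD -amulA bn0 amulr0.
have kn0 : k ⋅ n = 0.
  have : k ⋅ n = k ⋅ n + k ⋅ n by rewrite -nn; move: an0; rewrite aE amulDl amulNl => /eqP; rewrite subr_eq0 => /eqP.
  by move/eqP; rewrite -subr_eq0 opprD addNKr oppr_eq0 => /eqP.
have n0 : n = 0.
  apply: nr_eq0; apply/eqP; rewrite -sqrf_eq0 -nr_sa_sqr//.
  by rewrite nn kn0 addr0 nr0.
by rewrite ll aE n0 subr0.
Qed.

End PositiveSquares.

(** * The implications *)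

Lemma cvg_mxP (T : topologicalType) (m n : nat) (S : Type) (F : set_system S)
    {FF : Filter F} (f : S -> 'M[T]_(m, n)) (M : 'M[T]_(m, n)) :
  f @ F --> M <-> forall i j, (fun s => f s i j) @ F --> M i j.
Proof.
split=> [fM i j B MB|fM B [P MP PB]].
  have MB' : nbhs M [set N : 'M[T]_(m, n) | B (N i j)].
    exists (fun i' j' => if (i' == i) && (j' == j) then B else setT).
      move=> i' j'; case: ifP => [/andP[/eqP -> /eqP ->]//|_].
      exact: filterT.
    by move=> N /(_ i j); rewrite !eqxx.
  by have := fM _ MB'.
have Pf : \forall s \near F, forall ij : 'I_m * 'I_n, P ij.1 ij.2 (f s ij.1 ij.2).
  by apply: filter_forall => -[i j] /=; exact: fM (MP i j).
by apply: filterS Pf => s Ps; apply: PB => i j; exact: (Ps (i, j)).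
Qed.

(** Serves for products, for evaluation of operators at vectors and for [theta]. The last is
    conjugate linear in its second argument, hence only additivity is asked for. *)
Lemma cvg_biadditive (R : realType) (V W Z : normedModType R[i]) (m : V -> W -> Z)
    (S : Type) (F : set_system S) {FF : Filter F} (f : S -> V) (g : S -> W) (a : V) (b : W) :
  (forall x y z, m (x + y) z = m x z + m y z) ->
  (forall x y z, m x (y + z) = m x y + m x z) ->
  (forall x y, nr (m x y) <= nr x * nr y) ->
  f @ F --> a -> g @ F --> b -> (fun s => m (f s) (g s)) @ F --> m a b.
Proof.
move=> mDl mDr mle /nr_cvgP fa /nr_cvgP gb; apply/nr_cvgP => e e0.
have a1 : 0 < 2 * (nr a + 1) by rewrite mulr_gt0// ltr_wpDl// nr_ge0.
have b1 : 0 < 2 * (nr b + 1) by rewrite mulr_gt0// ltr_wpDl// nr_ge0.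
have := fa _ (divr_gt0 e0 b1); have := gb _ (divr_gt0 e0 a1); have := gb _ ltr01.
apply: filterS3 => s g1 ge fe.
have -> : m (f s) (g s) - m a b = m a (g s - b) + m (f s - a) (g s).
  have -> : m (f s) (g s) = m (a + (f s - a)) (g s) by rewrite addrC subrK.
  have -> : m a (g s - b) = m a (g s) - m a b.
    by apply/eqP; rewrite eq_sym subr_eq -mDr subrK.
  by rewrite mDl; lin.
rewrite (le_lt_trans (nrD _ _))// (splitr e) ltrD//.
  rewrite (le_lt_trans (mle _ _))// (@le_lt_trans _ _ ((nr a + 1) * nr (g s - b)))//.
    by rewrite ler_wpM2r ?nr_ge0// lerDl.
  move: ge; rewrite invfM mulrA ltr_pdivlMr ?ltr_wpDl ?nr_ge0//.
  by rewrite mulrC.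
rewrite (le_lt_trans (mle _ _))// (@le_lt_trans _ _ (nr (f s - a) * (nr b + 1)))//.
  rewrite ler_wpM2l ?nr_ge0// (le_trans (nrDB _ b))// lerD2l ltW//.
by move: fe; rewrite invfM mulrA ltr_pdivlMr// ltr_wpDl// nr_ge0.
Qed.

Section NormedStarAlgLimits.
Context {R : realType} {B : normedStarAlgType R}.

Lemma cvg_amul (S : Type) (F : set_system S) {FF : Filter F} (f g : S -> B) (a b : B) :
  f @ F --> a -> g @ F --> b -> (fun n => f n ⋅ g n) @ F --> a ⋅ b.
Proof.
apply: cvg_biadditive => [x y z|x y z|x y]; [exact: amulDl|exact: amulDr|].
by rewrite -lecR rmorphM /= -!nrE norm_amul.
Qed.

Lemma cvg_star (S : Type) (F : set_system S) {FF : Filter F} (f : S -> B) (a : B) :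
  f @ F --> a -> (fun n => (f n)^†) @ F --> a^†.
Proof. by move=> fa; apply: (cvg_comp _ _ fa); exact: star_continuous. Qed.

Lemma conj_mxE (b : B) m (r : 'M[B]_(m, 1)) i j :
  amulmx (amulmx r (mx11 b)) (starmx r) i j = r i ord0 ⋅ b ⋅ (r j ord0)^†.
Proof. by rewrite !mxE big_ord1 !mxE big_ord1 !mxE. Qed.

(** The matrix r in [cuntz_le] is a column (u, v). The remaining entry v b u^† of r b r^† is the
    adjoint of u b v^† because b is self-adjoint. *)
Lemma properly_infiniteP (b : B) : b^† = b -> properly_infinite b <->
  b != 0 /\ exists u v : nat -> B,
    [/\ (fun n => u n ⋅ b ⋅ (u n)^†) @ \oo --> b,
        (fun n => v n ⋅ b ⋅ (v n)^†) @ \oo --> b &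
        (fun n => u n ⋅ b ⋅ (v n)^†) @ \oo --> 0].
Proof.
move=> sb; split=> -[b0 br]; split=> //.
  have [r /cvg_mxP rb] := br; pose i0 := lshift 1 (@ord0 0).
  pose i1 := rshift 1 (@ord0 0).
  exists (fun n => r n i0 ord0), (fun n => r n i1 ord0); split.
  - have := rb i0 i0; rewrite block_mxEul mxE.
    by under eq_fun do rewrite conj_mxE.
  - have := rb i1 i1; rewrite block_mxEdr mxE.
    by under eq_fun do rewrite conj_mxE.
  - have := rb i0 i1; rewrite block_mxEur mxE.
    by under eq_fun do rewrite conj_mxE.
have [u [v [uu vv uv]]] := br.
have vu : (fun n => v n ⋅ b ⋅ (u n)^†) @ \oo --> 0.
  have -> : (fun n => v n ⋅ b ⋅ (u n)^†) = (fun n => (u n ⋅ b ⋅ (v n)^†)^†).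
    by apply/funext => n; rewrite !starM starK sb amulA.
  by rewrite -(star0 (A := B)); exact: cvg_star.
exists (fun n => col_mx (mx11 (u n)) (mx11 (v n))); apply/cvg_mxP => i j.
under eq_fun do rewrite conj_mxE.
case: (@split_ordP 1 1 i) => {}i ->; case: (@split_ordP 1 1 j) => {}j ->.
- by rewrite block_mxEul mxE; under eq_fun do rewrite !col_mxEu !mxE.
- by rewrite block_mxEur mxE; under eq_fun do rewrite col_mxEu col_mxEd !mxE.
- by rewrite block_mxEdl mxE; under eq_fun do rewrite col_mxEu col_mxEd !mxE.
- by rewrite block_mxEdr mxE; under eq_fun do rewrite !col_mxEd !mxE.
Qed.

End NormedStarAlgLimits.

Section Quotients.
Context {R : realType} {A : normedStarAlgType R} (I : closed_ideal A).

Lemma nr_quot_pi (a : A) : nr (quot_pi I a) <= nr a.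
Proof.
have -> : nr (quot_pi I a) = quot_rnorm (quot_pi I a) by [].
apply: ge_inf; last by exists a.
by exists 0 => _ [b _ <-]; exact: (nr_ge0 b).
Qed.

Lemma quot_pi_eq0 (a : A) : quot_pi I a = 0 <-> I a.
Proof.
by rewrite -(quot_pi0 I); split=> [/quot_piP|]; rewrite ?subr0// => Ia;
  apply/quot_piP; rewrite subr0.
Qed.

Lemma quot_piN (a : A) : quot_pi I (- a) = - quot_pi I a.
Proof. by rewrite -scaleN1r quot_piZ scaleN1r. Qed.

Lemma quot_piM (a b : A) : quot_pi I (a ⋅ b) = quot_pi I a ⋅ quot_pi I b.
Proof. by rewrite -quot_mulE. Qed.

Lemma quot_piS (a : A) : quot_pi I a^† = (quot_pi I a)^†.
Proof. by rewrite -quot_starE. Qed.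

Lemma quot_pi_cvg (f : nat -> A) (a : A) :
  f @ \oo --> a -> (fun n => quot_pi I (f n)) @ \oo --> quot_pi I a.
Proof.
move=> /nr_cvgnP fa; apply/nr_cvgnP => e /fa[N fN]; exists N => n Nn.
by rewrite -quot_piN -quot_piD (le_lt_trans (nr_quot_pi _))// fN.
Qed.

Lemma properly_infinite_quot (a : A) : a^† = a -> quot_pi I a != 0 ->
  properly_infinite a -> properly_infinite (quot_pi I a).
Proof.
move=> sa a0 /(properly_infiniteP sa)[_ [u [v [uu vv uv]]]].
apply/properly_infiniteP; first by rewrite -quot_piS sa.
split=> //; exists (fun n => quot_pi I (u n)), (fun n => quot_pi I (v n)).
have E f g : (fun n => quot_pi I (f n) ⋅ quot_pi I a ⋅ (quot_pi I (g n))^†) =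
    (fun n => quot_pi I (f n ⋅ a ⋅ (g n)^†)).
  by apply/funext => n; rewrite !quot_piM quot_piS.
rewrite !E; split; try exact: quot_pi_cvg.
by rewrite -(quot_pi0 I); exact: quot_pi_cvg.
Qed.

End Quotients.

(** If [a] were in the fibre ideal, so would be the dense set of all a c a, hence all of [A]. *)
Lemma strictly_positive_fibre_neq0 (R : realType) (X : topologicalType)
    (A : cxAlgType R X) (a : A) (x : X) :
  strictly_positive a -> (exists b : fibre A x, b != 0) -> fibre_pi x a != 0.
Proof.
move=> [_ ad] [b]; apply: contra => /eqP /quot_pi_eq0 Ia.
rewrite -[b]quot_reprK; apply/eqP/quot_pi_eq0; move: (quot_repr b) => {}b.
rewrite (closure_id (fibre_ideal A x)).1; last exact: ideal_closed.
apply/nr_closureP => e e0.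
have [|d [/= bE [c _ cE]]] := ad (ball b e%:C) _ (ball_open _ _).
  by exists b; apply: ballxx; rewrite ltr0c.
rewrite -cE in bE; exists (a ⋅ c ⋅ a).
  exact: (@idealMl _ _ (fibre_ideal A x) (a ⋅ c) a Ia).
by move: bE; rewrite -ball_normE /= nrE ltcR nrB.
Qed.

(** * Left multiplication as an embedding, and square roots in a possibly non-unital algebra *)

Section LeftMultiplication.
Context {R : realType} (A : cstarAlgType R).
Implicit Types a b c : A.

Program Definition lmult a : adj (self_form A) :=
  @Adj R A A (self_form A) (amul a) (amul a^†) _ _ _.
Next Obligation. by move=> a x y /=; rewrite starM amulA. Qed.
Next Obligation. by move=> a x y /=; rewrite starM starK amulA. Qed.
Next Obligation. by move=> a; exists (nr a) => x; rewrite nrM. Qed.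

Lemma lmultD a b : lmult (a + b) = lmult a + lmult b.
Proof. by apply: adj_ext => x /=; rewrite amulDl. Qed.

Lemma lmultZ (k : R[i]) a : lmult (k *: a) = k *: lmult a.
Proof. by apply: adj_ext => x /=; rewrite amulZl. Qed.

Lemma lmultM a b : lmult (a ⋅ b) = lmult a ⋅ lmult b.
Proof. by apply: adj_ext => x /=; rewrite amulA. Qed.

Lemma lmultS a : lmult a^† = (lmult a)^†.
Proof. by apply: adj_ext. Qed.

Lemma nr_lmult a : nr (lmult a) = nr a.
Proof.
apply/eqP; rewrite eq_le; apply/andP; split.
  by apply: nr_adj_le => [|x]; [exact: nr_ge0 | exact: nrM].
have := nr_ap (lmult a) a^†; rewrite /= -{1}(starK a) nr_cstar !nr_star.
have [->|a0] := eqVneq (nr a) 0; first by rewrite nr_ge0.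
by rewrite expr2 ler_pM2r// lt_def a0 nr_ge0.
Qed.

Lemma lmultB a b : lmult (a - b) = lmult a - lmult b.
Proof. by rewrite lmultD -scaleN1r lmultZ scaleN1r. Qed.

Lemma lmult_inj : injective lmult.
Proof.
move=> a b ab; apply/eqP; rewrite -subr_eq0; apply/eqP/nr_eq0.
by rewrite -nr_lmult lmultB ab subrr nr0.
Qed.

Lemma lmult_range_closed : closed (range lmult : set (adj (self_form A))).
Proof.
move=> T /nr_closureP TA.
have inv0 n : 0 < n.+1%:R^-1 :> R by rewrite invr_gt0.
have h n : exists a, nr (lmult a - T) < n.+1%:R^-1 :> R.
  by have [_ [a _ <-] aT] := TA _ (inv0 n); exists a.
have [u uT] := choice h.
have uT' : (fun n => lmult (u n)) @ \oo --> T.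
  apply/nr_cvgnP => e /ltr_add_invr[N]; rewrite add0r => Ne; exists N => n Nn.
  by rewrite (lt_trans (uT n))// (le_lt_trans _ Ne)// lef_pV2 ?posrE// ler_nat.
have [e|a ua] := @nr_cauchy_cvg _ _ u.
  move=> e0; have e2 : 0 < e / 2 by rewrite divr_gt0.
  have [N uN] := iffLR (nr_cvgnP _ _) uT' _ e2; exists N => m n Nm Nn.
  rewrite -nr_lmult lmultB (le_lt_trans (nr_triangle T _ _))// (splitr e).
  by rewrite ltrD ?uN// nrB uN.
exists a => //; apply: norm_cvg_unique uT'.
apply/nr_cvgnP => e e0; have [N uN] := iffLR (nr_cvgnP _ _) ua _ e0.
by exists N => n Nn; rewrite -lmultB nr_lmult uN.
Qed.

(** The root is taken among the adjointable operators, where there is a unit. It lies in every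
    closed subalgebra containing the square of b^† b, in particular in the closed copy of [A]. *)
Lemma positive_sqrt a : positive a -> nr a <= 1 ->
  exists h, h^† = h /\ h ⋅ h = a.
Proof.
move=> [b ->] b1.
have {}b1 : nr (lmult b) <= 1.
  by rewrite nr_lmult -(@ler_pXn2r _ 2)// ?nnegrE ?nr_ge0// -nr_cstar expr1n.
have [|x|l [sl ll Sl]] := @cstar_positive_sqrt _ _ (adj_one (self_form A)) _ _ _ b1.
- by move=> x; exact: adj_ext.
- exact: adj_ext.
have [||||c _ cl] := Sl (range lmult) lmult_range_closed.
- by move=> _ _ [c _ <-] [d _ <-]; exists (c + d); rewrite ?lmultD.
- by move=> k _ [c _ <-]; exists (k *: c); rewrite ?lmultZ.
- by move=> _ _ [c _ <-] [d _ <-]; exists (c ⋅ d); rewrite ?lmultM.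
- by exists (b^† ⋅ b ⋅ (b^† ⋅ b)); rewrite ?lmultM ?lmultS.
exists c; split; apply: lmult_inj; first by rewrite lmultS cl.
by rewrite !lmultM lmultS cl ll.
Qed.

End LeftMultiplication.

Section MultiplierIsometries.
Context {R : realType} (A : cstarAlgType R).
Implicit Types s t : multiplier A.

Lemma mult_star_mul_act s t (y z : A) :
  (lact s y)^† ⋅ lact t z = y^† ⋅ lact (mult_star s * t) z.
Proof.
by rewrite /= -starM centralizer starM starK.
Qed.

Lemma multiplier_properly_infinite_strictly_positive (a : A) :
  strictly_positive a -> nr a <= 1 -> a != 0 ->
  multiplier_properly_infinite A -> properly_infinite a.
Proof.
move=> [ap ad] a1 a0 [s [t [ss tt st]]].
have [h [sh hh]] := positive_sqrt ap a1.
have sa : a^† = a by rewrite -hh starM sh.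
(* Multiply the orthogonality of the range projections by s^† on the left and by t on the right. *)
have st0 : mult_star s * t = 0.
  rewrite -[LHS]mul1r -[1]ss -[LHS]mulr1 -[1]tt.
  by rewrite -!mulrA (mulrA t) (mulrA s) (mulrA (s * _)) st mul0r mulr0.
(* Each a b a equals (a b h) h, so the left multiples of [h] are dense. They are used to approximate
   h s^† and h t^†, which are the adjoints of [lact s h] and [lact t h]. *)
have dn (c : A) n : exists d : A, nr (d ⋅ h - c) < n.+1%:R^-1.
  have e0 : 0 < n.+1%:R^-1 :> R by rewrite invr_gt0.
  have [|d [/= cb [b _ bE]]] := ad (ball c (n.+1%:R^-1 : R)%:C) _ (ball_open _ _).
    by exists c; apply: ballxx; rewrite ltr0c.
  exists (a ⋅ b ⋅ h); rewrite -amulA hh bE.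
  by move: cb; rewrite -ball_normE /= nrE ltcR nrB.
have [u uE] := choice (dn (lact s h)^†).
have [v vE] := choice (dn (lact t h)^†).
have lim (w : nat -> A) c : (forall n, nr (w n ⋅ h - c) < n.+1%:R^-1) ->
    (fun n => w n ⋅ h) @ \oo --> c.
  move=> wE; apply/nr_cvgnP => e /ltr_add_invr[N]; rewrite add0r => Ne.
  exists N => n Nn; rewrite (lt_trans (wE n))// (le_lt_trans _ Ne)//.
  by rewrite lef_pV2 ?posrE// ler_nat.
have E f g : (fun n => f n ⋅ a ⋅ (g n)^†) = (fun n => (f n ⋅ h) ⋅ (g n ⋅ h)^†).
  by apply/funext => n; rewrite starM sh -hh !amulA.
have {}uE := lim _ _ uE; have {}vE := lim _ _ vE.
apply/properly_infiniteP => //; split=> //; exists u, v; rewrite !E; split.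
- have := cvg_amul (FF := eventually_filter) uE (cvg_star (FF := eventually_filter) uE).
  by rewrite starK mult_star_mul_act ss /= sh hh.
- have := cvg_amul (FF := eventually_filter) vE (cvg_star (FF := eventually_filter) vE).
  by rewrite starK mult_star_mul_act tt /= sh hh.
- have := cvg_amul (FF := eventually_filter) uE (cvg_star (FF := eventually_filter) vE).
  by rewrite starK mult_star_mul_act st0 /= amulr0.
Qed.

End MultiplierIsometries.

Lemma proposition4p3_implications (R : realType) (X : topologicalType)
    (A : cxAlgType R X) (a : A) : standing_hyp a ->
  (multiplier_properly_infinite A -> properly_infinite a) /\
  (properly_infinite a -> forall x : X, properly_infinite (fibre_pi x a)).
Proof.
move=> [[[x _] _ _ _] _ _ nf [sp a1]].
have a0 y : fibre_pi y a != 0 by exact: strictly_positive_fibre_neq0 sp (nf y).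
have sa : a^† = a by have [[b ->] _] := sp; rewrite starM starK.
split=> [Mpi|api y]; last exact: (properly_infinite_quot sa (a0 y) api).
apply: multiplier_properly_infinite_strictly_positive => //.
  by rewrite nr_le rmorph1.
by apply: contraNneq (a0 x) => ->; rewrite /fibre_pi quot_pi0.
Qed.

(** * The Hilbert space of square-summable sequences *)

Section ComplexModulus.
Context {R : realType}.
Implicit Types z w : R[i].

Lemma nr_mul z w : nr (z * w) = nr z * nr w.
Proof. exact: (nrZ z (w : R[i])). Qed.

Lemma nr_one : nr (1 : R[i]) = 1.
Proof. by apply: complexI; rewrite -nrE normr1. Qed.

Lemma nr_conj z : nr (Num.conj z) = nr z.
Proof. by apply: complexI; rewrite -!nrE norm_conjC. Qed.

Lemma nr_real (r : R) : nr (r%:C : R[i]) = `|r|.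
Proof. by have := nrZR r (1 : R[i]); rewrite nr_one mulr1 /GRing.scale/= mulr1. Qed.

Lemma conjM z w : Num.conj (z * w) = Num.conj z * Num.conj w.
Proof. exact: rmorphM. Qed.

Lemma conj_mulE z : Num.conj z * z = (nr z ^+ 2)%:C.
Proof. by rewrite rmorphXn /= -nrE mulrC -normCK. Qed.

Lemma nr_sqrE z : nr z ^+ 2 = complex.Re z ^+ 2 + complex.Im z ^+ 2.
Proof. by apply: complexI; rewrite rmorphXn /= -nrE -add_Re2_Im2. Qed.

Lemma Re_le_nr z : `|complex.Re z| <= nr z.
Proof. by rewrite -lecR -nrE normc_ge_Re. Qed.

Lemma Im_le_nr z : `|complex.Im z| <= nr z.
Proof.
rewrite -ler_sqr ?nnegrE ?nr_ge0// nr_sqrE -normrX ger0_norm ?sqr_ge0//.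
by rewrite lerDr sqr_ge0.
Qed.

Lemma nr_le_ReIm z : nr z <= `|complex.Re z| + `|complex.Im z|.
Proof.
rewrite -ler_sqr ?nnegrE ?addr_ge0 ?nr_ge0// nr_sqrE sqrrD.
rewrite !real_normK ?num_real// -addrA lerD2l lerDr.
by rewrite mulrn_wge0// mulr_ge0.
Qed.

Lemma complex_complete (F : set_system R[i]) : ProperFilter F -> cauchy F -> cvg F.
Proof.
apply: nr_complete => u uc.
have sub (f : R[i] -> R) : (forall z w, f z - f w = f (z - w)) ->
    (forall z, `|f z| <= nr z) -> exists l : R, (f \o u) @ \oo --> l.
  move=> fB fle; have uex : cauchy_ex (f \o u @ \oo).
    move=> e /uc[N uN]; exists (f (u N)); exists N => // n Nn.
    by rewrite /ball /= fB (le_lt_trans (fle _))// uN.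
  have [l ul] := iffLR (cvg_ex (f \o u @ \oo)) (@cauchy_cvg R _ _ (cauchy_exP _ uex)).
  by exists l.
have [||x ux] := sub (@complex.Re R); [by case=> ? ?; case|exact: Re_le_nr|].
have [||y uy] := sub (@complex.Im R); [by case=> ? ?; case|exact: Im_le_nr|].
exists (x +i* y); apply/nr_cvgnP => e e0.
have e2 : 0 < e / 2 by rewrite divr_gt0.
move/cvgrPdist_lt: ux => /(_ _ e2)[N _ uN].
move/cvgrPdist_lt: uy => /(_ _ e2)[M _ uM].
exists (maxn N M) => n; rewrite geq_max => /andP[Nn Mn].
rewrite (le_lt_trans (nr_le_ReIm _))// (splitr e).
have := uN n Nn; have := uM n Mn; rewrite /= !(distrC x) !(distrC y).
by case: (u n) => a b /= ? ?; rewrite ltrD.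
Qed.

HB.instance Definition _ := Uniform_isComplete.Build R[i] complex_complete.

End ComplexModulus.

Lemma sum_cauchy_schwarz (R : realType) (a b : nat -> R) n :
  (forall k, 0 <= a k) -> (forall k, 0 <= b k) ->
  \sum_(k < n) a k * b k <=
  Num.sqrt (\sum_(k < n) a k ^+ 2) * Num.sqrt (\sum_(k < n) b k ^+ 2).
Proof.
move=> a0 b0; elim: n => [|n IH]; first by rewrite !big_ord0 sqrtr0 mulr0.
rewrite !big_ord_recr /=; move: IH.
have A0 : 0 <= \sum_(k < n) a k ^+ 2 by apply: sumr_ge0 => *; rewrite sqr_ge0.
have B0 : 0 <= \sum_(k < n) b k ^+ 2 by apply: sumr_ge0 => *; rewrite sqr_ge0.
have T0 : 0 <= \sum_(k < n) a k * b k by apply: sumr_ge0 => *; rewrite mulr_ge0.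
move: (\sum_(k < n) a k ^+ 2) A0 (\sum_(k < n) b k ^+ 2) B0
  (\sum_(k < n) a k * b k) T0 => A A0 B B0 T T0 TAB.
have := a0 n; have := b0 n; move: (a n) (b n) => {a0 b0} {}a {}b b0 a0.
have := sqr_sqrtr A0; have := sqr_sqrtr B0; move: (sqrtr_ge0 A) (sqrtr_ge0 B) TAB.
move: (Num.sqrt A) (Num.sqrt B) => p q p0 q0 Tpq <- <-.
rewrite -sqrtrM ?addr_ge0 ?sqr_ge0//.
rewrite -(@ler_pXn2r _ 2) ?nnegrE ?sqrtr_ge0 ?addr_ge0 ?mulr_ge0//.
rewrite sqr_sqrtr ?mulr_ge0 ?addr_ge0 ?sqr_ge0//.
have H : T + a * b <= p * q + a * b by rewrite lerD2r.
have H2 : (T + a * b) ^+ 2 <= (p * q + a * b) ^+ 2.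
  by rewrite ler_sqr ?nnegrE ?addr_ge0 ?mulr_ge0.
rewrite (le_trans H2)// -subr_ge0.
rewrite (_ : _ - _ = (p * b - a * q) ^+ 2) ?sqr_ge0//; ring.
Qed.

Section SquareSummable.
Context {R : realType}.
Implicit Types x y z : nat -> R[i].

Definition sqsum x n : R := \sum_(k < n) nr (x k) ^+ 2.

Lemma sqsum_ge0 x n : 0 <= sqsum x n.
Proof. by apply: sumr_ge0 => k _; rewrite sqr_ge0. Qed.

Lemma sqsum_nd x m n : (m <= n)%N -> sqsum x m <= sqsum x n.
Proof.
move=> /subnKC <-; elim: (n - m)%N => [|k IH]; first by rewrite addn0.
by rewrite addnS (le_trans IH)// /sqsum big_ord_recr /= lerDl sqr_ge0.
Qed.

Lemma sqsumD x y n :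
  Num.sqrt (sqsum (fun k => x k + y k) n) <=
  Num.sqrt (sqsum x n) + Num.sqrt (sqsum y n).
Proof.
rewrite -ler_sqr ?nnegrE ?addr_ge0 ?sqrtr_ge0// sqr_sqrtr ?sqsum_ge0//.
rewrite sqrrD !sqr_sqrtr ?sqsum_ge0//.
have := @sum_cauchy_schwarz R (fun k => nr (x k)) (fun k => nr (y k)) n
  (fun k => nr_ge0 _) (fun k => nr_ge0 _).
rewrite -/(sqsum x n) -/(sqsum y n) => CS.
apply: (@le_trans _ _ (sqsum x n + (\sum_(k < n) nr (x k) * nr (y k)) *+ 2 + sqsum y n)).
  rewrite -sumrMnl -!big_split /=; apply: ler_sum => k _.
  by rewrite -sqrrD ler_sqr ?nnegrE ?addr_ge0 ?nr_ge0// nrD.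
by rewrite lerD2r lerD2l lerMn2r.
Qed.

Lemma sqsumZ (c : R[i]) x n : sqsum (fun k => c * x k) n = nr c ^+ 2 * sqsum x n.
Proof. by rewrite /sqsum mulr_sumr; apply: eq_bigr => k _; rewrite nr_mul exprMn. Qed.

Record l2 : Type := L2 {
  l2_fun :> nat -> R[i];
  l2_bounded : exists C, forall n, sqsum l2_fun n <= C
}.

Lemma l2_ext (x y : l2) : x =1 y -> x = y.
Proof.
case: x y => [x px] [y py] /= /funext xy; subst y.
by congr L2; exact: Prop_irrelevance.
Qed.

Lemma l2_sqrt_bounded (x : nat -> R[i]) (C : R) :
  (forall n, Num.sqrt (sqsum x n) <= C) -> exists C', forall n, sqsum x n <= C'.
Proof.
move=> xC; exists (C ^+ 2) => n.
have C0 : 0 <= C by rewrite (le_trans _ (xC 0%N))// sqrtr_ge0.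
by rewrite -[leLHS]sqr_sqrtr ?sqsum_ge0// ler_sqr ?nnegrE ?sqrtr_ge0.
Qed.

Definition l2_nr (x : l2) : R := Num.sqrt (sup (range (sqsum x))).

Lemma l2_has_sup (x : l2) : has_sup (range (sqsum x)).
Proof.
split; first by exists (sqsum x 0), 0%N.
by have [C xC] := l2_bounded x; exists C => _ [n _ <-].
Qed.

Lemma l2_nr_ge0 (x : l2) : 0 <= l2_nr x.
Proof. exact: sqrtr_ge0. Qed.

Lemma sqsum_le (x : l2) n : Num.sqrt (sqsum x n) <= l2_nr x.
Proof.
rewrite ler_wsqrtr//; apply: ub_le_sup; first by case: (l2_has_sup x).
by exists n.
Qed.

Lemma l2_nr_le (x : l2) (C : R) : (forall n, Num.sqrt (sqsum x n) <= C) ->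
  l2_nr x <= C.
Proof.
move=> xC; have C0 : 0 <= C by rewrite (le_trans _ (xC 0%N))// sqrtr_ge0.
rewrite -(ger0_norm C0) -sqrtr_sqr ler_wsqrtr//.
apply: ge_sup; first by case: (l2_has_sup x).
move=> _ [n _ <-]; rewrite -[leLHS]sqr_sqrtr ?sqsum_ge0//.
by rewrite ler_sqr ?nnegrE ?sqrtr_ge0.
Qed.

Lemma l2_zeroP : exists C : R, forall n, sqsum (fun=> 0) n <= C.
Proof. by exists 0 => n; rewrite /sqsum big1// => k _; rewrite nr0 expr0n. Qed.

Lemma l2_addP (x y : l2) : exists C, forall n, sqsum (fun k => x k + y k) n <= C.
Proof.
apply: (@l2_sqrt_bounded _ (l2_nr x + l2_nr y)) => n.
by rewrite (le_trans (sqsumD _ _ _))// lerD// sqsum_le.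
Qed.

Lemma l2_scaleP (c : R[i]) (x : l2) : exists C, forall n, sqsum (fun k => c * x k) n <= C.
Proof.
have [C xC] := l2_bounded x; exists (nr c ^+ 2 * C) => n.
by rewrite sqsumZ ler_wpM2l ?sqr_ge0.
Qed.

Lemma l2_oppP (x : l2) : exists C, forall n, sqsum (fun k => - x k) n <= C.
Proof.
have [C xC] := l2_bounded x; exists C => n; rewrite (le_trans _ (xC n))//.
by rewrite le_eqVlt; apply/orP; left; apply/eqP; apply: eq_bigr => k _; rewrite nrN.
Qed.

Definition l2_zero := L2 l2_zeroP.
Definition l2_add (x y : l2) := L2 (l2_addP x y).
Definition l2_opp (x : l2) := L2 (l2_oppP x).
Definition l2_scale (c : R[i]) (x : l2) := L2 (l2_scaleP c x).

HB.instance Definition _ := gen_eqMixin l2.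
HB.instance Definition _ := gen_choiceMixin l2.

Lemma l2_addA : associative l2_add.
Proof. by move=> x y z; apply: l2_ext => k /=; rewrite addrA. Qed.

Lemma l2_addC : commutative l2_add.
Proof. by move=> x y; apply: l2_ext => k /=; rewrite addrC. Qed.

Lemma l2_add0 : left_id l2_zero l2_add.
Proof. by move=> x; apply: l2_ext => k /=; rewrite add0r. Qed.

Lemma l2_addN : left_inverse l2_zero l2_opp l2_add.
Proof. by move=> x; apply: l2_ext => k /=; rewrite addNr. Qed.

HB.instance Definition _ := GRing.isZmodule.Build l2
  l2_addA l2_addC l2_add0 l2_addN.

Lemma l2_scaleA c d (x : l2) : l2_scale c (l2_scale d x) = l2_scale (c * d) x.
Proof. by apply: l2_ext => k /=; rewrite mulrA. Qed.

Lemma l2_scale1 : left_id 1 l2_scale.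
Proof. by move=> x; apply: l2_ext => k /=; rewrite mul1r. Qed.

Lemma l2_scaleDr : right_distributive l2_scale +%R.
Proof. by move=> c x y; apply: l2_ext => k /=; rewrite mulrDr. Qed.

Lemma l2_scaleDl (x : l2) : {morph l2_scale^~ x : c d / c + d}.
Proof. by move=> c d; apply: l2_ext => k /=; rewrite mulrDl. Qed.

HB.instance Definition _ := GRing.Zmodule_isLmodule.Build R[i] l2
  l2_scaleA l2_scale1 l2_scaleDr l2_scaleDl.

Lemma l2DE (x y : l2) k : (x + y) k = x k + y k. Proof. by []. Qed.
Lemma l2NE (x : l2) k : (- x) k = - x k. Proof. by []. Qed.
Lemma l2ZE (c : R[i]) (x : l2) k : (c *: x) k = c * x k. Proof. by []. Qed.
Definition l2_norm (x : l2) : R[i] := (l2_nr x)%:C.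

Lemma l2_normD (x y : l2) : l2_norm (x + y) <= l2_norm x + l2_norm y.
Proof.
rewrite /l2_norm -rmorphD lecR; apply: l2_nr_le => n.
by rewrite (le_trans (sqsumD _ _ _))// lerD// sqsum_le.
Qed.

Lemma l2_nrZ_le (c : R[i]) (x : l2) : l2_nr (c *: x) <= nr c * l2_nr x.
Proof.
apply: l2_nr_le => n; rewrite sqsumZ sqrtrM ?sqr_ge0// sqrtr_sqr.
by rewrite ger0_norm ?nr_ge0// ler_wpM2l ?nr_ge0// sqsum_le.
Qed.

Lemma l2_normZ (c : R[i]) (x : l2) : l2_norm (c *: x) = `|c| * l2_norm x.
Proof.
rewrite (nrE c) /l2_norm -rmorphM; congr (_%:C).
apply/eqP; rewrite eq_le l2_nrZ_le /=.
have [->|c0] := eqVneq c 0; first by rewrite nr0 mul0r l2_nr_ge0.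
have c1 : 0 < nr c by rewrite lt_def nr_ge0 andbT; apply: contraNneq c0 => /nr_eq0 ->.
have := l2_nrZ_le c^-1 (c *: x); rewrite scalerA mulVf// scale1r.
rewrite -(ler_pM2l c1) mulrA -nr_mul mulfV// nr_one mul1r.
by [].
Qed.

Lemma coord_le (x : l2) k : nr (x k) <= l2_nr x.
Proof.
rewrite (le_trans _ (sqsum_le x k.+1))// /sqsum big_ord_recr/=.
rewrite -[leLHS]ger0_norm ?nr_ge0// -sqrtr_sqr ler_wsqrtr// lerDr.
exact: sqsum_ge0.
Qed.

Lemma l2_norm0_eq0 (x : l2) : l2_norm x = 0 -> x = 0.
Proof.
move=> /(congr1 (@complex.Re R))/= x0; apply: l2_ext => k; apply: nr_eq0.
by apply/eqP; rewrite eq_le nr_ge0 andbT -x0 coord_le.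
Qed.

HB.instance Definition _ := Lmodule_isNormed.Build R[i] l2
  l2_normD l2_normZ l2_norm0_eq0.

Lemma l2_complete (F : set_system l2) : ProperFilter F -> cauchy F -> cvg F.
Proof.
apply: nr_complete => u uc.
have uck k : nr_cauchy (fun n => u n k).
  move=> e /uc[N uN]; exists N => m n Nm Nn.
  by rewrite (le_lt_trans (coord_le (u m - u n) k))// uN.
have [v vE] := choice (fun k => nr_cauchy_cvg (uck k)).
have near_v (e : R) : 0 < e -> exists N, forall n, (N <= n)%N ->
    forall K, Num.sqrt (sqsum (fun k => v k - u n k) K) <= e.
  move=> e0; have [N uN] := uc _ e0; exists N => n Nn K.
  apply/ler_addgt0Pr => d d0.
  (* Only K coordinates are involved, so coordinatewise convergence is uniform here. *)
  have : \forall m \near \oo, Num.sqrt (sqsum (fun k => v k - u m k) K) <= d.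
    have d1 : 0 < d / K.+1%:R by rewrite divr_gt0.
    have near_k : \forall m \near \oo, forall k : 'I_K, nr (u m k - v k) < d / K.+1%:R.
      by apply: filter_forall => k; exact: (iffLR (nr_cvgP _ _) (vE k)).
    apply: filterS near_k => m mK.
    rewrite -[leRHS](ger0_norm (ltW d0)) -sqrtr_sqr ler_wsqrtr//.
    rewrite (@le_trans _ _ (\sum_(k < K) (d / K.+1%:R) ^+ 2))//.
      apply: ler_sum => k _; rewrite ler_sqr ?nnegrE ?nr_ge0 ?(ltW d1)//.
      by rewrite nrB ltW// mK.
    rewrite sumr_const card_ord expr_div_n -mulrnAr ler_piMr ?sqr_ge0//.
    rewrite -[_ *+ K]mulr_natr mulrC ler_pdivrMr ?exprn_gt0// mul1r.
    rewrite (@le_trans _ _ K.+1%:R) ?ler_nat// expr2 ler_peMr//.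
    by rewrite ler1n.
  move=> [M _ vM]; pose m := maxn N M.
  have -> : (fun k => v k - u n k) = (fun k => (u m - u n) k + (v k - u m k)).
    by apply/funext => k; rewrite l2DE l2NE; ring.
  rewrite (le_trans (sqsumD _ _ _))// lerD//; last by apply: vM; exact: leq_maxr.
  by rewrite (le_trans (sqsum_le (u m - u n) K))// ltW// (uN m n)// leq_maxl.
have vP : exists C, forall n, sqsum v n <= C.
  have [N /(_ N (leqnn _)) vN] := near_v 1 ltr01.
  apply: (@l2_sqrt_bounded _ (1 + l2_nr (u N))) => n.
  have -> : v = (fun k => (v k - u N k) + u N k) by apply/funext => k; rewrite subrK.
  by rewrite (le_trans (sqsumD _ _ _))// lerD// sqsum_le.
exists (L2 vP); apply/nr_cvgnP => e e0.
have e2 : 0 < e / 2 by rewrite divr_gt0.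
have [N vN] := near_v _ e2; exists N => n Nn.
rewrite (@le_lt_trans _ _ (e / 2))//; last by rewrite ltr_pdivrMr// ltr_pMr// ltr1n.
by rewrite nrB; apply: l2_nr_le => K; exact: vN.
Qed.

HB.instance Definition _ := Uniform_isComplete.Build l2 l2_complete.

End SquareSummable.
Arguments l2 R : clear implicits.

Section HilbertSpace.
Context {R : realType}.
Implicit Types x y z : l2 R.

Definition ip_partial x y n : R[i] := \sum_(k < n) Num.conj (x k) * y k.

Lemma sqsum_cvg x : sqsum x @ \oo --> sup (range (sqsum x)).
Proof.
apply: nondecreasing_cvgn; first by move=> m n; exact: sqsum_nd.
by case: (l2_has_sup x).
Qed.

(** Since |x y| <= |x|^2 + |y|^2, the increments of the partial sums are dominated by those of the
    two convergent sums of squares. *)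
Lemma ip_partial_cauchy x y : nr_cauchy (ip_partial x y).
Proof.
have step m k : nr (ip_partial x y (m + k) - ip_partial x y m) <=
    (sqsum x (m + k) - sqsum x m) + (sqsum y (m + k) - sqsum y m).
  elim: k => [|k IH]; first by rewrite addn0 !subrr nr0 addr0.
  rewrite addnS /ip_partial /sqsum !big_ord_recr /= -!/(sqsum _ _) -!/(ip_partial _ _ _).
  set p := ip_partial x y (m + k); set q := ip_partial x y m.
  have -> : p + Num.conj (x (m + k)%N) * y (m + k)%N - q =
    (p - q) + Num.conj (x (m + k)%N) * y (m + k)%N by ring.
  rewrite (le_trans (nrD _ _))//.
  have : nr (Num.conj (x (m + k)%N) * y (m + k)%N) <=
      nr (x (m + k)%N) ^+ 2 + nr (y (m + k)%N) ^+ 2.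
    rewrite nr_mul nr_conj; have := nr_ge0 (x (m + k)%N); have := nr_ge0 (y (m + k)%N).
    by move: (nr _) (nr _) => s t; nra.
  by move: IH; rewrite -/p -/q; lra.
move=> e e0; have e2 : 0 < e / 4 by rewrite divr_gt0.
have [N _ xN] := iffLR (cvgrPdist_lt _ _) (sqsum_cvg (x := x)) _ e2.
have [M _ yM] := iffLR (cvgrPdist_lt _ _) (sqsum_cvg (x := y)) _ e2.
have lem m n : (maxn N M <= m)%N -> (m <= n)%N ->
    nr (ip_partial x y n - ip_partial x y m) < e.
  rewrite geq_max => /andP[Nm Mm] mn.
  have := step m (n - m)%N; rewrite subnKC// => /le_lt_trans; apply.
  have := xN _ Nm; have := xN _ (leq_trans Nm mn).
  have := yM _ Mm; have := yM _ (leq_trans Mm mn).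
  rewrite /= !ltr_distl; move: (sup _) (sup _) => X Y.
  by do 4 move=> /andP[? ?]; lra.
exists (maxn N M) => m n Nm Nn.
by case/orP: (leq_total m n) => mn; [rewrite nrB|]; apply: lem.
Qed.

Definition ip_l2 x y : R[i] := projT1 (cid (nr_cauchy_cvg (@ip_partial_cauchy x y))).

Lemma ip_l2_cvg x y : ip_partial x y @ \oo --> ip_l2 x y.
Proof. exact: (projT2 (cid (nr_cauchy_cvg (@ip_partial_cauchy x y)))). Qed.

Arguments ip_l2_cvg : clear implicits.

Lemma ip_l2P x y (l : R[i]) : ip_partial x y @ \oo --> l -> ip_l2 x y = l.
Proof. by move=> xl; exact: norm_cvg_unique (ip_l2_cvg x y) xl. Qed.

Lemma ip_l2Dl x y z : ip_l2 (x + y) z = ip_l2 x z + ip_l2 y z.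
Proof.
apply: ip_l2P; rewrite (_ : ip_partial _ _ = ip_partial x z \+ ip_partial y z).
  by apply: cvgD; exact: ip_l2_cvg.
apply/funext => n; rewrite /ip_partial /= -big_split; apply: eq_bigr => k _ /=.
by rewrite rmorphD mulrDl.
Qed.

Lemma ip_l2Dr x y z : ip_l2 x (y + z) = ip_l2 x y + ip_l2 x z.
Proof.
apply: ip_l2P; rewrite (_ : ip_partial _ _ = ip_partial x y \+ ip_partial x z).
  by apply: cvgD; exact: ip_l2_cvg.
apply/funext => n; rewrite /ip_partial /= -big_split; apply: eq_bigr => k _ /=.
by rewrite mulrDr.
Qed.

Lemma ip_l2Zl (c : R[i]) x y : ip_l2 (c *: x) y = Num.conj c *: ip_l2 x y.
Proof.
apply: ip_l2P.
rewrite (_ : ip_partial _ _ = fun n => Num.conj c *: (ip_partial x y n : R[i])).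
  by apply: cvgZr; exact: ip_l2_cvg.
apply/funext => n; rewrite /ip_partial /GRing.scale/= mulr_sumr.
by apply: eq_bigr => k _ /=; rewrite conjM mulrA.
Qed.

Lemma ip_l2Zr (c : R[i]) x y : ip_l2 x (c *: y) = c *: ip_l2 x y.
Proof.
apply: ip_l2P.
rewrite (_ : ip_partial _ _ = fun n => c *: (ip_partial x y n : R[i])).
  by apply: cvgZr; exact: ip_l2_cvg.
apply/funext => n; rewrite /ip_partial /GRing.scale/= mulr_sumr.
by apply: eq_bigr => k _ /=; rewrite mulrCA.
Qed.

Lemma ip_l2_conj x y : Num.conj (ip_l2 x y) = ip_l2 y x.
Proof.
apply/esym/ip_l2P.
rewrite (_ : ip_partial _ _ = fun n => Num.conj (ip_partial x y n : R[i])).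
  apply/nr_cvgnP => e /(iffLR (nr_cvgnP _ _) (ip_l2_cvg x y))[N xN].
  by exists N => n /xN; rewrite -rmorphB nr_conj.
apply/funext => n; rewrite /ip_partial rmorph_sum; apply: eq_bigr => k _ /=.
by rewrite conjM conjCK mulrC.
Qed.

Lemma nr_ip_l2 x y : nr (ip_l2 x y) <= nr x * nr y.
Proof.
rewrite -[ip_l2 x y]subr0; apply: nr_lim_le (ip_l2_cvg x y) _.
exists 0%N => n _; rewrite subr0.
apply: (@le_trans _ _ (\sum_(k < n) nr (x k) * nr (y k))).
  rewrite /ip_partial; elim: n => [|n IH]; first by rewrite !big_ord0 nr0.
  by rewrite !big_ord_recr /= (le_trans (nrD _ _))// lerD// nr_mul nr_conj.
have := @sum_cauchy_schwarz R (fun k => nr (x k)) (fun k => nr (y k)) n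
  (fun k => nr_ge0 _) (fun k => nr_ge0 _) => /le_trans; apply.
by rewrite ler_pM ?sqrtr_ge0//; exact: sqsum_le.
Qed.

Lemma ip_l2xx x : ip_l2 x x = (nr x ^+ 2)%:C.
Proof.
apply: ip_l2P; have -> : nr x ^+ 2 = sup (range (sqsum x)).
  have -> : nr x = l2_nr x by [].
  rewrite sqr_sqrtr//; have [_ xb] := l2_has_sup x.
  by rewrite (le_trans (sqsum_ge0 x 0))//; apply: ub_le_sup => //; exists 0%N.
apply/nr_cvgnP => e e0.
have [N _ xN] := iffLR (cvgrPdist_lt _ _) (sqsum_cvg (x := x)) _ e0.
exists N => n /xN /=; rewrite distrC => xn.
rewrite (_ : ip_partial x x n = (sqsum x n)%:C).
  by rewrite -rmorphB nr_real.
rewrite /sqsum rmorph_sum; apply: eq_bigr => k _ /=.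
by rewrite conj_mulE.
Qed.

Lemma nr_ip_l2xx x : nr (ip_l2 x x) = nr x ^+ 2.
Proof. by rewrite ip_l2xx nr_real ger0_norm// sqr_ge0. Qed.

Definition l2_form : hilbForm (l2 R) (R[i] : normedModType R[i]) :=
  HilbForm ip_l2Dl ip_l2Dr ip_l2Zl ip_l2Zr nr_ip_l2 nr_ip_l2xx.

Definition bop : cstarAlgType R := adj l2_form.

Lemma ip_l20l x : ip_l2 0 x = 0.
Proof. exact: (ip0l l2_form). Qed.

Lemma ip_l20r x : ip_l2 x 0 = 0.
Proof. exact: (ip0r l2_form). Qed.

Lemma one_amul (T : adj l2_form) : adj_one l2_form ⋅ T = T. Proof. exact: adj_ext. Qed.

Lemma amul_one (T : adj l2_form) : T ⋅ adj_one l2_form = T. Proof. exact: adj_ext. Qed.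

Lemma bop_adj (T : adj l2_form) x y : ip_l2 (T x) y = ip_l2 x (T^† y).
Proof. exact: (adP T). Qed.

Lemma basis_bounded (j : nat) :
  exists C : R, forall n, sqsum (fun k => (k == j)%:R : R[i]) n <= C.
Proof.
exists 1 => n; suff -> : sqsum (fun k => (k == j)%:R : R[i]) n = (j < n)%:R.
  by case: (j < n)%N.
rewrite /sqsum; elim: n => [|n IH]; first by rewrite big_ord0.
rewrite big_ord_recr /= IH [in RHS]ltnS [in RHS]leq_eqVlt (eq_sym j).
have [->|_] /= := eqVneq n j; first by rewrite ltnn nr_one expr1n add0r.
by rewrite nr0 expr0n addr0.
Qed.

Definition l2_basis (j : nat) : l2 R := L2 (basis_bounded j).

Lemma ip_basisl j x : ip_l2 (l2_basis j) x = x j.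
Proof.
apply: ip_l2P; apply/nr_cvgnP => e e0; exists j.+1 => n jn.
rewrite /ip_partial (bigD1 (Ordinal jn))//= eqxx rmorph1 mul1r big1 ?addr0 ?subrr ?nr0//.
by move=> k kj; rewrite (_ : (k == j :> nat) = false) ?rmorph0 ?mul0r//; exact: negbTE.
Qed.

Lemma ip_basisr j x : ip_l2 x (l2_basis j) = Num.conj (x j).
Proof. by rewrite -ip_l2_conj ip_basisl. Qed.

Lemma ip_basis i j : ip_l2 (l2_basis i) (l2_basis j) = (i == j)%:R.
Proof. by rewrite ip_basisl. Qed.

Lemma nr_basis j : nr (l2_basis j) = 1.
Proof.
apply/eqP; rewrite -(@eqrXn2 _ 2) ?nr_ge0// expr1n -nr_ip_l2xx ip_basis eqxx.
by rewrite nr_one.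
Qed.

(** The operator |u><v| of rank at most one. *)
Program Definition theta (u v : l2 R) : adj l2_form :=
  @Adj R _ _ l2_form (fun x => ip_l2 v x *: u) (fun x => ip_l2 u x *: v) _ _ _.
Next Obligation.
move=> u v x y /=; rewrite ip_l2Zl ip_l2Zr ip_l2_conj /GRing.scale/=.
by rewrite mulrC.
Qed.
Next Obligation.
move=> u v x y /=; rewrite ip_l2Zl ip_l2Zr ip_l2_conj /GRing.scale/=.
by rewrite mulrC.
Qed.
Next Obligation.
move=> u v; exists (nr v * nr u) => x.
by rewrite nrZ mulrAC ler_wpM2r ?nr_ge0// nr_ip_l2.
Qed.

Lemma nr_theta u v : nr (theta u v) <= nr u * nr v.
Proof.
apply: nr_adj_le => [|x]; first by rewrite mulr_ge0// nr_ge0.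
by rewrite /= nrZ mulrC -mulrA ler_wpM2l ?nr_ge0// nr_ip_l2.
Qed.

Lemma theta_star u v : (theta u v)^† = theta v u.
Proof. exact: adj_ext. Qed.

Lemma theta0l v : theta 0 v = 0.
Proof. by apply: adj_ext => x; exact: scaler0. Qed.

Lemma theta0r u : theta u 0 = 0.
Proof. by apply: adj_ext => x; rewrite -[LHS]/(ip_l2 0 x *: u) ip_l20l scale0r. Qed.

Lemma mul_theta (T : adj l2_form) u v : T ⋅ theta u v = theta (T u) v.
Proof. by apply: adj_ext => x /=; rewrite apZ. Qed.

Lemma theta_mul (T : adj l2_form) u v : theta u v ⋅ T = theta u (T^† v).
Proof. by apply: adj_ext => x; congr (_ *: _); exact/esym/(adP' T). Qed.

Lemma theta_theta u v w z : theta u v ⋅ theta w z = ip_l2 v w *: theta u z.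
Proof.
by apply: adj_ext => x /=; rewrite ip_l2Zr scalerA; congr (_ *: _); exact: mulrC.
Qed.

Program Definition diag (g : nat -> R) (g1 : forall k, `|g k| <= 1) : adj l2_form :=
  @Adj R _ _ l2_form (fun x => @L2 R (fun k => (g k)%:C * x k) _)
   (fun x => @L2 R (fun k => (g k)%:C * x k) _) _ _ _.
Next Obligation.
move=> g g1 x; have [C xC] := l2_bounded x; exists C => n.
rewrite (le_trans _ (xC n))//; apply: ler_sum => k _.
rewrite ler_sqr ?nnegrE ?nr_ge0// nr_mul nr_real.
by rewrite ler_piMl ?nr_ge0.
Qed.
Next Obligation.
move=> g g1 x; have [C xC] := l2_bounded x; exists C => n.
rewrite (le_trans _ (xC n))//; apply: ler_sum => k _.
rewrite ler_sqr ?nnegrE ?nr_ge0// nr_mul nr_real.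
by rewrite ler_piMl ?nr_ge0.
Qed.
Next Obligation.
move=> g g1 x y /=; apply: ip_l2P.
rewrite (_ : ip_partial _ _ = ip_partial x (L2 (diag_obligation_2 g1 y))).
  exact: ip_l2_cvg.
apply/funext => n; apply: eq_bigr => k _ /=.
by rewrite conjM conj_real mulrAC mulrC.
Qed.
Next Obligation.
move=> g g1 x y /=; apply: ip_l2P.
rewrite (_ : ip_partial _ _ = ip_partial x (L2 (diag_obligation_1 g1 y))).
  exact: ip_l2_cvg.
apply/funext => n; apply: eq_bigr => k _ /=.
by rewrite conjM conj_real mulrAC mulrC.
Qed.
Next Obligation.
move=> g g1; exists 1 => x; rewrite mul1r; apply: l2_nr_le => n.
rewrite (le_trans _ (sqsum_le x n))// ler_wsqrtr//; apply: ler_sum => k _ /=.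
rewrite ler_sqr ?nnegrE ?nr_ge0// nr_mul nr_real.
by rewrite ler_piMl ?nr_ge0.
Qed.

End HilbertSpace.
Arguments ip_l2_cvg {R} x y.

(** * Four isometries with mutually orthogonal ranges *)

Section CuntzFamily.
Context {R : realType}.

Lemma big_ord4 (V : zmodType) (f : nat -> V) m :
  \sum_(i < 4 * m) f i =
  \sum_(j < m) (f (4 * j)%N + f (4 * j).+1 + f (4 * j).+2 + f (4 * j).+3).
Proof.
elim: m => [|m IH]; first by rewrite muln0 !big_ord0.
rewrite [in RHS]big_ord_recr /= -IH (_ : (4 * m.+1)%N = (4 * m).+4).
  by rewrite !big_ord_recr /= !addrA.
by rewrite mulnS addnC !addnS addn0.
Qed.

Definition spread (r : nat) (x : nat -> R[i]) (i : nat) : R[i] :=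
  if (i %% 4 == r)%N then x (i %/ 4)%N else 0.

Lemma spreadE r x j s : (r < 4)%N -> (s < 4)%N ->
  spread r x (4 * j + s)%N = if s == r then x j else 0.
Proof.
move=> r4 s4; rewrite /spread mulnC modnMDl modn_small// divnMDl//.
by rewrite divn_small// addn0.
Qed.

Lemma big_spread (V : zmodType) (r : nat) (x y : nat -> R[i]) (F : R[i] -> R[i] -> V) m :
  (r < 4)%N -> (forall w, F 0 w = 0) ->
  \sum_(i < 4 * m) F (spread r x i) (y i) = \sum_(j < m) F (x j) (y (4 * j + r)%N).
Proof.
move=> r4 F0; rewrite (big_ord4 (fun i => F (spread r x i) (y i))).
apply: eq_bigr => j _.
have E s : (s < 4)%N -> F (spread r x (4 * j + s)%N) (y (4 * j + s)%N) =
    if s == r then F (x j) (y (4 * j + r)%N) else 0.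
  by move=> s4; rewrite spreadE//; case: eqVneq => [->|]//; rewrite F0.
have := E 0%N isT; have := E 1%N isT; have := E 2%N isT; have := E 3%N isT.
rewrite addn0 addn1 addn2 addn3 => -> -> -> ->.
by move: r r4 E => [|[|[|[|]]]]//= _ _; rewrite ?addr0 ?add0r.
Qed.

Lemma sqsum_spread r (x : nat -> R[i]) m : (r < 4)%N ->
  sqsum (spread r x) (4 * m) = sqsum x m.
Proof.
move=> r4; apply: (big_spread x (fun=> 0) (F := fun z _ => nr z ^+ 2)) => // _.
by rewrite nr0 expr0n.
Qed.

Lemma spread_le r (x : l2 R) n : (r < 4)%N -> sqsum (spread r x) n <= sqsum x n.
Proof.
move=> r4; rewrite -(sqsum_spread x n r4); apply: sqsum_nd.
by rewrite leq_pmull.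
Qed.

Lemma spread_bounded r (x : l2 R) : (r < 4)%N ->
  exists C, forall n, sqsum (spread r x) n <= C.
Proof.
move=> r4; have [C xC] := l2_bounded x; exists C => n.
by rewrite (le_trans (spread_le _ _ r4)).
Qed.

Lemma gather_le r (x : nat -> R[i]) n : (r < 4)%N ->
  sqsum (fun j => x (4 * j + r)%N) n <= sqsum x (4 * n).
Proof.
move=> r4; rewrite /sqsum (big_ord4 (fun i => nr (x i) ^+ 2)).
apply: ler_sum => j _.
have H := (sqr_ge0 (nr (x (4 * j)%N)), sqr_ge0 (nr (x (4 * j).+1)),
  sqr_ge0 (nr (x (4 * j).+2)), sqr_ge0 (nr (x (4 * j).+3))).
move: r r4 => [|[|[|[|]]]]// _; rewrite ?addn0 ?addn1 ?addn2 ?addn3;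
  by move: H => [[[]]]; lra.
Qed.

Lemma gather_bounded r (x : l2 R) : (r < 4)%N ->
  exists C, forall n, sqsum (fun j => x (4 * j + r)%N) n <= C.
Proof.
move=> r4; have [C xC] := l2_bounded x; exists C => n.
by rewrite (le_trans (gather_le _ _ r4)).
Qed.

Lemma spread_adjoint r (x y : l2 R) (r4 : (r < 4)%N) :
  ip_l2 (L2 (spread_bounded x r4)) y = ip_l2 x (L2 (gather_bounded y r4)).
Proof.
apply/esym/ip_l2P; apply/nr_cvgnP => e.
move=> /(iffLR (nr_cvgnP _ _) (ip_l2_cvg (L2 (spread_bounded x r4)) y))[N xN].
exists N => n Nn; have := xN (4 * n)%N; rewrite (leq_trans Nn) ?leq_pmull// => /(_ isT).
rewrite (_ : ip_partial _ _ (4 * n) = ip_partial x (L2 (gather_bounded y r4)) n)//.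
apply: (big_spread x y (F := fun z w => Num.conj z * w)) => // w.
by rewrite rmorph0 mul0r.
Qed.

(** The isometry that sends e_j to e_(4j+r). Four of them are used in the second example: one cuts
    out a corner, two give isometries in this corner, and one leaves room orthogonal to their
    ranges. *)
Program Definition cuntz r (r4 : (r < 4)%N) : adj (@l2_form R) :=
  @Adj R _ _ (@l2_form R) (fun x => L2 (spread_bounded x r4))
   (fun x => L2 (gather_bounded x r4)) _ _ _.
Next Obligation. by move=> r r4 x y; exact: spread_adjoint. Qed.
Next Obligation.
by move=> r r4 x y /=; rewrite -[LHS]ip_l2_conj -spread_adjoint ip_l2_conj.
Qed.
Next Obligation.
move=> r r4; exists 1 => x; rewrite mul1r; apply: l2_nr_le => n.
by rewrite (le_trans _ (sqsum_le x n))// ler_wsqrtr// spread_le.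
Qed.

Lemma cuntz_ortho r s (r4 : (r < 4)%N) (s4 : (s < 4)%N) :
  (cuntz r4)^† ⋅ cuntz s4 = if r == s then adj_one (@l2_form R) else 0.
Proof.
apply: adj_ext => x; apply: l2_ext => j /=.
rewrite -[LHS]/(spread s x (4 * j + r)%N) spreadE//.
by case: eqVneq.
Qed.

Lemma cuntz_basis r (r4 : (r < 4)%N) j : cuntz r4 (l2_basis j) = l2_basis (4 * j + r).
Proof.
apply: l2_ext => i /=; rewrite /spread (divn_eq i 4) modnMDl.
have i4 : (i %% 4 < 4)%N by rewrite ltn_mod.
rewrite modn_mod divnMDl// (divn_small i4) addn0.
case: eqVneq => [->|ir].
  by rewrite eqn_add2r mulnC eqn_pmul2l.
rewrite (_ : (_ == _) = false)//; apply: contraNF ir => /eqP/(congr1 (modn^~ 4)).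
by rewrite (mulnC 4) !modnMDl modn_mod (modn_small r4) => ->.
Qed.

Lemma cuntz_star_basis r s (r4 : (r < 4)%N) (s4 : (s < 4)%N) j :
  (cuntz r4)^† (l2_basis (4 * j + s)) = if r == s then l2_basis j else 0.
Proof.
rewrite -(cuntz_basis s4).
have := cuntz_ortho r4 s4 => /(congr1 (fun T : adj (@l2_form R) => T (l2_basis j))) /=.
by move=> ->; case: eqVneq.
Qed.

End CuntzFamily.

Section HarmonicWeights.
Context {R : realType}.

Definition harm (k : nat) : R := k.+1%:R^-1.

Lemma harm_gt0 k : 0 < harm k. Proof. by rewrite invr_gt0. Qed.

Lemma harm_anti m n : (m <= n)%N -> harm n <= harm m.
Proof. by move=> mn; rewrite lef_pV2 ?posrE// ler_nat. Qed.

Lemma harm_le1 k : harm k <= 1.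
Proof. by rewrite invf_le1// ler1n. Qed.

Lemma harm_bound k : `|harm k| <= 1.
Proof. by rewrite ger0_norm ?harm_le1// invr_ge0. Qed.

Lemma harm_small (e : R) : 0 < e -> exists N, harm N < e.
Proof. by move=> /ltr_add_invr[N]; rewrite add0r; exists N. Qed.

Lemma harm_mul_small (C e : R) : 0 < e -> exists N, C * harm N < e.
Proof.
move=> e0; have C0 : 0 < `|C| + 1 by rewrite ltr_wpDl.
have [N Ne] := harm_small (divr_gt0 e0 C0); exists N.
rewrite (@le_lt_trans _ _ ((`|C| + 1) * harm N))//; last by rewrite mulrC -ltr_pdivlMr.
by rewrite ler_wpM2r ?(ltW (harm_gt0 N))// (le_trans (ler_norm C))// lerDl.
Qed.

End HarmonicWeights.

Section Truncation.
Context {R : realType}.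

Lemma trunc_bound N k : `|(k < N)%N%:R| <= 1 :> R.
Proof. by case: (k < N)%N; rewrite ?normr1 ?normr0. Qed.

Definition trunc N : adj (@l2_form R) := diag (trunc_bound N).

Lemma truncE N x k : trunc N x k = if (k < N)%N then x k else 0.
Proof. by rewrite /=; case: (k < N)%N; rewrite ?rmorph1 ?mul1r ?rmorph0 ?mul0r. Qed.

Lemma trunc_star N : (trunc N)^† = trunc N.
Proof. by apply: adj_ext => x; exact: l2_ext. Qed.

Lemma trunc_sum N (x : l2 R) : trunc N x = \sum_(j < N) x j *: l2_basis j.
Proof.
apply: l2_ext => k; rewrite truncE.
have -> : (\sum_(j < N) x j *: l2_basis j) k = \sum_(j < N) x j * (k == j)%:R.
  elim: N => [|N IH]; first by rewrite !big_ord0.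
  by rewrite !big_ord_recr /= -IH.
case: ifP => [kN|kN].
  rewrite (bigD1 (Ordinal kN))//= eqxx mulr1 big1 ?addr0// => j jk.
  by rewrite (_ : (k == j) = false) ?mulr0//; rewrite eq_sym; exact: negbTE.
rewrite big1// => j _; rewrite (_ : (k == j :> nat) = false) ?mulr0//.
by apply: contraFF kN => /eqP ->.
Qed.

Lemma diag_bound_le (g : nat -> R) (g1 : forall k, `|g k| <= 1) (C : R) (x : l2 R) :
  0 <= C -> (forall k, x k = 0 \/ `|g k| <= C) -> nr (diag g1 x) <= C * nr x.
Proof.
move=> C0 gC; apply: l2_nr_le => n.
rewrite -(ger0_norm C0) -sqrtr_sqr.
apply: (@le_trans _ _ (Num.sqrt (C ^+ 2) * Num.sqrt (sqsum x n))); last first.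
  by rewrite ler_wpM2l ?sqrtr_ge0//; exact: sqsum_le.
rewrite -sqrtrM ?sqr_ge0// ler_wsqrtr// /sqsum mulr_sumr.
apply: ler_sum => k _ /=; rewrite nr_mul nr_real exprMn.
have [->|gk] := gC k; first by rewrite nr0 expr0n !mulr0.
by rewrite ler_wpM2r ?sqr_ge0// ler_sqr ?nnegrE.
Qed.

End Truncation.

(** * C*-algebras of functions *)

(* A C*-algebra of functions, given by its membership predicate. *)
Record funSubalg (R : realType) (Y : Type) (U : cstarAlgType R) := FunSubalg {
  fmem :> (Y -> U) -> Prop;
  fmem_bounded : forall F, fmem F -> exists C : R, forall y, nr (F y) <= C;
  fmem0 : fmem (fun=> 0);
  fmemD : forall F G, fmem F -> fmem G -> fmem (fun y => F y + G y);
  fmemZ : forall (k : R[i]) F, fmem F -> fmem (fun y => k *: F y);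
  fmemM : forall F G, fmem F -> fmem G -> fmem (fun y => F y ⋅ G y);
  fmemS : forall F, fmem F -> fmem (fun y => (F y)^†);
  fmem_closed : forall F, (forall e : R, 0 < e ->
    exists2 G, fmem G & forall y, nr (F y - G y) <= e) -> fmem F
}.

Section FunctionAlgebra.
Context {R : realType} {Y : Type} {U : cstarAlgType R} (M : funSubalg Y U).

Record funAlg : Type := FunAlg { fval :> Y -> U; fvalP : M fval }.

Implicit Types F G : funAlg.

Lemma funAlg_ext F G : F =1 G -> F = G.
Proof.
case: F G => [F MF] [G MG] /= /funext FG; subst G.
by congr FunAlg; exact: Prop_irrelevance.
Qed.

Lemma fmemN F : M (fun y => - F y).
Proof.
rewrite (_ : (fun _ => _) = (fun y => (-1 : R[i]) *: F y)).
  exact: fmemZ (fvalP F).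
by apply/funext => y; rewrite scaleN1r.
Qed.

Definition funAlg_zero := FunAlg (fmem0 M).
Definition funAlg_opp F := FunAlg (fmemN F).
Definition funAlg_add F G := FunAlg (fmemD (fvalP F) (fvalP G)).
Definition funAlg_scale (k : R[i]) F := FunAlg (fmemZ k (fvalP F)).
Definition funAlg_mul F G := FunAlg (fmemM (fvalP F) (fvalP G)).
Definition funAlg_star F := FunAlg (fmemS (fvalP F)).

HB.instance Definition _ := gen_eqMixin funAlg.
HB.instance Definition _ := gen_choiceMixin funAlg.

Lemma funAlg_addA : associative funAlg_add.
Proof. by move=> F G H; apply: funAlg_ext => y /=; rewrite addrA. Qed.

Lemma funAlg_addC : commutative funAlg_add.
Proof. by move=> F G; apply: funAlg_ext => y /=; rewrite addrC. Qed.

Lemma funAlg_add0 : left_id funAlg_zero funAlg_add.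
Proof. by move=> F; apply: funAlg_ext => y /=; rewrite add0r. Qed.

Lemma funAlg_addN : left_inverse funAlg_zero funAlg_opp funAlg_add.
Proof. by move=> F; apply: funAlg_ext => y /=; rewrite addNr. Qed.

HB.instance Definition _ := GRing.isZmodule.Build funAlg
  funAlg_addA funAlg_addC funAlg_add0 funAlg_addN.

Lemma funAlg_scaleA k l F : funAlg_scale k (funAlg_scale l F) = funAlg_scale (k * l) F.
Proof. by apply: funAlg_ext => y /=; rewrite scalerA. Qed.

Lemma funAlg_scale1 : left_id 1 funAlg_scale.
Proof. by move=> F; apply: funAlg_ext => y /=; rewrite scale1r. Qed.

Lemma funAlg_scaleDr : right_distributive funAlg_scale +%R.
Proof. by move=> k F G; apply: funAlg_ext => y /=; rewrite scalerDr. Qed.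

Lemma funAlg_scaleDl F : {morph funAlg_scale^~ F : k l / k + l}.
Proof. by move=> k l; apply: funAlg_ext => y /=; rewrite scalerDl. Qed.

HB.instance Definition _ := GRing.Zmodule_isLmodule.Build R[i] funAlg
  funAlg_scaleA funAlg_scale1 funAlg_scaleDr funAlg_scaleDl.

Definition supn F : R := inf [set C | 0 <= C /\ forall y, nr (F y) <= C].

Lemma supn_has_inf F : has_inf [set C | 0 <= C /\ forall y, nr (F y) <= C].
Proof.
split; last by exists 0 => C [].
have [C FC] := fmem_bounded (fvalP F); exists `|C|; split => // y.
by rewrite (le_trans (FC y))// ler_norm.
Qed.

Lemma supn_ge0 F : 0 <= supn F.
Proof. by apply: lb_le_inf; [case: (supn_has_inf F) | move=> C []]. Qed.

Lemma supn_le F C : 0 <= C -> (forall y, nr (F y) <= C) -> supn F <= C.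
Proof. by move=> C0 FC; apply: ge_inf => //; case: (supn_has_inf F). Qed.

Lemma fval_le F y : nr (F y) <= supn F.
Proof. by apply: lb_le_inf; [case: (supn_has_inf F) | move=> C [_]]. Qed.

Definition funAlg_norm F : R[i] := (supn F)%:C.

Lemma funAlg_normD F G : funAlg_norm (F + G) <= funAlg_norm F + funAlg_norm G.
Proof.
rewrite /funAlg_norm -rmorphD lecR; apply: supn_le.
  by rewrite addr_ge0// supn_ge0.
by move=> y; rewrite (le_trans (nrD _ _))// lerD// fval_le.
Qed.

Lemma supnZ_le (k : R[i]) F : supn (k *: F) <= nr k * supn F.
Proof.
apply: supn_le; first by rewrite mulr_ge0 ?nr_ge0 ?supn_ge0.
by move=> y; rewrite nrZ ler_wpM2l ?nr_ge0// fval_le.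
Qed.

Lemma funAlg_normZ k F : funAlg_norm (k *: F) = `|k| * funAlg_norm F.
Proof.
have kE : `|k| = (nr k)%:C by exact: nrE.
rewrite kE /funAlg_norm -rmorphM; congr (_%:C).
apply/eqP; rewrite eq_le supnZ_le/=.
have [k0|k0] := eqVneq k 0.
  by rewrite k0 nr0 mul0r supn_ge0.
have nk : 0 < nr k by rewrite -ltr0c -kE normr_gt0.
have := supnZ_le k^-1 (k *: F); rewrite scalerA mulVf// scale1r.
rewrite -(ler_pM2l nk) mulrA.
have -> : nr k * nr (k^-1 : R[i]) = 1.
  have := nrZ k (k^-1 : R[i]); rewrite /GRing.scale/= mulfV// => <-.
  by apply: complexI; rewrite -nrE normr1.
by rewrite mul1r.
Qed.

Lemma funAlg_norm0_eq0 F : funAlg_norm F = 0 -> F = 0.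
Proof.
move=> /(congr1 (@complex.Re R))/= F0; apply: funAlg_ext => y.
by apply: nr_eq0; apply/eqP; rewrite eq_le nr_ge0 andbT -F0 fval_le.
Qed.

HB.instance Definition _ := Lmodule_isNormed.Build R[i] funAlg
  funAlg_normD funAlg_normZ funAlg_norm0_eq0.

Lemma nr_fval F y : nr (F y) <= nr F.
Proof. exact: fval_le. Qed.

Lemma nr_funAlg_le F C : 0 <= C -> (forall y, nr (F y) <= C) -> nr F <= C.
Proof. exact: supn_le. Qed.

Lemma funAlg_mulA : associative funAlg_mul.
Proof. by move=> F G H; apply: funAlg_ext => y /=; rewrite amulA. Qed.

Lemma funAlg_mulDl : left_distributive funAlg_mul +%R.
Proof. by move=> F G H; apply: funAlg_ext => y /=; rewrite amulDl. Qed.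

Lemma funAlg_mulDr : right_distributive funAlg_mul +%R.
Proof. by move=> F G H; apply: funAlg_ext => y /=; rewrite amulDr. Qed.

Lemma funAlg_mulZl k F G : funAlg_mul (k *: F) G = k *: funAlg_mul F G.
Proof. by apply: funAlg_ext => y /=; rewrite amulZl. Qed.

Lemma funAlg_mulZr k F G : funAlg_mul F (k *: G) = k *: funAlg_mul F G.
Proof. by apply: funAlg_ext => y /=; rewrite amulZr. Qed.

Lemma funAlg_starK : involutive funAlg_star.
Proof. by move=> F; apply: funAlg_ext => y /=; rewrite starK. Qed.

Lemma funAlg_starD : {morph funAlg_star : F G / F + G}.
Proof. by move=> F G; apply: funAlg_ext => y /=; rewrite starD. Qed.

Lemma funAlg_starZ (k : R[i]) F : funAlg_star (k *: F) = Num.conj k *: funAlg_star F.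
Proof. by apply: funAlg_ext => y /=; rewrite starZ. Qed.

Lemma funAlg_starM F G : funAlg_star (funAlg_mul F G) = funAlg_mul (funAlg_star G) (funAlg_star F).
Proof. by apply: funAlg_ext => y /=; rewrite starM. Qed.

Lemma funAlg_norm_mul F G : `|funAlg_mul F G| <= `|F| * `|G|.
Proof.
rewrite !nrE -rmorphM lecR; apply: nr_funAlg_le.
  by rewrite mulr_ge0// nr_ge0.
by move=> y; rewrite (le_trans (nrM _ _))// ler_pM ?nr_ge0// nr_fval.
Qed.

Lemma funAlg_norm_star F : `|funAlg_star F| = `|F|.
Proof.
have le G : nr (funAlg_star G) <= nr G.
  by apply: nr_funAlg_le => [|y]; [exact: nr_ge0 | rewrite nr_star nr_fval].
rewrite !nrE; congr (_%:C); apply/eqP; rewrite eq_le le/=.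
by rewrite -{1}(funAlg_starK F) le.
Qed.

HB.instance Definition _ := NormedModule_isStarAlgebra.Build R funAlg
  funAlg_mulA funAlg_mulDl funAlg_mulDr funAlg_mulZl funAlg_mulZr
  funAlg_starK funAlg_starD funAlg_starZ funAlg_starM funAlg_norm_mul funAlg_norm_star.

Lemma funAlg_cstar F : `|F^† ⋅ F| = `|F| ^+ 2.
Proof.
rewrite !nrE -rmorphXn; congr (_%:C); apply/eqP; rewrite eq_le.
apply/andP; split.
  have := norm_amul F^† F; rewrite norm_star !nrE -rmorphM lecR.
  by rewrite -expr2.
rewrite -[leRHS]sqr_sqrtr ?nr_ge0// ler_sqr ?nnegrE ?nr_ge0 ?sqrtr_ge0//.
apply: nr_funAlg_le => [|y]; first exact: sqrtr_ge0.
rewrite -ler_sqr ?nnegrE ?nr_ge0 ?sqrtr_ge0// sqr_sqrtr ?nr_ge0//.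
by rewrite -nr_cstar (nr_fval (F^† ⋅ F)).
Qed.

Lemma funAlg_complete (L : set_system funAlg) : ProperFilter L -> cauchy L -> cvg L.
Proof.
apply: nr_complete => u uc.
have uc1 y : nr_cauchy (fun n => u n y).
  move=> e e0; have [N uN] := uc _ e0; exists N => m n Nm Nn.
  by rewrite (le_lt_trans (nr_fval (u m - u n) y))// uN.
have [l lE] := choice (fun y => nr_cauchy_cvg (uc1 y)).
have near_l (e : R) : 0 < e -> exists N, forall n, (N <= n)%N ->
    forall y, nr (l y - u n y) <= e.
  move=> e0; have [N uN] := uc _ e0; exists N => n Nn y.
  apply: (nr_lim_le (lE y)); exists N => m Nm.
  by rewrite (le_trans (nr_fval (u m - u n) y))// ltW// uN.
have lM : M l.
  apply: fmem_closed => e /near_l[N /(_ N (leqnn _)) uN].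
  by exists (u N) => //; exact: fvalP.
exists (FunAlg lM); apply/nr_cvgnP => e e0.
have e2 : 0 < e / 2 by rewrite divr_gt0.
have [N uN] := near_l _ e2; exists N => n Nn.
rewrite (@le_lt_trans _ _ (e / 2))//; last by rewrite ltr_pdivrMr// ltr_pMr// ltr1n.
by apply: nr_funAlg_le => [|y]; [exact: ltW | rewrite /= nrB uN].
Qed.

HB.instance Definition _ := Uniform_isComplete.Build funAlg funAlg_complete.

HB.instance Definition _ := NormedStarAlgebra_isCStar.Build R funAlg funAlg_cstar.

Lemma fvalB F G y : (F - G) y = F y - G y. Proof. by []. Qed.

End FunctionAlgebra.

Lemma nr_dense (R : realType) (V : normedModType R[i]) (S : set V) :
  (forall x (e : R), 0 < e -> exists2 y, S y & nr (y - x) < e) -> dense S.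
Proof.
move=> SV O [x Ox] oO; have := open_nbhs_nbhs (conj oO Ox).
move=> /nbhs_ballP[e /= e0 xeO]; have e1 := gtr0_cplx e0.
move: e0; rewrite e1 ltr0c => /(SV x)[y Sy yx]; exists y; split => //.
by apply: xeO; rewrite -ball_normE /= e1 nrE ltcR nrB.
Qed.

Lemma rational_complex_dense (R : realType) (z : R[i]) (e : R) : 0 < e ->
  exists p q : rat, nr (z - ratr p +i* ratr q) < e.
Proof.
move=> e0; have e2 : 0 < e / 2 by rewrite divr_gt0.
have ex (x : R) : exists q : rat, `|x - ratr q| < e / 2.
  have /rat_in_itvoo[q] : x - e / 2 < x + e / 2 by lra.
  by rewrite in_itv /= => /andP[? ?]; exists q; rewrite ltr_distl; lra.
have [p zp] := ex (complex.Re z); have [q zq] := ex (complex.Im z).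
exists p, q; rewrite (le_lt_trans (nr_le_ReIm _))// (splitr e).
by case: z zp zq => a b /= ? ?; rewrite ltrD.
Qed.

(** * Uniform closures of algebras of bounded functions *)

Section UniformClosure.
Context {R : realType} {Y : Type} {U : cstarAlgType R}.
Implicit Types (F G : Y -> U) (S : (Y -> U) -> Prop).

Definition fbounded F := exists C : R, forall y, nr (F y) <= C.

Lemma fbounded_pos F : fbounded F -> exists2 C : R, 0 < C & forall y, nr (F y) <= C.
Proof.
move=> [C FC]; exists (`|C| + 1) => [|y]; first by rewrite ltr_wpDl.
by rewrite (le_trans (FC y))// (le_trans (ler_norm C))// lerDl.
Qed.

Definition uclosure S F := forall e : R, 0 < e ->
  exists2 G, S G & forall y, nr (F y - G y) <= e.

Lemma uclosure_sub S F : S F -> uclosure S F.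
Proof. by move=> SF e e0; exists F => // y; rewrite subrr nr0 ltW. Qed.

Lemma uclosureK S F : uclosure (uclosure S) F -> uclosure S F.
Proof.
move=> SF e e0; have e2 : 0 < e / 2 by rewrite divr_gt0.
have [G /(_ _ e2)[H SH GH] FG] := SF _ e2; exists H => // y.
by rewrite (le_trans (nr_triangle (G y) _ _))// (splitr e) lerD ?FG ?GH.
Qed.

Lemma uclosureD S F G : (forall F G, S F -> S G -> S (fun y => F y + G y)) ->
  uclosure S F -> uclosure S G -> uclosure S (fun y => F y + G y).
Proof.
move=> SD SF SG e e0; have e2 : 0 < e / 2 by rewrite divr_gt0.
have [F' SF' FF'] := SF _ e2; have [G' SG' GG'] := SG _ e2.
exists (fun y => F' y + G' y); first exact: SD.
move=> y; have -> : F y + G y - (F' y + G' y) = (F y - F' y) + (G y - G' y) by lin.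
by rewrite (le_trans (nrD _ _))// (splitr e) lerD ?FF' ?GG'.
Qed.

Lemma uclosureS S F : (forall F, S F -> S (fun y => (F y)^†)) ->
  uclosure S F -> uclosure S (fun y => (F y)^†).
Proof.
move=> SS SF e /SF[G SG FG]; exists (fun y => (G y)^†); first exact: SS.
by move=> y; rewrite -starN -starD nr_star; exact: FG.
Qed.

Lemma uclosureM S F G : (forall F G, S F -> S G -> S (fun y => F y ⋅ G y)) ->
  fbounded F -> fbounded G ->
  uclosure S F -> uclosure S G -> uclosure S (fun y => F y ⋅ G y).
Proof.
move=> SM /fbounded_pos[C C0 FC] /fbounded_pos[D D0 GD] SF SG e e0.
have D1 : 0 < D + 1 by rewrite ltr_wpDr.
(* The minimum with 1 keeps the approximant of [G] below D + 1. *)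
have e1 : 0 < Num.min 1 (e / (2 * C)) by rewrite lt_min ltr01 divr_gt0// mulr_gt0.
have e2 : 0 < e / (2 * (D + 1)) by rewrite divr_gt0// mulr_gt0.
have [F' SF' FF'] := SF _ e2; have [G' SG' GG'] := SG _ e1.
exists (fun y => F' y ⋅ G' y); first exact: SM.
move=> y.
have -> : F y ⋅ G y - F' y ⋅ G' y = F y ⋅ (G y - G' y) + (F y - F' y) ⋅ G' y.
  by rewrite amulDl amulDr amulNl amulNr; lin.
have G'D : nr (G' y) <= D + 1.
  rewrite (le_trans (nrDB _ (G y)))// lerD// nrB (le_trans (GG' y))//.
  by rewrite ge_min lexx.
rewrite (le_trans (nrD _ _))// (splitr e) lerD//.
  rewrite (le_trans (nrM _ _))// (@le_trans _ _ (C * (e / (2 * C))))//.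
    by rewrite ler_pM ?nr_ge0 ?FC// (le_trans (GG' y))// ge_min lexx orbT.
  by rewrite le_eqVlt; apply/orP; left; apply/eqP; field; rewrite gt_eqF.
rewrite (le_trans (nrM _ _))// (@le_trans _ _ (e / (2 * (D + 1)) * (D + 1)))//.
  by rewrite ler_pM ?nr_ge0 ?FF'.
by rewrite le_eqVlt; apply/orP; left; apply/eqP; field; rewrite gt_eqF.
Qed.

Lemma uclosureZ S (k : R[i]) F : (forall F, S F -> S (fun y => k *: F y)) ->
  uclosure S F -> uclosure S (fun y => k *: F y).
Proof.
move=> SZ SF e e0; have k0 : 0 < nr k + 1 by rewrite ltr_wpDl// nr_ge0.
have [G SG FG] := SF _ (divr_gt0 e0 k0); exists (fun y => k *: G y); first exact: SZ.
move=> y; rewrite -scalerBr nrZ (@le_trans _ _ ((nr k + 1) * (e / (nr k + 1))))//.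
  by rewrite ler_pM ?nr_ge0 ?FG// lerDl.
by rewrite mulrC divfK// gt_eqF.
Qed.

Lemma uclosure_bounded S F : (forall F, S F -> fbounded F) -> uclosure S F -> fbounded F.
Proof.
move=> Sb /(_ _ ltr01)[G /Sb[C GC] FG]; exists (C + 1) => y.
by rewrite (le_trans (nrDB _ (G y)))// lerD ?GC ?FG.
Qed.

Record starSubalg := StarSubalg {
  smem :> (Y -> U) -> Prop;
  smem_bounded : forall F, smem F -> fbounded F;
  smem0 : smem (fun=> 0);
  smemD : forall F G, smem F -> smem G -> smem (fun y => F y + G y);
  smemZ : forall (k : R[i]) F, smem F -> smem (fun y => k *: F y);
  smemM : forall F G, smem F -> smem G -> smem (fun y => F y ⋅ G y);
  smemS : forall F, smem F -> smem (fun y => (F y)^†)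
}.

Variable S : starSubalg.

Let bnd F : uclosure S F -> fbounded F.
Proof. by apply: uclosure_bounded; exact: smem_bounded. Qed.

Definition closedSubalg : funSubalg Y U :=
  @FunSubalg R Y U (uclosure S) bnd (uclosure_sub (smem0 S))
    (fun F G => @uclosureD S F G (@smemD S))
    (fun k F => @uclosureZ S k F (@smemZ S k))
    (fun F G SF SG => @uclosureM S F G (@smemM S) (bnd SF) (bnd SG) SF SG)
    (fun F => @uclosureS S F (@smemS S))
    (fun F => @uclosureK S F).

End UniformClosure.

(** * Separability of countably generated algebras *)

Section GeneratedAlgebra.
Context {R : realType} {Y : Type} {U : cstarAlgType R}.
Variable g : nat -> Y -> U.
Hypothesis g_bounded : forall n, fbounded (g n).

Inductive gen_alg : (Y -> U) -> Prop :=
  | gen_alg_gen n : gen_alg (g n)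
  | gen_alg_add F G : gen_alg F -> gen_alg G -> gen_alg (fun y => F y + G y)
  | gen_alg_scale (k : R[i]) F : gen_alg F -> gen_alg (fun y => k *: F y)
  | gen_alg_mul F G : gen_alg F -> gen_alg G -> gen_alg (fun y => F y ⋅ G y)
  | gen_alg_star F : gen_alg F -> gen_alg (fun y => (F y)^†).

Lemma gen_alg_bounded F : gen_alg F -> fbounded F.
Proof.
elim=> {F} [n|F G _ [C FC] _ [D GD]|k F _ [C FC]|F G _ [C FC] _ [D GD]|F _ [C FC]].
- exact: g_bounded.
- by exists (C + D) => y; rewrite (le_trans (nrD _ _))// lerD ?FC ?GD.
- by exists (nr k * C) => y; rewrite nrZ ler_wpM2l ?nr_ge0 ?FC.
- by exists (C * D) => y; rewrite (le_trans (nrM _ _))// ler_pM ?nr_ge0 ?FC ?GD.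
- by exists C => y; rewrite nr_star FC.
Qed.

Lemma gen_alg0 : gen_alg (fun=> 0).
Proof.
rewrite (_ : (fun=> 0) = (fun y => (0 : R[i]) *: g 0 y)).
  by apply: gen_alg_scale; exact: gen_alg_gen.
by apply/funext => y; rewrite scale0r.
Qed.

Definition genSubalg : starSubalg :=
  StarSubalg gen_alg_bounded gen_alg0 gen_alg_add gen_alg_scale gen_alg_mul gen_alg_star.

(** An operation is coded by a number and a scalar with rational parts, so countable stages stay
    countable. Code 0 returns its argument, which makes the stages increase. *)
Definition rat_step (c : (nat * (rat * rat)) * ((Y -> U) * (Y -> U))) : Y -> U :=
  let: ((op, (p, q)), (F, G)) := c in
  match op with
  | 0%N => F
  | 1%N => fun y => F y + G y
  | 2%N => fun y => (ratr p +i* ratr q) *: F y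
  | 3%N => fun y => F y ⋅ G y
  | _ => fun y => (F y)^†
  end.

Fixpoint rat_stage n : set (Y -> U) :=
  if n is n'.+1 then rat_step @` ([set: nat * (rat * rat)] `*` (rat_stage n' `*` rat_stage n'))
  else range g.

Definition rat_alg : set (Y -> U) := \bigcup_n rat_stage n.

Lemma rat_alg_countable : countable rat_alg.
Proof.
apply: bigcup_countable => // n _; elim: n => [|n IH] /=.
  by apply: sub_countable (card_image_le _ _) _; exact: countableP.
apply: sub_countable (card_image_le _ _) _.
by apply: countableX; [exact: countableP | exact: countableX].
Qed.

Lemma rat_stage_nd m n : (m <= n)%N -> rat_stage m `<=` rat_stage n.
Proof.
move=> /subnKC <-; elim: (n - m)%N => [|k IH]; first by rewrite addn0.
rewrite addnS => F /IH SF /=.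
by exists ((0%N, (0, 0)), (F, F)).
Qed.

Lemma rat_alg_step op F G : rat_alg F -> rat_alg G -> rat_alg (rat_step (op, (F, G))).
Proof.
move=> [m _ mF] [n _ nG]; exists (maxn m n).+1 => //=.
exists (op, (F, G)) => //; do 2 (split => //=).
  by apply: rat_stage_nd mF; exact: leq_maxl.
by apply: rat_stage_nd nG; exact: leq_maxr.
Qed.

Lemma rat_alg_gen F : rat_alg F -> gen_alg F.
Proof.
move=> [n _]; elim: n F => [|n IH] F /=; first by case=> n _ <-; exact: gen_alg_gen.
move=> [[[op [p q]] [G H]] [_ [/= /IH GG /IH GH]] <-].
case: op => [|[|[|[|op]]]] //.
- exact: gen_alg_add.
- exact: gen_alg_scale.
- exact: gen_alg_mul.
- exact: gen_alg_star.
Qed.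

Lemma rat_alg_dense F : gen_alg F -> uclosure rat_alg F.
Proof.
elim=> {F} [n|F G _ IF _ IG|k F gF IF|F G gF IF gG IG|F _ IF].
- by apply: uclosure_sub; exists 0%N => //; exists n.
- apply: uclosureD IF IG => {}F {}G SF SG.
  exact: (rat_alg_step (1%N, (0, 0))).
- have [C C0 FC] := fbounded_pos (gen_alg_bounded gF).
  apply: uclosureK => e e0.
  have [p [q kpq]] := rational_complex_dense k (divr_gt0 e0 C0).
  exists (fun y => (ratr p +i* ratr q) *: F y).
    apply: uclosureZ IF => F' SF.
    exact: (rat_alg_step (2%N, (p, q)) SF SF).
  move=> y; rewrite -scalerBl nrZ (@le_trans _ _ (e / C * C))//.
    by rewrite ler_pM ?nr_ge0 ?FC// ltW.
  by rewrite divfK// gt_eqF.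
- apply: uclosureM IF IG; try exact: gen_alg_bounded.
  by move=> F' G' SF SG; exact: (rat_alg_step (3%N, (0, 0))).
- apply: uclosureS IF => {}F SF.
  exact: (rat_alg_step (4%N, (0, 0)) SF SF).
Qed.

Lemma genSubalg_separable : separable (funAlg (closedSubalg genSubalg)).
Proof.
exists [set F | rat_alg (fval F)].
  have /countable_injP[f f_inj] := rat_alg_countable.
  apply/countable_injP; exists (fun F => f (fval F)) => F G /set_mem SF /set_mem SG.
  by move=> /f_inj fFG; apply: funAlg_ext => y; rewrite fFG// inE.
apply: nr_dense => F e e0.
have e2 : 0 < e / 2 by rewrite divr_gt0.
have [|G GS FG] := @uclosureK _ _ _ rat_alg (fval F) _ _ e2.
  move=> d d0; have [G gG FG] : exists2 G, gen_alg G & forall y, nr (F y - G y) <= d.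
    exact: (fvalP F).
  by exists G => //; exact: rat_alg_dense.
exists (FunAlg (uclosure_sub (rat_alg_gen GS) : closedSubalg genSubalg G)) => //.
rewrite (@le_lt_trans _ _ (e / 2))//; last by rewrite ltr_pdivrMr// ltr_pMr// ltr1n.
by apply: nr_funAlg_le => [|y]; [exact: ltW | rewrite /= nrB; exact: FG].
Qed.

End GeneratedAlgebra.

(** * A properly infinite element without isometries in the multiplier algebra *)

Section OnePoint.
Context {R : realType} {X : topologicalType} (x0 : X).
Hypothesis one : forall x, x = x0.

Lemma one_point_space :
  [/\ [set: X] !=set0, @second_countable X, compact [set: X] & hausdorff_space X].
Proof.
have T1 : [set: X] = [set x0] by apply/seteqP; split => // x _; exact: one.
split.
- by exists x0.
- exists [set [set: X]]; first exact: countable1.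
  split; first by move=> _ ->; exact: openT.
  move=> x V xV; exists setT; first by split.
  move=> y _; rewrite (one y) -(one x); exact: nbhs_singleton.
- by rewrite T1; exact: compact_set1.
- by move=> x y _; rewrite (one x) (one y).
Qed.

Variable B : cstarAlgType R.

Definition point_hom (f : continuousType X R[i]) : multiplier B := mult_scale (f x0) mult_one.

Lemma point_homD f g : point_hom (ctsD f g) = point_hom f + point_hom g.
Proof. exact: mult_scaleDl. Qed.

Lemma point_homZ k f : point_hom (ctsZ k f) = k *: point_hom f.
Proof. exact/esym/mult_scaleA. Qed.

Lemma point_homM f g : point_hom (ctsM f g) = point_hom f * point_hom g.
Proof.
by apply: multiplier_ext => a /=; rewrite scalerA// mulrC.
Qed.

Lemma point_homJ f : point_hom (ctsJ f) = mult_star (point_hom f).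
Proof.
by apply: multiplier_ext => a /=; rewrite starZ starK.
Qed.

Lemma point_hom1 : point_hom cts1 = 1.
Proof. exact: mult_scale1. Qed.

Lemma point_hom_central f (m : multiplier B) : m * point_hom f = point_hom f * m.
Proof. by apply: multiplier_ext => a /=; rewrite ?lactZ ?ractZ. Qed.

Definition pointCx : cxAlgType R X :=
  CxAlg point_homD point_homZ point_homM point_homJ point_hom1 point_hom_central.

(** A function that vanishes at the only point acts as zero, so the fibre ideal is the closure of
    0. *)
Lemma point_fibre_eq0 (x : X) (b : pointCx) : fibre_pi x b = 0 -> b = 0.
Proof.
move=> /quot_pi_eq0 bI; apply: nr_small => e e0.
have [_ [s sx <-]] := iffLR (nr_closureP _ _) bI _ e0.
rewrite big_seq big1 ?sub0r ?nrN// => q /sx; rewrite (one x) => q0.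
by rewrite /cx_act /= q0 scale0r.
Qed.

Lemma standing_hyp_point (a b : B) : separable B -> strictly_positive a -> nr a <= 1 ->
  b != 0 -> standing_hyp (a : pointCx).
Proof.
move=> sB sa a1 b0; split.
- exact: one_point_space.
- exact: sB.
- move=> c; rewrite (_ : (fun x => _) = cst `|fibre_pi x0 (c : pointCx)|).
    by move=> x; exact: cvg_cst.
  by apply/funext => x; rewrite (one x).
- move=> x; exists (fibre_pi x (b : pointCx)).
  by apply: contra_neq b0 => /point_fibre_eq0.
- by split=> //; rewrite -[X in _ <= X](rmorph1 (real_complex R)) -nr_le.
Qed.

End OnePoint.

Section SecondExample.
Variable R : realType.
Let U := bop (R := R).
Implicit Types (r s n N : nat) (c d : R[i]).

Notation e_ := (@l2_basis R).

Definition v0 : adj (@l2_form R) := @cuntz R 0 isT.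
Definition v1 : adj (@l2_form R) := @cuntz R 1 isT.

Definition vr (b : bool) : adj (@l2_form R) :=
  if b then @cuntz R 2 isT else @cuntz R 3 isT.

Lemma vr_ortho b b' : (vr b)^† ⋅ vr b' = if b == b' then adj_one (@l2_form R) else 0.
Proof. by case: b; case: b'; rewrite cuntz_ortho. Qed.

Lemma vr_v0 b : (vr b)^† ⋅ v0 = 0.
Proof. by case: b; rewrite cuntz_ortho. Qed.

Lemma v1_ortho : v1^† ⋅ v1 = adj_one (@l2_form R).
Proof. by rewrite cuntz_ortho. Qed.

Lemma v1_e0 : v1^† (e_ 0) = 0.
Proof. exact: (@cuntz_star_basis R 1 0 isT isT 0). Qed.

(** The projection p of the construction. The algebra will live on the closed span of e_0 and the
    range of [p1], in which this range is the hyperplane orthogonal to e_0. *)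
Definition p1 : adj (@l2_form R) := v1 ⋅ v1^†.

Definition q0 : adj (@l2_form R) := theta (e_ 0) (e_ 0).

(* A unital copy of the Toeplitz-Cuntz algebra in the corner of [p1]. *)
Definition tr b : adj (@l2_form R) := v1 ⋅ vr b ⋅ v1^†.

(** Two orthonormal vectors of the corner, orthogonal to the ranges of both [tr]: the room in which
    copies of the direction e_0 are placed. *)
Definition fr b : l2 R := v1 (v0 (e_ b)).

(** An orthonormal basis of the space on which the algebra lives. *)
Definition jv n : l2 R := if n is n'.+1 then v1 (e_ n') else e_ 0.

Lemma frE b : fr b = jv (4 * b).+1.
Proof. by rewrite /fr /v0 cuntz_basis addn0. Qed.

Lemma p1_star : p1^† = p1.
Proof. by rewrite /p1 starM starK. Qed.

Lemma p1_v1 : p1 ⋅ v1 = v1.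
Proof. by rewrite /p1 -amulA v1_ortho amul_one. Qed.

Lemma p1_p1 : p1 ⋅ p1 = p1.
Proof. by rewrite {2}/p1 amulA p1_v1. Qed.

Lemma p1_e0 : p1 (e_ 0) = 0.
Proof. by rewrite -[p1 _]/(v1 (v1^† (e_ 0))) v1_e0 ap0. Qed.

Lemma p1_q0 : p1 ⋅ q0 = 0.
Proof.
by rewrite mul_theta p1_e0; apply: adj_ext => x; rewrite /= scaler0.
Qed.

Lemma q0_star : q0^† = q0.
Proof. exact: theta_star. Qed.

Lemma q0_p1 : q0 ⋅ p1 = 0.
Proof. by rewrite -q0_star -p1_star -starM p1_q0 star0. Qed.

Lemma q0_q0 : q0 ⋅ q0 = q0.
Proof. by rewrite theta_theta ip_basis scale1r. Qed.

Lemma q0_e0 : q0 (e_ 0) = e_ 0.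
Proof. by rewrite /= ip_basis scale1r. Qed.

Lemma q0_v1 : q0 ⋅ v1 = 0.
Proof.
rewrite theta_mul v1_e0; apply: adj_ext => x /=.
by rewrite ip_l20l scale0r.
Qed.

Definition dop c : adj (@l2_form R) := p1 + c *: q0.

Lemma dopM c d : dop c ⋅ dop d = dop (c * d).
Proof.
rewrite /dop !(amulDl, amulDr, amulZl, amulZr) p1_p1 p1_q0 q0_p1 q0_q0.
by rewrite !scaler0 addr0 add0r scalerA.
Qed.

Lemma dop_star c : (dop c)^† = dop (Num.conj c).
Proof. by rewrite starD starZ p1_star q0_star. Qed.

Lemma dop_v1 c : dop c ⋅ v1 = v1.
Proof. by rewrite amulDl amulZl p1_v1 q0_v1 scaler0 addr0. Qed.

Lemma dop_e0 c : dop c (e_ 0) = c *: e_ 0.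
Proof. by rewrite -[LHS]/(p1 (e_ 0) + c *: q0 (e_ 0)) p1_e0 q0_e0 add0r. Qed.


Lemma dop_jv n c : (n == 0)%N ==> (c == 1) -> dop c (jv n) = jv n.
Proof.
case: n => [/implyP/(_ (eqxx _))/eqP ->|n _].
  exact: etrans (dop_e0 _) (scale1r _).
by have := dop_v1 c => /(congr1 (fun T : adj (@l2_form R) => T (e_ n))).
Qed.

Lemma dop_tr c b : dop c ⋅ tr b = tr b.
Proof. by rewrite /tr !amulA dop_v1. Qed.

Lemma tr_dop c b : tr b ⋅ dop c = tr b.
Proof.
rewrite /tr -!amulA; congr (_ ⋅ (_ ⋅ _)).
by rewrite -[LHS]starK starM dop_star starK dop_v1.
Qed.

Lemma tr_tr b b' : (tr b)^† ⋅ tr b' = if b == b' then p1 else 0.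
Proof.
rewrite /tr !starM starK -!amulA (amulA v1^† v1) v1_ortho one_amul.
rewrite (amulA (vr b)^†) vr_ortho; case: eqP => _.
  by rewrite one_amul.
by rewrite amul0r amulr0.
Qed.

Lemma tr_fr b b' : (tr b)^† (fr b') = 0.
Proof.
have E : (tr b)^† ⋅ (v1 ⋅ v0) = 0.
  rewrite /tr !starM starK -!amulA (amulA v1^† v1) v1_ortho one_amul.
  by rewrite vr_v0 amulr0.
by have := congr1 (fun T : adj (@l2_form R) => T (e_ b')) E.
Qed.

Lemma fr_fr b b' : ip_l2 (fr b) (fr b') = (b == b')%:R.
Proof.
rewrite !frE -[LHS]/(ip_l2 (v1 (e_ (4 * b))) (v1 (e_ (4 * b')))) bop_adj.
have -> : v1^† (v1 (e_ (4 * b'))) = e_ (4 * b').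
  by have := congr1 (fun T : adj (@l2_form R) => T (e_ (4 * b'))) v1_ortho.
by rewrite ip_basis eqn_pmul2l//; case: b; case: b'.
Qed.

(** Constant sequences that generate the corner algebra, and all matrix units placed at a single n,
    enumerated by [unpickle]. The sequences thus obtained converge into the corner. *)
Definition gens (k : nat) : nat -> U :=
  match k with
  | 0%N => fun=> tr true
  | 1%N => fun=> tr false
  | k'.+2 =>
      if choice.unpickle k' is Some (n, (i, j)) then
        fun m => if m == n then theta (jv i) (jv j) else 0
      else fun=> 0
  end.

Lemma gens_bounded k : fbounded (gens k).
Proof.
case: k => [|[|k]]; [by exists (nr (tr true))|by exists (nr (tr false))|].
rewrite /gens; case: (choice.unpickle k) => [[n [i j]]|]; last by exists 0 => y; rewrite nr0.
exists (nr (theta (jv i) (jv j))) => m; case: ifP => // _.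
by rewrite nr0 nr_ge0.
Qed.

Let G := gen_alg gens.

Lemma gen_tr b : G (fun=> tr b).
Proof. by case: b; [exact: (gen_alg_gen _ 0)|exact: (gen_alg_gen _ 1)]. Qed.

Lemma gen_theta n i j : G (fun m => if m == n then theta (jv i) (jv j) else 0 : U).
Proof.
have := gen_alg_gen gens (choice.pickle (n, (i, j))).+2.
by rewrite /gens choice.pickleK.
Qed.

Lemma gen_add_theta F (c : nat -> R[i]) i j N : G F ->
  G (fun n => F n + (if (n < N)%N then c n else 0) *: theta (jv i) (jv j)).
Proof.
move=> GF; elim: N => [|N IH].
  by rewrite (_ : (fun n => _) = F)//; apply/funext => n; rewrite scale0r addr0.
rewrite (_ : (fun n => _) = fun n =>
  (F n + (if (n < N)%N then c n else 0) *: theta (jv i) (jv j)) +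
  c N *: (if n == N then theta (jv i) (jv j) else 0)).
  by apply: gen_alg_add IH _; apply: gen_alg_scale; exact: gen_theta.
apply/funext => n; rewrite -addrA; congr (_ + _); rewrite ltnS leq_eqVlt.
have [->|_] /= := eqVneq n N; first by rewrite ltnn scale0r add0r.
by rewrite scaler0 addr0.
Qed.

Lemma gen_dop (c : nat -> R[i]) N : G (fun n => dop (if (n < N)%N then c n else 0)).
Proof.
rewrite (_ : (fun n => _) = fun n => p1 + (if (n < N)%N then c n else 0) *: theta (jv 0) (jv 0))//.
apply: (gen_add_theta (F := fun=> p1)).
rewrite (_ : (fun=> p1) = fun=> (tr true)^† ⋅ tr true); last first.
  by apply/funext => n; rewrite tr_tr eqxx.
by apply: gen_alg_mul; [apply: gen_alg_star|]; exact: gen_tr.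
Qed.

Definition cutoff N n : adj (@l2_form R) := dop (if (n < N)%N then 1 else 0).

Lemma cutoff_star N n : (cutoff N n)^† = cutoff N n.
Proof. by rewrite /cutoff dop_star; case: ifP => _; rewrite ?rmorph1 ?rmorph0. Qed.

(** An algebraic expression contains finitely many generators supported at a single n, so for all
    large n its value lies in the corner. Thus the cutoffs are local units. *)
Lemma gen_stable F : G F -> exists N0, forall N, (N0 <= N)%N -> forall n,
  cutoff N n ⋅ F n = F n /\ F n ⋅ cutoff N n = F n.
Proof.
elim=> {F} [k|F H _ [N1 F1] _ [N2 H2]|k F _ [N1 F1]|F H _ [N1 F1] _ [N2 H2]|F _ [N1 F1]].
- case: k => [|[|k]].
  + by exists 0%N => N _ n; rewrite dop_tr tr_dop.
  + by exists 0%N => N _ n; rewrite dop_tr tr_dop.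
  + rewrite /gens; case: (choice.unpickle k) => [[m [i j]]|]; last first.
      by exists 0%N => N _ n; rewrite amul0r amulr0.
    exists m.+1 => N mN n; case: eqP => [->|_]; last by rewrite amul0r amulr0.
    rewrite mul_theta theta_mul cutoff_star /cutoff mN.
    by rewrite !dop_jv ?eqxx ?implybT.
- exists (maxn N1 N2) => N; rewrite geq_max => /andP[/F1 {}F1 /H2 {}H2] n.
  by rewrite (amulDr (cutoff N n)) (amulDl (F n)) (F1 n).1 (F1 n).2 (H2 n).1 (H2 n).2.
- by exists N1 => N /F1 {}F1 n; rewrite amulZl amulZr (F1 n).1 (F1 n).2.
- exists (maxn N1 N2) => N; rewrite geq_max => /andP[/F1 {}F1 /H2 {}H2] n.
  by rewrite amulA (F1 n).1 -amulA (H2 n).2.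
- exists N1 => N /F1 {}F1 n.
  by rewrite -(cutoff_star N n) -!starM (F1 n).1 (F1 n).2.
Qed.

Definition alg2 : cstarAlgType R := funAlg (closedSubalg (genSubalg gens_bounded)).

Definition el F (GF : G F) : alg2 :=
  FunAlg (uclosure_sub GF : closedSubalg (genSubalg gens_bounded) F).

Lemma alg2_approx (F : alg2) e : 0 < e -> exists H (GH : G H), nr (F - el GH) <= e.
Proof.
move=> e0; have [H GH FH] : exists2 H, G H & forall y, nr (F y - H y) <= e.
  by exact: (fvalP F).
by exists H, GH; apply: nr_funAlg_le; [exact: ltW|exact: FH].
Qed.

Lemma alg2_e0 (F : alg2) e : 0 < e -> exists N, forall n, (N <= n)%N ->
  nr (F n (e_ 0)) <= e.
Proof.
move=> e0; have [H [GH FH]] := alg2_approx F e0; have [N HN] := gen_stable GH.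
exists N => n Nn; have [_ Hn] := HN N (leqnn N) n.
have H0 : H n (e_ 0) = 0.
  by rewrite -Hn -[LHS]/(H n (cutoff N n (e_ 0))) dop_e0 ltnNge Nn scale0r ap0.
rewrite (_ : F n (e_ 0) = (F - el GH) n (e_ 0)).
  rewrite (le_trans (nr_ap _ _))// nr_basis mulr1.
  by rewrite (le_trans (nr_fval (F - el GH) n)).
by rewrite -[RHS]/(F n (e_ 0) - H n (e_ 0)) H0 subr0.
Qed.

Lemma alg2_dop1 (F : alg2) n : dop 1 ⋅ F n = F n.
Proof.
apply/eqP; rewrite -subr_eq0; apply/eqP/nr_small => e e0.
set C := nr (dop 1) + 1; have C0 : 0 < C by rewrite ltr_wpDl// nr_ge0.
have e2 : 0 < e / 2 by rewrite divr_gt0.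
have [H [GH FH]] := alg2_approx F (divr_gt0 e2 C0).
have [N HN] := gen_stable GH; have [Hn _] := HN _ (leq_maxl N n.+1) n.
have {}Hn : dop 1 ⋅ H n = H n by move: Hn; rewrite /cutoff leq_maxr.
have -> : dop 1 ⋅ F n - F n = dop 1 ⋅ (F n - H n) - (F n - H n).
  by rewrite (amulDr (dop 1)) amulNr Hn; lin.
have FHn : nr (F n - H n) <= e / 2 / C.
  by rewrite (le_trans (nr_fval (F - el GH) n)).
rewrite (le_lt_trans (nrD _ _))// nrN (@le_lt_trans _ _ (C * (e / 2 / C)))//.
  rewrite mulrDl mul1r lerD// (le_trans (nrM _ _))//.
  by rewrite ler_wpM2l ?nr_ge0.
by rewrite mulrC divfK ?gt_eqF// ltr_pdivrMr// ltr_pMr// ltr1n.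
Qed.

End SecondExample.

Section SecondExample2.
Variable R : realType.
Notation e_ := (@l2_basis R).
Notation A2 := (alg2 R).
Notation wt := (@harm R).

Lemma dopB (c d : R[i]) : dop c - dop d = (c - d) *: q0 R.
Proof. by rewrite /dop; lin. Qed.

Lemma nr_q0 : nr (q0 R) <= 1.
Proof. by rewrite (le_trans (nr_theta _ _))// !nr_basis mulr1. Qed.

Lemma nr_proj (P : adj (@l2_form R)) : P^† = P -> P ⋅ P = P -> nr P <= 1.
Proof.
move=> sP PP; have := nr_cstar (P : bop (R := R)); rewrite sP PP.
by have := nr_ge0 P; move: (nr P) => r; nra.
Qed.

Lemma nr_dop (c : R) : 0 <= c <= 1 -> nr (dop c%:C) <= 1.
Proof.
move=> /andP[c0 c1].
have -> : dop c%:C = c%:C *: dop 1 + (1 - c)%:C *: p1 R by rewrite /dop; lin.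
have P1 : nr (dop (1 : R[i])) <= 1.
  by apply: nr_proj; rewrite ?dop_star ?dopM ?rmorph1 ?mulr1.
have P2 : nr (p1 R) <= 1 by apply: nr_proj; rewrite ?p1_star ?p1_p1.
rewrite (le_trans (nrD _ _))// !nrZR !ger0_norm ?subr_ge0//.
by have := nr_ge0 (p1 R); nra.
Qed.

Lemma dop_harm_mem (f : nat -> R) : (forall n, 0 <= f n <= wt n) ->
  uclosure (gen_alg (gens R)) (fun n => dop (f n)%:C).
Proof.
move=> fw e /harm_small[N Ne].
exists (fun n => dop (if (n < N)%N then (f n)%:C else 0)); first exact: gen_dop.
move=> n; rewrite dopB nrZ (le_trans _ (ltW Ne))//.
have [nN|nN] := ltnP n N; first by rewrite subrr nr0 mul0r ltW// harm_gt0.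
have /andP[f0 f1] := fw n.
rewrite subr0 nr_real ger0_norm// (le_trans _ (harm_anti nN))//.
by rewrite (le_trans _ f1)// ler_piMr// nr_q0.
Qed.

Definition elw (f : nat -> R) (fw : forall n, 0 <= f n <= wt n) : A2 :=
  FunAlg (dop_harm_mem fw : closedSubalg (genSubalg (@gens_bounded R)) _).

Lemma harm_refl_bound n : 0 <= wt n <= wt n.
Proof. by rewrite lexx ltW// harm_gt0. Qed.

Lemma harm_sqr_bound n : 0 <= wt n ^+ 2 <= wt n.
Proof. by rewrite sqr_ge0 expr2 ler_piMr ?harm_le1// ltW// harm_gt0. Qed.

Definition h2 : A2 := elw harm_refl_bound.
Definition a2 : A2 := elw harm_sqr_bound.

Lemma h2_star : h2^† = h2.
Proof. by apply: funAlg_ext => n; rewrite /= dop_star conj_real. Qed.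

Lemma h2h2 : h2 ⋅ h2 = a2.
Proof. by apply: funAlg_ext => n; rewrite /= dopM -rmorphM -expr2. Qed.

Lemma a2_star : a2^† = a2.
Proof. by rewrite -h2h2 starM h2_star. Qed.

Lemma a2_neq0 : a2 != 0.
Proof.
apply/negP => /eqP /(congr1 (fun F : A2 => F 0%N (e_ 0) 0%N)).
rewrite [LHS]/= -[LHS]/(dop _ (e_ 0) 0%N) dop_e0 /= mulr1.
rewrite /wt invr1 expr1n => /eqP.
by rewrite rmorph1 oner_eq0.
Qed.

Lemma nr_a2 : nr a2 <= 1.
Proof.
apply: nr_funAlg_le => // n; apply: nr_dop.
by rewrite sqr_ge0 exprn_ile1// ?harm_le1// ltW// harm_gt0.
Qed.

Lemma a2_strictly_positive : strictly_positive a2.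
Proof.
split; first by exists h2; rewrite h2_star h2h2.
apply: nr_dense => F e e0.
have e2 : 0 < e / 2 by rewrite divr_gt0.
have [H [GH FH]] := alg2_approx F e2.
have [N /(_ N (leqnn N)) HN] := gen_stable GH.
(* The inverse of [a2] on n < N: its product with [a2] is [cutoff N], a unit for [H]. *)
have GC := gen_dop (fun n => ((wt n ^+ 2)^-1)%:C) N.
exists (a2 ⋅ (el GC ⋅ el GH ⋅ el GC) ⋅ a2); first by exists (el GC ⋅ el GH ⋅ el GC).
rewrite (_ : a2 ⋅ _ ⋅ a2 = el GH).
  rewrite nrB (le_lt_trans FH)// ltr_pdivrMr// ltr_pMr// ltr1n//.
apply: funAlg_ext => n; rewrite /= -!amulA.
have wn : wt n ^+ 2 != 0 by rewrite expf_neq0// gt_eqF// harm_gt0.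
have E : dop (wt n ^+ 2)%:C ⋅ dop (if (n < N)%N then ((wt n ^+ 2)^-1)%:C else 0) = cutoff R N n.
  rewrite dopM /cutoff; case: ifP => _; last by rewrite mulr0.
  by rewrite -rmorphM mulfV ?rmorph1.
have E' : dop (if (n < N)%N then ((wt n ^+ 2)^-1)%:C else 0) ⋅ dop (wt n ^+ 2)%:C = cutoff R N n.
  by rewrite -E !dopM mulrC.
by rewrite E' amulA E amulA (HN n).1 (HN n).2.
Qed.

Lemma gen_iso b N : gen_alg (gens R) (fun n => (tr R b)^† +
  (if (n < N)%N then (wt n)%:C else 0) *: theta (e_ 0) (fr R b)).
Proof.
rewrite frE; apply: (gen_add_theta (fun n => (wt n)%:C) 0 (4 * b).+1 N (F := fun=> (tr R b)^†)).
by apply: gen_alg_star; exact: gen_tr.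
Qed.

(** A coisometry of the corner plus, for n < N, the map taking [fr b] to a multiple of e_0. It lives
    on the corner, hence absorbs [a2] on its right. As [fr b] is orthogonal to the ranges of [tr],
    no cross terms occur, and the product with its adjoint is [a2] for n < N and [p1] beyond. *)
Definition iso2 b N : A2 := el (gen_iso b N).

Lemma iso2_dop b N n (c : R[i]) : iso2 b N n ⋅ dop c = iso2 b N n.
Proof.
rewrite /= (amulDl (tr R b)^†) amulZl; congr (_ + _ *: _).
  by rewrite -[LHS]starK starM dop_star starK dop_tr.
rewrite theta_mul dop_star frE; congr theta.
by apply: dop_jv.
Qed.

Lemma iso2M b b' N n : iso2 b N n ⋅ (iso2 b' N n)^† =
  if b == b' then dop (if (n < N)%N then (wt n ^+ 2)%:C else 0) else 0.
Proof.
rewrite /=; set c := if (n < N)%N then (wt n)%:C else 0.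
have cJ : Num.conj c = c by rewrite /c; case: ifP => _; rewrite ?conj_real ?rmorph0.
have cc : c * c = if (n < N)%N then (wt n ^+ 2)%:C else 0.
  by rewrite /c; case: ifP => _; rewrite ?mulr0// -rmorphM expr2.
rewrite starD starK starZ cJ theta_star (amulDl (tr R b)^†) !amulDr !amulZl !amulZr.
rewrite tr_tr mul_theta tr_fr theta0l theta_mul tr_fr theta0r theta_theta fr_fr.
rewrite !scaler0 addr0 add0r !scalerA cc -/(q0 R).
by case: b b' => -[] /=; rewrite ?mulr1n ?mulr0n ?mulr1 ?mulr0 ?scale0r ?addr0.
Qed.

Lemma a2_properly_infinite : properly_infinite a2.
Proof.
apply/properly_infiniteP; first exact: a2_star.
split; first exact: a2_neq0.
exists (iso2 true), (iso2 false).
have E b b' N n : (iso2 b N ⋅ a2 ⋅ (iso2 b' N)^†) n =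
    if b == b' then dop (if (n < N)%N then (wt n ^+ 2)%:C else 0) else 0.
  have -> : (iso2 b N ⋅ a2 ⋅ (iso2 b' N)^†) n =
    iso2 b N n ⋅ dop (wt n ^+ 2)%:C ⋅ (iso2 b' N n)^† by [].
  by rewrite iso2_dop iso2M.
have C b : (fun N => iso2 b N ⋅ a2 ⋅ (iso2 b N)^†) @ \oo --> a2.
  apply/nr_cvgnP => e e0; have e2 : 0 < e / 2 by rewrite divr_gt0.
  have [N Ne] := harm_small e2; exists N => m Nm.
  rewrite (@le_lt_trans _ _ (e / 2))//; last by rewrite ltr_pdivrMr// ltr_pMr// ltr1n.
  apply: nr_funAlg_le => [|n]; first exact: ltW.
  rewrite fvalB E eqxx dopB nrZ (le_trans _ (ltW Ne))//.
  have [nm|nm] := ltnP n m; first by rewrite subrr nr0 mul0r ltW// harm_gt0.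
  rewrite sub0r nrN nr_real ger0_norm ?sqr_ge0//.
  have /andP[w0 w1] := harm_sqr_bound n.
  rewrite (@le_trans _ _ (wt n ^+ 2))//; first by rewrite ler_piMr// nr_q0.
  by rewrite (le_trans w1)// harm_anti// (leq_trans Nm).
split=> //.
rewrite (_ : (fun N => _) = fun=> 0); first exact: cvg_cst.
by apply/funext => N; apply: funAlg_ext => n; rewrite E.
Qed.

Definition q_at n : A2 := el (gen_theta R n 0 0).

Lemma q_at_e0 n : q_at n n (e_ 0) = e_ 0.
Proof. by rewrite /= eqxx -[LHS]/(q0 R (e_ 0)) q0_e0. Qed.

Definition p_el : A2 := el (gen_dop (R := R) (fun=> 0) 0).

Lemma p_elE n : p_el n = p1 R.
Proof. by rewrite /= /dop scale0r addr0. Qed.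

Section Isometries.
Variables s t : multiplier A2.

(** The vector s(n) e_0, with the multiplier seen as a sequence of operators: [q_at n] is the
    projection onto e_0 placed at n. *)
Definition corner_vec s n : l2 R := lact s (q_at n) n (e_ 0).

Lemma corner_vec_ip (s' t' : multiplier A2) n :
  ip_l2 (corner_vec s' n) (corner_vec t' n) =
  ip_l2 (e_ 0) (lact (mult_star s' * t') (q_at n) n (e_ 0)).
Proof.
rewrite /corner_vec bop_adj.
have -> : (lact s' (q_at n) n)^† (lact t' (q_at n) n (e_ 0)) =
  ((lact s' (q_at n))^† ⋅ lact t' (q_at n)) n (e_ 0) by [].
rewrite mult_star_mul_act.
have -> : ((q_at n)^† ⋅ lact (mult_star s' * t') (q_at n)) n (e_ 0) =
  (q_at n n)^† (lact (mult_star s' * t') (q_at n) n (e_ 0)) by [].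
by rewrite -bop_adj q_at_e0.
Qed.

Lemma corner_vec_split (s' : multiplier A2) (e : R) : 0 < e ->
  exists N, forall n, (N <= n)%N ->
  exists2 y, nr y <= e &
    corner_vec s' n = y + ip_l2 (e_ 0) (corner_vec s' n) *: e_ 0.
Proof.
move=> /(alg2_e0 (ract s' p_el))[N sN]; exists N => n /sN se.
exists (ract s' p_el n (e_ 0)) => //.
have -> : ract s' p_el n (e_ 0) = p1 R (corner_vec s' n).
  have -> : p1 R (corner_vec s' n) = (p_el ⋅ lact s' (q_at n)) n (e_ 0).
    by rewrite /corner_vec -(p_elE n).
  rewrite -centralizer.
  by rewrite -[RHS]/(ract s' p_el n (q_at n n (e_ 0))) q_at_e0.
rewrite -[LHS]/(lact s' (q_at n) n (e_ 0)) -(alg2_dop1 (lact s' (q_at n)) n).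
by rewrite -[LHS]/(p1 R (corner_vec s' n) + 1 *: q0 R (corner_vec s' n)) scale1r.
Qed.

End Isometries.

Lemma alg2_not_pi : ~ multiplier_properly_infinite A2.
Proof.
move=> [s [t [ss tt st]]].
have st0 : mult_star s * t = 0.
  rewrite -[LHS]mul1r -[1]ss -[LHS]mulr1 -[1]tt.
  by rewrite -!mulrA (mulrA t) (mulrA s) (mulrA (s * _)) st mul0r mulr0.
have unit_vec (s' : multiplier A2) n : mult_star s' * s' = 1 -> nr (corner_vec s' n) = 1.
  move=> s1; apply/eqP; rewrite -(@eqrXn2 _ 2) ?nr_ge0// expr1n -nr_ip_l2xx.
  by rewrite corner_vec_ip s1 q_at_e0 ip_basis eqxx nr_one.
(* With errors 1/8 both coefficients on e_0 have modulus at least 7/8, while orthogonality bounds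
   their product by 1/4. *)
have e8 : 0 < 8^-1 :> R by rewrite invr_gt0.
have [N sN] := corner_vec_split s e8; have [M tM] := corner_vec_split t e8.
have [x x8 xE] := sN _ (leq_maxl N M); have [y y8 yE] := tM _ (leq_maxr N M).
set n := maxn N M in xE yE; have := corner_vec_ip s t n.
rewrite st0 [RHS]ip_l20r.
have := unit_vec s n ss; have := unit_vec t n tt.
move: (corner_vec s n) (corner_vec t n) xE yE => u v.
set a := ip_l2 (e_ 0) u; set b := ip_l2 (e_ 0) v => uE vE v1 u1 uv.
have a1 : nr a <= 1 by rewrite (le_trans (nr_ip_l2 _ _))// nr_basis mul1r u1.
have na (z w : l2 R) (c : R[i]) : nr z = 1 -> nr w <= 8^-1 -> z = w + c *: e_ 0 ->
    7 / 8 <= nr c.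
  move=> z1 w8 zE; have : nr z <= nr w + nr c.
    by rewrite zE (le_trans (nrD _ _))// nrZ nr_basis mulr1.
  by rewrite z1; lra.
have na' := na _ _ _ u1 x8 uE; have nb' := na _ _ _ v1 y8 vE.
have : ip_l2 u v = ip_l2 x v + Num.conj a * (ip_l2 (e_ 0) y + b).
  rewrite {1}uE ip_l2Dl ip_l2Zl /GRing.scale/=; congr (_ + _ * _).
  by rewrite {1}vE ip_l2Dr ip_l2Zr ip_basis /GRing.scale/= mulr1.
rewrite uv => /esym/eqP; rewrite mulrDr addrA addr_eq0 => /eqP E.
have : nr (Num.conj a * b) <= 8^-1 + 8^-1.
  rewrite -nrN -E (le_trans (nrD _ _))// lerD//.
    by rewrite (le_trans (nr_ip_l2 _ _))// v1 mulr1.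
  rewrite nr_mul nr_conj (le_trans (ler_wpM2l (nr_ge0 _) (nr_ip_l2 _ _)))//.
  rewrite nr_basis mul1r (le_trans _ y8)// ler_piMl ?nr_ge0//.
rewrite nr_mul nr_conj; move: (nr a) (nr b) na' nb' => p q; nra.
Qed.

Lemma second_example : exists (X : topologicalType) (A : cxAlgType R X) (a : A),
  [/\ standing_hyp a, properly_infinite a & ~ multiplier_properly_infinite A].
Proof.
(* The row vectors of length 0 serve as the one-point space. *)
have one (x : 'rV[R]_0) : x = 0 by rewrite thinmx0.
exists 'rV[R]_0, (@pointCx R 'rV[R]_0 0 A2), a2; split.
- apply: (standing_hyp_point one (b := a2)).
  + exact: genSubalg_separable.
  + exact: a2_strictly_positive.
  + exact: nr_a2.
  + exact: a2_neq0.
- exact: a2_properly_infinite.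
- exact: alg2_not_pi.
Qed.

End SecondExample2.

(** * The Poincare-Miranda theorem *)

Section CubicalCup.
Variables (M : nat).
Notation K := 'F_2.
Notation pt := ('I_M -> nat).
Implicit Types (x y b : pt) (d c i : 'I_M) (D : {set 'I_M}) (f a : pt -> K).

Definition upd x d t : pt := fun i => if i == d then t else x i.
Definition shift x d : pt := upd x d (x d).+1.

Lemma shiftC x d c : shift (shift x d) c = shift (shift x c) d.
Proof.
have [->//|cd] := eqVneq c d.
apply/funext => i; rewrite /shift /upd /= (negbTE cd) (eq_sym d) (negbTE cd).
by have [->|//] := eqVneq i c; rewrite (negbTE cd).
Qed.

(* The cup product of the coboundaries of the functions [fs] on the simplices of the
   Freudenthal triangulation issued from [x] with edge directions in [D]. *)
Fixpoint cup D (fs : seq (pt -> K)) x : K :=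
  if fs is f :: fs' then
    \sum_(d in D) (f (shift x d) - f x) * cup (D :\ d) fs' (shift x d)
  else 1.

Lemma F2_addrr (k : K) : k + k = 0.
Proof. by case: k => [[|[|]]] // ?; apply: val_inj. Qed.

Lemma F2_oppr (k : K) : - k = k.
Proof. by apply/eqP; rewrite eq_sym -subr_eq0 opprK F2_addrr. Qed.

(** Each unordered pair is counted twice, and 2 = 0. *)
Lemma sum_sym_eq0 D (F : 'I_M -> 'I_M -> K) : (forall d c, F d c = F c d) ->
  \sum_(d in D) \sum_(c in D :\ d) F d c = 0.
Proof.
move=> Fs; have E d : d \in D -> \sum_(c in D :\ d) F d c =
    \sum_(c in D | (c < d)%N) F d c + \sum_(c in D | (d < c)%N) F d c.
  move=> dD; rewrite (bigID (fun c : 'I_M => (c < d)%N)) /=; congr (_ + _).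
    apply: eq_bigl => c; rewrite !inE; have [->|//] := eqVneq c d.
    by rewrite ltnn !andbF.
  apply: eq_bigl => c; rewrite !inE -leqNgt; have [->|cd] /= := eqVneq c d.
    by rewrite ltnn !andbF.
  congr (_ && _); rewrite leq_eqVlt (_ : (d == c :> nat) = false)//.
  by apply: contra_neqF cd => /eqP dc; apply/val_inj.
rewrite (eq_bigr _ E) big_split /= [X in _ + X](exchange_big_dep (mem D)) /=; last first.
  by move=> d c _ /andP[].
rewrite -big_split /= big1 // => d dD.
rewrite [X in _ + X](_ : _ = \sum_(c in D | (c < d)%N) F d c) ?F2_addrr//.
by apply: eq_big => [c|c _]; [rewrite dD | rewrite Fs].
Qed.

Lemma setDDC D d c : D :\ d :\ c = D :\ c :\ d.
Proof. by rewrite !finset.setDDl finset.setUC. Qed.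

Lemma sum_exchange_pair D (F : 'I_M -> 'I_M -> K) :
  \sum_(d in D) \sum_(c in D :\ d) F d c = \sum_(d in D) \sum_(c in D :\ d) F c d.
Proof.
rewrite (exchange_big_dep (mem D)) /=; last first.
  by move=> d c dD; rewrite !inE => /andP[].
apply: eq_bigr => c cD; apply: eq_bigl => d.
by rewrite !inE cD andbT andbC eq_sym.
Qed.

(** A product of coboundaries is closed: its sum over the boundary of the unit cube at [x] with
    directions [D] is 0 modulo 2. The left side collects the far faces, the right side the near
    ones. Terms with a twofold shift are symmetric and cancel. *)
Lemma cup_shift D fs x :
  \sum_(d in D) cup (D :\ d) fs (shift x d) = \sum_(d in D) cup (D :\ d) fs x.
Proof.
elim: fs D x => [|f fs IH] D x; first exact: eq_bigr.
rewrite /=.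
have -> : \sum_(d in D) \sum_(c in D :\ d)
    (f (shift (shift x d) c) - f (shift x d)) * cup (D :\ d :\ c) fs (shift (shift x d) c) =
    - \sum_(d in D) f (shift x d) * \sum_(c in D :\ d) cup (D :\ d :\ c) fs (shift x d).
  transitivity (\sum_(d in D) \sum_(c in D :\ d)
     f (shift (shift x d) c) * cup (D :\ d :\ c) fs (shift (shift x d) c)
    - \sum_(d in D) f (shift x d) * \sum_(c in D :\ d) cup (D :\ d :\ c) fs (shift (shift x d) c)).
    rewrite -sumrB; apply: eq_bigr => d _; rewrite mulr_sumr -sumrB.
    by apply: eq_bigr => c _; rewrite mulrBl.
  rewrite sum_sym_eq0 ?sub0r; last by move=> d c; rewrite shiftC setDDC.
  by congr (- _); apply: eq_bigr => d _; rewrite IH.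
transitivity (\sum_(d in D) \sum_(c in D :\ d) f (shift x c) * cup (D :\ d :\ c) fs (shift x c)
   - f x * \sum_(d in D) \sum_(c in D :\ d) cup (D :\ d :\ c) fs (shift x c)); last first.
  rewrite mulr_sumr -sumrB; apply: eq_bigr => d _; rewrite mulr_sumr -sumrB.
  by apply: eq_bigr => c _; rewrite mulrBl.
have -> : \sum_(d in D) \sum_(c in D :\ d) cup (D :\ d :\ c) fs (shift x c) = 0.
  rewrite (eq_bigr (fun d => \sum_(c in D :\ d) cup (D :\ d :\ c) fs x)); last first.
    by move=> d _; rewrite IH.
  by apply: sum_sym_eq0 => d c; rewrite setDDC.
rewrite mulr0 subr0 [RHS]sum_exchange_pair.
rewrite F2_oppr; apply: eq_bigr => d _; rewrite mulr_sumr.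
by apply: eq_bigr => c _; rewrite setDDC.
Qed.

Lemma cup_const D fs x d v f : d \notin D -> x d = v -> List.In f fs ->
  (forall y z, y d = v -> z d = v -> f y = f z) -> cup D fs x = 0.
Proof.
move=> + + + fc; elim: fs D x => [|g fs IH] D x dD xd //= fin.
rewrite big1 // => c cD; have dc : d != c by apply: contraNneq dD => ->.
have sd : shift x c d = v by rewrite /shift /upd (negbTE dc).
case: fin => [->|fin]; first by rewrite (fc _ _ sd xd) subrr mul0r.
by rewrite (IH (D :\ c)) ?mulr0// !inE (negbTE dD) andbF.
Qed.

Lemma cup_neq0 D fs x : cup D fs x != 0 -> forall f, List.In f fs ->
  exists y z, [/\ forall i, (x i <= y i <= x i + (i \in D))%N,
    forall i, (x i <= z i <= x i + (i \in D))%N & f y != f z].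
Proof.
elim: fs D x => [|g fs IH] D x //= W.
have [d dD Wd] : exists2 d, d \in D &
    (g (shift x d) - g x) * cup (D :\ d) fs (shift x d) != 0.
  apply: contrapT => nW; move/negP: W; apply; apply/eqP; apply: big1 => d dD.
  by apply/eqP; apply: contrapT => /negP Wd; apply: nW; exists d.
have shift_le i : (x i <= shift x d i <= x i + (i \in D))%N.
  rewrite /shift /upd; case: eqP => [->|_]; first by rewrite dD addn1 leqnn leqnSn.
  by rewrite leqnn leq_addr.
move: Wd; rewrite mulf_eq0 negb_or => /andP[gd Wd] f [<-|fin].
  exists (shift x d), x; split=> //; last by rewrite -subr_eq0.
  by move=> i; rewrite leqnn leq_addr.
have [y [z [yx zx fyz]]] := IH _ _ Wd _ fin.
have box w : (forall i, (shift x d i <= w i <= shift x d i + (i \in D :\ d))%N) ->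
    forall i, (x i <= w i <= x i + (i \in D))%N.
  move=> wx i; have /andP[w1 w2] := wx i; have /andP[s1 s2] := shift_le i.
  rewrite (leq_trans s1 w1) (leq_trans w2)//.
  rewrite !inE /shift /upd; case: (eqVneq i d) => [->|_]/=; last by [].
  by rewrite dD addn0 addn1.
by exists y, z; split=> //; exact: box.
Qed.

Variable m : nat.

Fixpoint box_sum (ds : seq 'I_M) (F : pt -> K) b : K :=
  if ds is d :: ds' then \sum_(t < m) box_sum ds' F (upd b d t) else F b.

Lemma upd_upd x d c s t : d != c -> upd (upd x d s) c t = upd (upd x c t) d s.
Proof.
move=> dc; apply/funext => i; rewrite /upd; case: (eqVneq i c) => [->|//].
by rewrite eq_sym (negbTE dc).
Qed.

Lemma box_sum_upd ds F b d t : d \notin ds ->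
  box_sum ds F (upd b d t) = box_sum ds (fun x => F (upd x d t)) b.
Proof.
elim: ds b => [|c ds IH] b //=; rewrite inE negb_or => /andP[dc dds].
by apply: eq_bigr => s _; rewrite upd_upd// IH.
Qed.

Lemma box_sum_sum ds (I : finType) (P : pred I) (F : I -> pt -> K) b :
  \sum_(i | P i) box_sum ds (F i) b = box_sum ds (fun x => \sum_(i | P i) F i x) b.
Proof.
elim: ds b => [|c ds IH] b //=; rewrite exchange_big /=.
by apply: eq_bigr => s _; rewrite IH.
Qed.

Lemma eq_box_sum ds F G b : (forall x, F x = G x) -> box_sum ds F b = box_sum ds G b.
Proof. by move=> FG; congr box_sum; apply/funext. Qed.

Lemma box_sum_rem ds F b d : uniq ds -> d \in ds ->
  box_sum ds F b = box_sum (rem d ds) (fun x => \sum_(t < m) F (upd x d t)) b.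
Proof.
elim: ds b => [|c ds IH] b //= /andP[cds ds_uniq].
rewrite inE eq_sym; case: (eqVneq c d) => [cd _|cd /= dds].
  subst c; rewrite -box_sum_sum; apply: eq_bigr => t _.
  by rewrite box_sum_upd.
by apply: eq_bigr => s _; rewrite IH.
Qed.

Lemma box_sum_neq0 ds F b : box_sum ds F b != 0 ->
  exists x, [/\ forall i, i \in ds -> (x i < m)%N, forall i, i \notin ds -> x i = b i & F x != 0].
Proof.
elim: ds b => [|d ds IH] b /=; first by exists b.
move=> S; have [t /IH[x [xm xb Fx]]] : exists t : 'I_m, box_sum ds F (upd b d t) != 0.
  apply: contrapT => nS; move/negP: S; apply; apply/eqP; apply: big1 => t _.
  by apply/eqP; apply: contrapT => /negP St; apply: nS; exists t.
exists x; split=> // i; rewrite inE.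
  case/orP => [/eqP ->|/xm//]; have [/xm//|dds] := boolP (d \in ds).
  by rewrite (xb _ dds) /upd eqxx ltn_ord.
rewrite negb_or => /andP[id ids]; rewrite (xb _ ids) /upd.
by rewrite (negbTE id).
Qed.

Variable lab : 'I_M -> pt -> K.
Hypothesis lab0 : forall i x, x i = 0%N -> lab i x = 0.
Hypothesis lab1 : forall i x, x i = m -> lab i x = 1.

(* Stokes: the sum over the cube reduces to the face [x_i = m] for the first label [i]. *)
Lemma box_sum_cup js b : uniq js ->
  box_sum js (cup [set i in js] (map lab js)) b = 1.
Proof.
elim: js b => [|i js IH] b //= /andP[ijs js_uniq].
set D := [set j in i :: js]; set fs := map lab js.
have iD : i \in D by rewrite inE mem_head.
(* A primitive: by [cup_shift] the integrand is the sum over d of the increments of [Phi d] in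
   direction d, and these telescope. *)
pose Phi d x := lab i x * cup (D :\ d) fs x.
have E x : \sum_(d in D) (lab i (shift x d) - lab i x) * cup (D :\ d) fs (shift x d) =
    \sum_(d in D) (Phi d (shift x d) - Phi d x).
  transitivity (\sum_(d in D) Phi d (shift x d) -
      lab i x * \sum_(d in D) cup (D :\ d) fs (shift x d)).
    by rewrite mulr_sumr -sumrB; apply: eq_bigr => d _; rewrite mulrBl.
  by rewrite cup_shift mulr_sumr -sumrB.
rewrite -[LHS]/(box_sum (i :: js) (cup D (lab i :: fs)) b).
rewrite (eq_box_sum _ _ E) -box_sum_sum.
have tele d : d \in D -> box_sum (i :: js) (fun x => Phi d (shift x d) - Phi d x) b =
    box_sum (rem d (i :: js)) (fun x => Phi d (upd x d m) - Phi d (upd x d 0)) b.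
  rewrite inE => dD; rewrite (box_sum_rem _ _ _ dD); last by rewrite /= ijs.
  apply: eq_box_sum => x.
  rewrite -(@telescope_sumr _ 0%N m (fun t => Phi d (upd x d t)))// big_mkord.
  apply: eq_bigr => t _; congr (Phi d _ - _); apply/funext => j.
  by rewrite /shift /upd eqxx; case: eqP.
(* In a direction d other than i, [lab d] is among the remaining factors and is constant on each of
   the faces x_d = 0 and x_d = m, so both contributions vanish. In direction i the factor [lab i] is
   0 on one face and 1 on the other. *)
rewrite (bigD1 i iD) tele // big1; last first.
  move=> d /andP[dD di]; rewrite tele//.
  rewrite (@eq_box_sum _ _ (fun=> 0)); last first.
    have {}dD : d \in D by [].
    move=> x; have dis : d \in js by move: dD; rewrite inE in_cons (negbTE di).
    have fin : List.In (lab d) fs.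
      move: dis; rewrite /fs; elim: (js) => //= j l IHl; rewrite inE.
      by case/orP => [/eqP ->|/IHl]; [left | right].
    have dD' : d \notin D :\ d by rewrite !inE eqxx.
    have U t : upd x d t d = t by rewrite /upd eqxx.
    rewrite /Phi (cup_const dD' (U m) fin) ?(cup_const dD' (U 0%N) fin) ?mulr0 ?subrr//.
      by move=> y z yd zd; rewrite !lab0.
    by move=> y z yd zd; rewrite !lab1.
  by elim: (rem _ _) (b) => //= c l IHl b'; apply: big1 => t _; exact: IHl.
rewrite [LHS]addr0 /= eqxx -(IH (upd b i m))// box_sum_upd//.
apply: eq_box_sum => x; rewrite /Phi (lab0 (x := upd x i 0)) ?mul0r ?subr0; last first.
  by rewrite /upd eqxx.
rewrite lab1 ?mul1r; last by rewrite /upd eqxx.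
congr (cup _ _ _); apply/setP => j; rewrite !inE.
by case: (eqVneq j i) => [->|]//=; rewrite (negbTE ijs).
Qed.

(** A cubical form of Sperner's lemma: the sum being 1, some cell has a nonzero term, and then no
    label is constant on its vertices. *)
Lemma kuhn_lemma : exists x, (forall i, (x i < m)%N) /\
  forall i, exists y z, [/\ forall j, (x j <= y j <= (x j).+1)%N,
    forall j, (x j <= z j <= (x j).+1)%N & lab i y != lab i z].
Proof.
have := box_sum_cup (fun=> 0%N) (enum_uniq 'I_M) => S1.
have S0 : box_sum (enum 'I_M) (cup [set i in enum 'I_M] (map lab (enum 'I_M))) (fun=> 0%N) != 0.
  by rewrite S1 oner_eq0.
have [x [xm _ Wx]] := box_sum_neq0 S0.
exists x; split=> i; first by apply: xm; rewrite mem_enum.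
have fin : List.In (lab i) (map lab (enum 'I_M)).
  have : i \in enum 'I_M by rewrite mem_enum.
  elim: (enum _) => //= j l IHl; rewrite inE.
  by case/orP => [/eqP ->|/IHl]; [left | right].
have [y [z [yx zx yz]]] := cup_neq0 Wx fin; exists y, z.
by split=> // j; [have := yx j|have := zx j]; rewrite inE mem_enum addn1.
Qed.

End CubicalCup.

Section PoincareMiranda.
Context {R : realType}.
Variables (M : nat) (F : 'I_M -> 'rV[R]_M -> R).
Hypothesis Fc : forall i, continuous (F i).
Let cube : set 'rV[R]_M := [set x | forall i, x ord0 i \in `[-1, 1]].
Hypothesis F_lo : forall i x, cube x -> x ord0 i = -1 -> F i x <= 0.
Hypothesis F_hi : forall i x, cube x -> x ord0 i = 1 -> 0 <= F i x.

Let node (m : nat) (x : 'I_M -> nat) : 'rV[R]_M :=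
  \row_i (-1 + 2 * (x i)%:R / m.+1%:R).

Lemma grid_sign_change m : exists q : 'rV[R]_M, cube q /\
  forall i, exists y z : 'rV[R]_M,
  [/\ forall j, `|q ord0 j - y ord0 j| <= 2 / m.+1%:R,
      forall j, `|q ord0 j - z ord0 j| <= 2 / m.+1%:R, 0 <= F i y & F i z <= 0].
Proof.
(* The sign of [F i] at the node, except that on the two faces the values 0 and 1 are imposed, as
   [kuhn_lemma] demands. By [F_lo] and [F_hi] the label still tells the weak sign. The grid has m +
   1 steps, hence at least one. *)
pose lab (i : 'I_M) (x : 'I_M -> nat) : 'F_2 :=
  ((x i != 0%N) && ((x i == m.+1) || (0 < F i (node m x))))%:R.
have [||x [xm xi]] := @kuhn_lemma M m.+1 lab.
- by move=> i x x0; rewrite /lab x0.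
- by move=> i x x0; rewrite /lab x0 eqxx.
have m0 : 0 < m.+1%:R :> R by rewrite ltr0n.
have node_in (w : 'I_M -> nat) : (forall j, (w j <= m.+1)%N) -> cube (node m w).
  move=> wm j; rewrite mxE in_itv /= -mulrA.
  have t0 : 0 <= (w j)%:R / m.+1%:R :> R by rewrite divr_ge0.
  have t1 : (w j)%:R / m.+1%:R <= 1 :> R by rewrite ler_pdivrMr// mul1r ler_nat.
  by move: (_ / _) t0 t1 => t t0 t1; apply/andP; split; lra.
have near_x (w : 'I_M -> nat) : (forall j, (x j <= w j <= (x j).+1)%N) ->
    (forall j, (w j <= m.+1)%N) /\
    forall j, `|node m x ord0 j - node m w ord0 j| <= 2 / m.+1%:R.
  move=> wx; split=> j; have /andP[w1 w2] := wx j; first exact: leq_trans w2 (xm j).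
  rewrite !mxE opprD addrACA subrr add0r -mulrBl -mulrBr normrM normrM.
  rewrite [X in _ * X]ger0_norm ?invr_ge0// ler_wpM2r ?invr_ge0//.
  rewrite ger0_norm// ler_piMr// distrC ger0_norm ?subr_ge0 ?ler_nat//.
  by rewrite lerBlDr addrC natr1 ler_nat.
have sgn (w : 'I_M -> nat) i : (forall j, (w j <= m.+1)%N) ->
    if lab i w == 1 then 0 <= F i (node m w) else F i (node m w) <= 0.
  move=> wm; have cw := node_in _ wm; rewrite /lab.
  have [w0|w0] /= := eqVneq (w i) 0%N.
    by apply: F_lo => //; rewrite mxE w0 mulr0 mul0r addr0.
  have [wM|wM] /= := eqVneq (w i) m.+1.
    apply: F_hi => //; rewrite mxE wM mulfK ?gt_eqF//.
    by rewrite addrC -{1}[2]natr1 addrK.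
  have [FP|FN] := ltP 0 (F i (node m w)); first by rewrite ltW.
  by [].
exists (node m x); split; first by apply: node_in => j; exact: ltnW.
move=> i; have [y [z [/near_x[ym yx] /near_x[zm zx] yz]]] := xi i.
have := sgn y i ym; have := sgn z i zm.
have lab01 w : lab i w = 1 \/ lab i w = 0 by rewrite /lab; case: (_ && _); [left|right].
case: (lab01 y) yz => ->; case: (lab01 z) => -> //=; rewrite ?eqxx// => _.
- by move=> Fz Fy; exists (node m y), (node m z).
- by move=> Fz Fy; exists (node m z), (node m y).
Qed.

Lemma poincare_miranda : exists2 x, cube x & forall i, F i x = 0.
Proof.
have [q qP] := choice grid_sign_change.
have cpt : compact cube.
  apply: (@rV_compact _ M (fun=> `[(-1 : R), 1]%classic)) => i.
  exact: segment_compact.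
have [x [cx clx]] : cube `&` cluster (q @ \oo) !=set0.
  by apply: cpt; exists 0%N => // n _; exact: (qP n).1.
exists x => // i.
(* Some small cell lies entirely in any given neighbourhood of [x], so a strict sign of [F i] near
   [x] contradicts the vertices of opposite weak signs. *)
have near_x (P : set 'rV[R]_M) : nbhs x P -> exists n, forall w : 'rV[R]_M,
    (forall j, `|q n ord0 j - w ord0 j| <= 2 / n.+1%:R) -> P w.
  move=> /nbhs_ballP[e /= e0 xP].
  have e4 : 0 < e / 4 by rewrite divr_gt0.
  have [N] := ltr_add_invr e4; rewrite add0r => Ne.
  have Qn : (q @ \oo) [set q n | n in [set n | (N <= n)%N]].
    by exists N => // n Nn; exists n.
  have e2 : 0 < e / 2 by rewrite divr_gt0.
  have [_ [[n /= Nn <-] xq]] := clx _ _ Qn (nbhsx_ballx x _ e2).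
  exists n => w qw; apply: xP; split => // a j; rewrite !ord1 {a}.
  have /(_ ord0 j) := xq.2; rewrite /ball /= => xqj.
  rewrite (le_lt_trans (ler_distD (q n ord0 j) _ _))// (splitr e) ltrD//.
  rewrite (le_lt_trans (qw j))// (@le_lt_trans _ _ (2 / N.+1%:R))//.
    by rewrite ler_pM2l// lef_pV2 ?posrE// ler_nat.
  by rewrite mulrC -ltr_pdivlMr// (lt_le_trans Ne)// -mulrA -invfM -natrM.
have [Fx|Fx|//] := ltgtP (F i x) 0.
- have [n Pn] := near_x _ (cvgr_lt _ (@Fc i x) _ Fx); have [_ /(_ i)[y [z [yq _ Fy _]]]] := qP n.
  by have := Pn y yq; rewrite /= ltNge Fy.
- have [n Pn] := near_x _ (cvgr_gt _ (@Fc i x) _ Fx); have [_ /(_ i)[y [z [_ zq _ Fz]]]] := qP n.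
  by have := Pn z zq; rewrite /= ltNge Fz.
Qed.

End PoincareMiranda.

(** * The Hilbert ball *)

Lemma continuous_sum (K : numFieldType) (V : normedModType K) (T : topologicalType)
    (I : Type) (r : seq I) (P : pred I) (f : I -> T -> V) :
  (forall i, P i -> continuous (f i)) ->
  continuous (fun t => \sum_(i <- r | P i) f i t).
Proof.
apply: continuous_big => x.
by apply: (@cvgD _ _ _ _ _ fst snd); [exact: cvg_fst | exact: cvg_snd].
Qed.

Section HilbertBall.
Variable R : realType.

Definition real_seq : Type := prod_topology (fun _ : nat => R).

HB.instance Definition _ := PseudoMetric.on real_seq.
HB.instance Definition _ := Pointed.on real_seq.

Definition unit_ball_set : set (prod_topology (fun _ : nat => R)) :=
  [set x : nat -> R | forall n, \sum_(k < n) x k ^+ 2 <= 1].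

(** On the unit ball of l^2 the weak topology is coordinatewise convergence, so a subspace of a
    countable product of lines is taken: compact by Tychonoff, and pseudometric, whence second
    countable. Coordinates 2k and 2k+1 will be real and imaginary parts, see [zeta]. *)
Definition hball : Type := set_type unit_ball_set.

HB.instance Definition _ := PseudoMetric.on hball.

Definition mk_hball (x : nat -> R) (Hx : unit_ball_set x) : hball :=
  exist _ x (mem_set Hx).

Lemma zero_in_ball : unit_ball_set (fun=> 0).
Proof. by move=> n; rewrite big1// => k _; rewrite expr0n. Qed.

HB.instance Definition _ := isPointed.Build hball (mk_hball zero_in_ball).

Definition bcoord (k : nat) (z : hball) : R := (val z : nat -> R) k.

Lemma bcoord_bound z n : \sum_(k < n) bcoord k z ^+ 2 <= 1.
Proof. exact: (set_mem (valP z)). Qed.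

Lemma bcoord_continuous k : continuous (bcoord k).
Proof.
move=> z; apply: (@continuous_comp hball (prod_topology (fun _ : nat => R)) R
  (set_val : hball -> prod_topology (fun _ : nat => R)) (@proj nat (fun=> R) k)).
  exact: initial_continuous.
exact: proj_continuous.
Qed.

Lemma bcoord_ext (y z : hball) : (forall k, bcoord k y = bcoord k z) -> y = z.
Proof.
by move=> yz; apply: val_inj; apply/funext => k; exact: yz.
Qed.

Lemma hball_continuous (S : topologicalType) (f : S -> hball) :
  (forall k, continuous (bcoord k \o f)) -> continuous f.
Proof.
move=> fc; apply: continuous_comp_initial => s.
apply/cvg_sup => k A [B /= [[W oW WB]] Bs BA].
have Ws : W (bcoord k (f s)) by move: Bs; rewrite -WB.
apply: filterS BA _; rewrite -WB.
by apply: (fc k s); exact: open_nbhs_nbhs.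
Qed.

Lemma hball_hausdorff : hausdorff_space hball.
Proof.
move=> p q pq; apply: bcoord_ext => k; apply: (@Rhausdorff R) => A B pA qB.
have [z [Az Bz]] := pq _ _ (@bcoord_continuous k p A pA) (@bcoord_continuous k q B qB).
by exists (bcoord k z).
Qed.

Lemma unit_ball_closed : closed unit_ball_set.
Proof.
pose f n (x : prod_topology (fun _ : nat => R)) : R := \sum_(k < n) x k ^+ 2.
have fc n : continuous (f n).
  apply: continuous_sum => k _ x.
  apply: (@continuous_comp (prod_topology (fun _ : nat => R)) R R
    (@proj nat (fun=> R) k) (fun r => r ^+ 2)).
    exact: proj_continuous.
  exact: exprn_continuous.
rewrite (_ : unit_ball_set = \bigcap_n (f n @^-1` [set r | r <= 1])).
  apply: closed_bigI => n _; apply: closed_comp => //; exact: closed_le.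
by apply/seteqP; split => x xB n; [move=> _; exact: xB | exact: xB n I].
Qed.

Lemma hball_compact : compact [set: hball].
Proof.
have Bc : compact unit_ball_set.
  have := @tychonoff nat (fun=> R) (fun=> `[(-1 : R), 1]%classic)
    (fun=> @segment_compact R (-1) 1).
  move/(subclosed_compact unit_ball_closed); apply => x xB k.
  rewrite /= in_itv /= -ler_norml -(expr_le1 (n := 2))// real_normK ?num_real//.
  rewrite (le_trans _ (xB k.+1))// big_ord_recr /= lerDr.
  by apply: sumr_ge0 => i _; exact: sqr_ge0.
move=> F FF _; pose G := (set_val : hball -> _) @ F.
have [p [pB pG]] : unit_ball_set `&` cluster G !=set0.
  apply: Bc; rewrite /G /= /nbhs /=; apply: filterS filterT => z _ /=.
  exact: (set_mem (valP z)).
exists (mk_hball pB); split=> // A B FA [C [[W oW WC] Cp CB]].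
have GA : G ((set_val : hball -> _) @` A).
  by apply: (@filterS hball F) FA => z Az; exists z.
have Wp : W p by move: Cp; rewrite -WC.
have [_ [[z Az <-] Wz]] := pG _ _ GA (open_nbhs_nbhs (conj oW Wp)).
by exists z; split => //; apply: CB; rewrite -WC.
Qed.

Lemma hball_second_countable : @second_countable hball.
Proof. exact: (compact_second_countable (T := hball) hball_compact). Qed.

End HilbertBall.

(** * Hereditary subalgebras of C(X, U) *)

Lemma continuous_cst (X Y : topologicalType) (y : Y) : continuous (fun _ : X => y).
Proof. by move=> x; exact: cvg_cst. Qed.

Section ContinuousMaps.
Context {R : realType} {X : topologicalType}.

Lemma continuous_amul (U : normedStarAlgType R) (F G : X -> U) :
  continuous F -> continuous G -> continuous (fun x => F x ⋅ G x).
Proof. by move=> Fc Gc x; apply: cvg_amul; [exact: Fc|exact: Gc]. Qed.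

Lemma continuous_star (U : normedStarAlgType R) (F : X -> U) :
  continuous F -> continuous (fun x => (F x)^†).
Proof. by move=> Fc x; apply: cvg_star; exact: Fc. Qed.

Variable V : normedModType R[i].
Implicit Types F G : X -> V.

Lemma continuous_addv F G :
  continuous F -> continuous G -> continuous (fun x => F x + G x).
Proof. by move=> Fc Gc x; apply: cvgD; [exact: Fc|exact: Gc]. Qed.

Lemma continuous_oppv F : continuous F -> continuous (fun x => - F x).
Proof. by move=> Fc x; apply: cvgN; exact: Fc. Qed.

Lemma continuous_scalev (f : X -> R[i]) F :
  continuous f -> continuous F -> continuous (fun x => f x *: F x).
Proof. by move=> fc Fc x; apply: cvgZ; [exact: fc|exact: Fc]. Qed.

Lemma continuous_nr F : continuous F -> continuous (fun x => nr (F x) : R).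
Proof.
move=> /nr_continuousP Fc x; apply/cvgrPdist_lt => e /(Fc x).
by apply: filterS => y; rewrite distrC => /(le_lt_trans (nr_dist _ _)).
Qed.

Lemma continuous_uniform_limit F :
  (forall e : R, 0 < e -> exists2 G, continuous G & forall x, nr (F x - G x) <= e) ->
  continuous F.
Proof.
move=> FG; apply/nr_continuousP => x e e0.
have e3 : 0 < e / 3 by rewrite divr_gt0.
have [G /nr_continuousP Gc FGe] := FG _ e3.
have := Gc x _ e3; apply: filterS => y Gyx.
rewrite (le_lt_trans (nr_triangle (G y) _ _))// (_ : e = e / 3 + (e / 3 + e / 3)); last by lra.
rewrite ler_ltD ?FGe// (le_lt_trans (nr_triangle (G x) _ _))// ltr_leD// nrB; exact: FGe.
Qed.

Hypothesis Xc : compact [set: X].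

Lemma continuous_attains_min (f : X -> R) (x0 : X) : continuous f -> exists x, forall y, f x <= f y.
Proof.
move=> fc; have [||c _ cmin] := @compact_EVT_min X R f setT _ Xc.
- by exists x0.
- exact: continuous_subspaceT.
- by exists c => y; apply: cmin; rewrite inE.
Qed.

Lemma continuous_bounded F : continuous F -> exists C : R, forall x, nr (F x) <= C.
Proof.
move=> Fc; have [[x0]|X0] := pselect (inhabited X); last first.
  by exists 0 => x; case: X0; exists.
have [c cmin] := @continuous_attains_min (fun x => - nr (F x)) x0
  (fun x => cvgN (@continuous_nr F Fc x)).
by exists (nr (F c)) => y; rewrite -lerN2 cmin.
Qed.

End ContinuousMaps.

Lemma amul_injl (R : realType) (B : cstarAlgType R) (a b : B) :
  (forall c, c ⋅ a = c ⋅ b) -> a = b.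
Proof.
move=> ab; apply/eqP; rewrite -subr_eq0 -normr_eq0.
have := cstar_identity (a - b); rewrite amulDr amulNr ab subrr normr0.
by move=> /esym/eqP; rewrite expf_eq0.
Qed.

Lemma amul_injr (R : realType) (B : cstarAlgType R) (a b : B) :
  (forall c, a ⋅ c = b ⋅ c) -> a = b.
Proof.
move=> ab; apply: (can_inj (@starK R B)); apply: amul_injl => c.
by apply: (can_inj (@starK R B)); rewrite !starM !starK ab.
Qed.

Section HereditaryFunctions.
Context {R : realType} {X : topologicalType} {U : cstarAlgType R}.
Hypothesis Xc : compact [set: X].
Variable h : X -> U.
Hypotheses (hc : continuous h) (hs : forall x, (h x)^† = h x).

Definition hered_mem (F : X -> U) :=
  exists2 T, continuous T & F = fun x => h x ⋅ T x ⋅ h x.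

Lemma hered_continuous F : hered_mem F -> continuous F.
Proof.
by move=> [T Tc ->]; apply: continuous_amul => //; exact: continuous_amul.
Qed.

Lemma hered_bounded F : hered_mem F -> fbounded F.
Proof. by move=> /hered_continuous /(continuous_bounded Xc). Qed.

Lemma hered0 : hered_mem (fun=> 0).
Proof.
exists (fun=> 0); first by move=> x; exact: cvg_cst.
by apply/funext => x; rewrite amulr0 amul0r.
Qed.

Lemma heredD F G : hered_mem F -> hered_mem G -> hered_mem (fun x => F x + G x).
Proof.
move=> [S Sc ->] [T Tc ->]; exists (fun x => S x + T x); first exact: continuous_addv.
by apply/funext => x; rewrite amulDr amulDl.
Qed.

Lemma hered_scale (f : X -> R[i]) F : continuous f -> hered_mem F ->
  hered_mem (fun x => f x *: F x).
Proof.
move=> fc [T Tc ->]; exists (fun x => f x *: T x); first exact: continuous_scalev.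
by apply/funext => x; rewrite amulZr amulZl.
Qed.

Lemma heredZ (k : R[i]) F : hered_mem F -> hered_mem (fun x => k *: F x).
Proof. by apply: hered_scale => x; exact: cvg_cst. Qed.

Lemma heredM F G : hered_mem F -> hered_mem G -> hered_mem (fun x => F x ⋅ G x).
Proof.
move=> [S Sc ->] [T Tc ->]; exists (fun x => S x ⋅ (h x ⋅ (h x ⋅ T x))).
  by do 3 (apply: continuous_amul => //).
by apply/funext => x; rewrite !amulA.
Qed.

Lemma heredS F : hered_mem F -> hered_mem (fun x => (F x)^†).
Proof.
move=> [T Tc ->]; exists (fun x => (T x)^†); first exact: continuous_star.
by apply/funext => x; rewrite !starM hs amulA.
Qed.

Definition hered_star : starSubalg :=
  StarSubalg hered_bounded hered0 heredD heredZ heredM heredS.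

(* The hereditary C*-subalgebra of C(X, U) generated by h. *)
Definition hered_alg : cstarAlgType R := funAlg (closedSubalg hered_star).

Implicit Types (F G : hered_alg) (f : continuousType X R[i]).

Lemma hered_approx F e : 0 < e -> exists2 T, continuous T &
  forall x, nr (F x - h x ⋅ T x ⋅ h x) <= e.
Proof.
move=> e0; have [_ [T Tc ->] FT] : exists2 H, hered_mem H & forall x, nr (F x - H x) <= e.
  exact: (fvalP F).
by exists T.
Qed.

Lemma fval_continuous F : continuous F.
Proof.
apply: continuous_uniform_limit => e /(hered_approx F)[T Tc FT].
by exists (fun x => h x ⋅ T x ⋅ h x) => //; apply: hered_continuous; exists T.
Qed.

Lemma hered_el_mem T : continuous T -> uclosure hered_mem (fun x => h x ⋅ T x ⋅ h x).
Proof. by move=> Tc; apply: uclosure_sub; exists T. Qed.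

Definition hered_el T (Tc : continuous T) : hered_alg :=
  FunAlg (hered_el_mem Tc : closedSubalg hered_star _).

Lemma hered_act_mem (f : X -> R[i]) F : continuous f -> uclosure hered_mem (fun x => f x *: F x).
Proof.
move=> fc e e0; have [C fC] := continuous_bounded Xc fc.
have C1 : 0 < `|C| + 1 by rewrite ltr_wpDl.
have [T Tc FT] := hered_approx F (divr_gt0 e0 C1).
exists (fun x => f x *: (h x ⋅ T x ⋅ h x)); first by apply: hered_scale => //; exists T.
move=> x; rewrite -scalerBr nrZ (@le_trans _ _ ((`|C| + 1) * (e / (`|C| + 1))))//.
  rewrite ler_pM ?nr_ge0 ?FT// (le_trans (fC x))// (le_trans (ler_norm _))// lerDl.
  exact: ler01.
by rewrite mulrC divfK// gt_eqF.
Qed.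

Definition hered_act f F : hered_alg :=
  FunAlg (hered_act_mem F (@cts_fun X R[i] f) : closedSubalg hered_star _).

Lemma hered_act_linear f : linear (hered_act f).
Proof.
move=> k F G; apply: funAlg_ext => x /=; rewrite scalerDr !scalerA; congr (_ *: _ + _).
exact: mulrC.
Qed.

Lemma hered_act_continuous f : continuous (hered_act f).
Proof.
have [C fC] := continuous_bounded Xc (@cts_fun X R[i] f).
have C0 : 0 <= `|C| by [].
apply: (@lipschitz_continuous _ _ _ `|C|%:C); first by rewrite ler0c.
move=> F G; rewrite !nrE -rmorphM lecR; apply: nr_funAlg_le.
  by rewrite mulr_ge0// nr_ge0.
move=> x; have -> : (hered_act f F - hered_act f G) x = f x *: (F - G) x.
  by rewrite !fvalB /= scalerBr.
by rewrite nrZ ler_pM ?nr_ge0 ?nr_fval// (le_trans (fC x))// ler_norm.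
Qed.

Program Definition hered_hom f : multiplier hered_alg :=
  @Multiplier R hered_alg (hered_act f) (hered_act f) _ _ _ _ _ _ _.
Next Obligation. exact: hered_act_linear. Qed.
Next Obligation. exact: hered_act_linear. Qed.
Next Obligation. exact: hered_act_continuous. Qed.
Next Obligation. exact: hered_act_continuous. Qed.
Next Obligation. by move=> f F G; apply: funAlg_ext => x /=; rewrite amulZl. Qed.
Next Obligation. by move=> f F G; apply: funAlg_ext => x /=; rewrite amulZr. Qed.
Next Obligation. by move=> f F G; apply: funAlg_ext => x /=; rewrite amulZr amulZl. Qed.

Lemma hered_homD f g : hered_hom (ctsD f g) = hered_hom f + hered_hom g.
Proof. by apply: multiplier_ext => F; apply: funAlg_ext => x /=; rewrite scalerDl. Qed.

Lemma hered_homZ k f : hered_hom (ctsZ k f) = k *: hered_hom f.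
Proof. by apply: multiplier_ext => F; apply: funAlg_ext => x /=; rewrite scalerA. Qed.

Lemma hered_homM f g : hered_hom (ctsM f g) = hered_hom f * hered_hom g.
Proof.
by apply: multiplier_ext => F; apply: funAlg_ext => x /=; rewrite scalerA// mulrC.
Qed.

Lemma hered_homJ f : hered_hom (ctsJ f) = mult_star (hered_hom f).
Proof. by apply: multiplier_ext => F; apply: funAlg_ext => x /=; rewrite starZ starK. Qed.

Lemma hered_hom1 : hered_hom cts1 = 1.
Proof. by apply: multiplier_ext => F; apply: funAlg_ext => x /=; rewrite scale1r. Qed.

Lemma hered_act_mulr f F G : F ⋅ hered_act f G = hered_act f (F ⋅ G).
Proof. by apply: funAlg_ext => x /=; rewrite amulZr. Qed.

Lemma hered_act_mull f F G : hered_act f F ⋅ G = hered_act f (F ⋅ G).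
Proof. by apply: funAlg_ext => x /=; rewrite amulZl. Qed.

Lemma hered_hom_central f (m : multiplier hered_alg) : m * hered_hom f = hered_hom f * m.
Proof.
apply: multiplier_ext => F /=.
  by apply: amul_injl => G; rewrite -centralizer !hered_act_mulr centralizer.
by apply: amul_injr => G; rewrite centralizer !hered_act_mull centralizer.
Qed.

Definition heredCx : cxAlgType R X :=
  CxAlg hered_homD hered_homZ hered_homM hered_homJ hered_hom1 hered_hom_central.

End HereditaryFunctions.

Lemma continuous_cplx (R : realType) (X : topologicalType) (f : X -> R) :
  continuous f -> continuous (fun x => (f x)%:C : R[i]).
Proof.
move=> fc; apply/nr_continuousP => x e.
move=> /(iffLR (cvgrPdist_lt _ _) (fc x) e); apply: filterS => y.
by rewrite -rmorphB nr_real distrC.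
Qed.

Lemma le_nr_quot (R : realType) (A : normedStarAlgType R) (I : closed_ideal A)
    (q : quot_alg I) (r : R) :
  (forall a, quot_pi I a = q -> r <= nr a) -> r <= nr q.
Proof.
move=> rq; apply: lb_le_inf; last by move=> _ [a /= aq <-]; exact: rq.
by exists (nr (quot_repr q)), (quot_repr q) => //; exact: quot_reprK.
Qed.

(** * The fibres of a hereditary subalgebra are given by evaluation *)

Section Fibres.
Context {R : realType} {X : topologicalType} {U : cstarAlgType R}.
Hypothesis Xc : compact [set: X].
Variable h : X -> U.
Hypotheses (hc : continuous h) (hs : forall x, (h x)^† = h x).

Notation A := (heredCx Xc hc hs).
Implicit Types F G : A.

Lemma fibre_set_vanish x F : fibre_set x F -> fval F x = 0.
Proof.
move=> /nr_closureP Fx; apply: nr_small => e /Fx[G [s sx <-] GF].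
suff G0 : fval (\sum_(p <- s) cx_act p.1 p.2 : A) x = 0.
  rewrite (le_lt_trans _ GF)// nrB -[fval F x]subr0 -G0.
  exact: (nr_fval (F - _)).
elim: s sx {GF} => [|p s IH] sx; first by rewrite big_nil.
rewrite big_cons -[LHS]/(fval (cx_act p.1 p.2) x + fval (\sum_(q <- s) cx_act q.1 q.2 : A) x).
rewrite IH ?addr0 => [|q qs]; last by apply: sx; rewrite inE qs orbT.
by rewrite -[LHS]/(p.1 x *: fval p.2 x) sx ?scale0r// inE eqxx.
Qed.

(** Evaluation at x kills the fibre ideal, which gives one inequality. For the other put c = |F(x)|
    + e and f = 1 - c / max(c, |F|). Then f(x) = 0, so F - f F represents the same class, and its
    norm is at most c everywhere. *)
Lemma nr_fibre_pi x F : nr (fibre_pi x F) = nr (fval F x).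
Proof.
apply/eqP; rewrite eq_le; apply/andP; split; last first.
  apply: le_nr_quot => G GF; rewrite (le_trans _ (nr_fval G x))//.
  suff -> : fval F x = fval G x by [].
  apply/eqP; rewrite -subr_eq0; apply/eqP; apply: (@fibre_set_vanish x (F - G)).
  apply/(quot_pi_eq0 (fibre_ideal A x)).
  by rewrite quot_piD quot_piN GF subrr.
apply/ler_addgt0Pr => e e0; set c := nr (fval F x) + e.
have c0 : 0 < c by rewrite ltr_wpDl// nr_ge0.
pose d y := Num.max c (nr (fval F y)).
have d0 y : 0 < d y by rewrite lt_max c0.
have fc : continuous (fun y => (1 - c / d y)%:C : R[i]).
  apply: continuous_cplx => y; apply: cvgB; first exact: cvg_cst.
  apply: cvgM; first exact: cvg_cst.
  apply: cvgV; first by rewrite gt_eqF.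
  apply: (@continuous_max _ _ (fun=> c) (fun y => nr (fval F y))); first exact: cvg_cst.
  exact: (continuous_nr (@fval_continuous _ _ _ Xc h hc hs F)).
pose f : continuousType X R[i] := mkcts fc.
have fx : f x = 0.
  have dx : d x = c by apply: max_l; rewrite lerDl ltW.
  by rewrite -[f x]/((1 - c / d x)%:C) dx mulfV ?gt_eqF// subrr.
have -> : fibre_pi x F = fibre_pi x (F - cx_act f F).
  rewrite /fibre_pi quot_piD quot_piN (_ : quot_pi _ (cx_act f F) = 0) ?subr0//.
  by apply/quot_pi_eq0; apply: subset_closure; exact: fibre_span_gen.
rewrite (le_trans (nr_quot_pi _ _))//; apply: nr_funAlg_le => [|y]; first exact: ltW.
have -> : fval (F - cx_act f F) y = (c / d y)%:C *: fval F y.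
  rewrite fvalB -[fval (cx_act f F) y]/((1 - c / d y)%:C *: fval F y).
  by rewrite rmorphB rmorph1; lin.
rewrite nrZR ger0_norm; last by rewrite ltW// divr_gt0.
by rewrite mulrAC ler_pdivrMr// ler_pM2l// /d le_max lexx orbT.
Qed.

Lemma heredCx_continuous : continuous_cxAlg A.
Proof.
move=> F; rewrite (_ : (fun x => _) = fun x => (nr (fval F x))%:C).
  by apply: continuous_cplx; apply: continuous_nr; exact: fval_continuous.
by apply/funext => x; rewrite nrE nr_fibre_pi.
Qed.

Lemma fibre_pi_neq0 x F : fval F x != 0 -> fibre_pi x F != 0.
Proof.
apply: contra_neq => F0; apply: nr_eq0.
by rewrite -nr_fibre_pi F0 nr0.
Qed.

End Fibres.

(** * Approximate factorisation by polynomials, and strict positivity *)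

Section CesaroMeans.
Context {R : realType} {U : cstarAlgType R} (e : U).
Hypotheses (e1l : forall x, e ⋅ x = x) (e1r : forall x, x ⋅ e = x).

(** The sum of (e - k)^j for j < n. For k = h^2 its mean times h is small, while e minus the mean is
    a multiple of k; so h is close to h^3 times a polynomial in k. *)
Fixpoint cesaro n (k : U) : U := if n is n'.+1 then e + (e - k) ⋅ cesaro n' k else 0.

Fixpoint cesaro_quot n (k : U) : U :=
  if n is n'.+1 then cesaro_quot n' k + cesaro n' k else 0.

Lemma cesaro_quotE n k : (n%:R : R[i]) *: e - cesaro n k = k ⋅ cesaro_quot n k.
Proof.
elim: n => [|n IH] /=; first by rewrite amulr0 scale0r subr0.
rewrite amulDr -IH amulDl e1l amulNl -natr1; lin.
Qed.

Lemma cesaro_residue n k : nr (e - k) <= 1 -> nr (e - k ⋅ cesaro n k) <= 1.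
Proof.
move=> k1; elim: n => [|n IH] /=; first by rewrite amulr0 subr0 nr_unit.
have -> : e - k ⋅ (e + (e - k) ⋅ cesaro n k) = (e - k) ⋅ (e - k ⋅ cesaro n k).
  rewrite !(amulDl, amulDr, amulNl, amulNr) !e1l !e1r amulA; lin.
by rewrite (le_trans (nrM _ _))// mulr_ile1 ?nr_ge0.
Qed.

Lemma nr_cesaro n k : nr (e - k) <= 1 -> nr (cesaro n k) <= n%:R.
Proof.
move=> k1; elim: n => [|n IH] /=; first by rewrite nr0.
rewrite (le_trans (nrD _ _))// -nat1r lerD ?nr_unit// (le_trans (nrM _ _))//.
by rewrite (le_trans _ IH)// ler_piMl ?nr_ge0.
Qed.

(** With s the sum and k = h^2, (h s)^† (h s) = s^† (k s), where |s| <= n and k s = e - (e - k)^n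
    has norm at most 2. *)
Lemma nr_mul_cesaro n h : h^† = h -> nr h <= 1 -> nr (h ⋅ cesaro n (h ⋅ h)) ^+ 2 <= 2 * n%:R.
Proof.
move=> sh h1; have k1 := nr_sub_sqr e1l e1r sh h1.
rewrite -nr_cstar starM sh -amulA (amulA h h) (le_trans (nrM _ _))// nr_star mulrC.
rewrite ler_pM ?nr_ge0 ?nr_cesaro//.
rewrite -[X in nr X](subKr e) (le_trans (nrD _ _))// nrN (_ : 2 = 1 + 1)//.
by apply: lerD; [exact: nr_unit|exact: cesaro_residue].
Qed.

(** The difference is h times a mean, of norm at most sqrt(2 / (n + 1)). As n depends on [d] alone,
    one polynomial serves at all points of a space and gives a continuous factor. *)
Lemma cube_approx (d : R) : 0 < d -> exists n, forall h, h^† = h -> nr h <= 1 ->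
  nr (h - h ⋅ (h ⋅ h) ⋅ ((n.+1%:R^-1 : R[i]) *: cesaro_quot n.+1 (h ⋅ h))) <= d.
Proof.
move=> d0; have d2 : 0 < d ^+ 2 / 2 by rewrite divr_gt0// exprn_gt0.
have [n] := ltr_add_invr d2; rewrite add0r => nd; exists n => h sh h1.
have N0 : (n.+1%:R : R[i]) != 0 by rewrite pnatr_eq0.
have -> : h - h ⋅ (h ⋅ h) ⋅ ((n.+1%:R^-1 : R[i]) *: cesaro_quot n.+1 (h ⋅ h)) =
    (n.+1%:R^-1)%:C *: (h ⋅ cesaro n.+1 (h ⋅ h)).
  have := congr1 (amul h) (cesaro_quotE n.+1 (h ⋅ h)).
  move: (cesaro n.+1 _) (cesaro_quot n.+1 _) => s t.
  rewrite amulDr amulZr e1r amulNr amulZr !amulA => <-.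
  by rewrite fmorphV rmorph_nat scalerBr scalerA mulVf// scale1r subKr.
rewrite nrZR ger0_norm ?invr_ge0// -ler_sqr ?nnegrE ?mulr_ge0 ?invr_ge0 ?nr_ge0 ?(ltW d0)//.
rewrite exprMn (le_trans (ler_wpM2l (sqr_ge0 _) (nr_mul_cesaro n.+1 sh h1)))//.
have n0 : 0 < n.+1%:R :> R by [].
rewrite (_ : _ * _ = 2 * n.+1%:R^-1); last by field; rewrite gt_eqF.
by move: nd; rewrite ltr_pdivlMr// mulrC => /ltW.
Qed.

Lemma cesaro_quot_continuous (X : topologicalType) (k : X -> U) n : continuous k ->
  continuous (fun x => cesaro_quot n (k x)).
Proof.
move=> kc; have cc m : continuous (fun x => cesaro m (k x)).
  elim: m => [|m IH] /= x; first exact: cvg_cst.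
  apply: cvgD; first exact: cvg_cst.
  apply: cvg_amul; last exact: IH.
  by apply: cvgB; [exact: cvg_cst|exact: kc].
elim: n => [|n IH] /= x; first exact: cvg_cst.
by apply: cvgD; [exact: IH|exact: cc].
Qed.

End CesaroMeans.

Section StrictPositivity.
Context {R : realType} {X : topologicalType} {U : cstarAlgType R} (e : U).
Hypotheses (e1l : forall x, e ⋅ x = x) (e1r : forall x, x ⋅ e = x).
Hypothesis Xc : compact [set: X].
Variable h : X -> U.
Hypotheses (hc : continuous h) (hs : forall x, (h x)^† = h x).
Hypothesis h1 : forall x, nr (h x) <= 1.

Lemma cube_factor (d : R) : 0 < d -> exists2 c : X -> U, continuous c &
  forall x, nr (h x - h x ⋅ (h x ⋅ h x) ⋅ c x) <= d.
Proof.
move=> d0; have [n nd] := cube_approx e1l e1r d0.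
exists (fun x => (n.+1%:R^-1 : R[i]) *: cesaro_quot e n.+1 (h x ⋅ h x)) => [x|x].
  apply: cvgZr; apply: (@cesaro_quot_continuous _ _ e X (fun x => h x ⋅ h x)).
  exact: continuous_amul.
exact: nd (hs x) (h1 x).
Qed.

(** h^4, written so as to be, by computation, the square of the element h e h of the hereditary
    algebra. *)
Definition quart x := h x ⋅ e ⋅ h x ⋅ (h x ⋅ e ⋅ h x).

Lemma quartE x : quart x = h x ⋅ h x ⋅ (h x ⋅ h x).
Proof. by rewrite /quart !e1r. Qed.

(** h is close to h^3 b; replacing the last h there by h^3 c gives h^5 c b. One h is kept apart from
    h^4 so that, for strict positivity, the element between the two copies of h^4 again has the form
    h S h. *)
Lemma quint_factor (d : R) : 0 < d -> exists2 c : X -> U, continuous c &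
  forall x, nr (h x - quart x ⋅ (h x ⋅ c x)) <= d.
Proof.
move=> d0; have d2 : 0 < d / 2 by rewrite divr_gt0.
have [b bc bE] := cube_factor d2; have [C bC] := continuous_bounded Xc bc.
have C1 : 0 < `|C| + 1 by rewrite ltr_wpDl.
have [c cc cE] := cube_factor (divr_gt0 d2 C1).
exists (fun x => c x ⋅ b x) => [|x /=]; first exact: continuous_amul.
rewrite (le_trans (nr_triangle (h x ⋅ (h x ⋅ h x) ⋅ b x) _ _))// (splitr d) lerD ?bE//.
have -> : h x ⋅ (h x ⋅ h x) ⋅ b x - quart x ⋅ (h x ⋅ (c x ⋅ b x)) =
    h x ⋅ (h x ⋅ ((h x - h x ⋅ (h x ⋅ h x) ⋅ c x) ⋅ b x)).
  by rewrite quartE amulDl amulNl !amulDr !amulNr !amulA.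
do 2 (rewrite (le_trans (nrM _ _))// (le_trans (ler_piMl (nr_ge0 _) (h1 x)))//).
rewrite (le_trans (nrM _ _))// (@le_trans _ _ (d / 2 / (`|C| + 1) * (`|C| + 1)))//.
  rewrite ler_pM ?nr_ge0 ?cE// (le_trans (bC x))// (le_trans (ler_norm _))// lerDl.
  exact: ler01.
by rewrite divfK// gt_eqF.
Qed.

Lemma e_continuous : continuous (fun _ : X => e).
Proof. by move=> x; exact: cvg_cst. Qed.

Definition hered_sqr : heredCx Xc hc hs := hered_el Xc hc hs e_continuous.

Definition hered_quart : heredCx Xc hc hs := hered_sqr ⋅ hered_sqr.

Lemma hered_quartE x : fval hered_quart x = quart x. Proof. by []. Qed.

Lemma hered_sqr_star : hered_sqr^† = hered_sqr.
Proof. by apply: funAlg_ext => x; rewrite /= !e1r starM hs. Qed.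

Lemma hered_quart_star : hered_quart^† = hered_quart.
Proof. by rewrite starM hered_sqr_star. Qed.

Lemma nr_hered_quart : nr hered_quart <= 1.
Proof.
apply: nr_funAlg_le => // x; rewrite hered_quartE quartE.
have hh : nr (h x ⋅ h x) <= 1 by rewrite (le_trans (nrM _ _))// mulr_ile1 ?nr_ge0 ?h1.
by rewrite (le_trans (nrM _ _))// mulr_ile1 ?nr_ge0.
Qed.

Lemma hered_quart_strictly_positive : strictly_positive hered_quart.
Proof.
split; first by exists hered_sqr; rewrite hered_sqr_star.
apply: nr_dense => F d d0; have d4 : 0 < d / 4 by rewrite divr_gt0.
have [T Tc FT] := hered_approx F d4; have [C TC] := continuous_bounded Xc Tc.
have C1 : 0 < `|C| + 1 by rewrite ltr_wpDl.
(* The minimum with 1 bounds w by 2 below; the two error terms are then at most d/8 and d/4. *)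
pose d' := Num.min 1 (d / 8 / (`|C| + 1)).
have d8 : 0 < d / 8 by rewrite divr_gt0.
have d'0 : 0 < d' by rewrite lt_min ltr01 divr_gt0.
have [c cc cE] := quint_factor d'0.
have Sc : continuous (fun x => c x ⋅ T x ⋅ (c x)^†).
  by apply: continuous_amul; [exact: continuous_amul|exact: continuous_star].
pose B : heredCx Xc hc hs := hered_el Xc hc hs Sc.
exists (hered_quart ⋅ B ⋅ hered_quart); first by exists B.
rewrite nrB (@le_lt_trans _ _ (d / 4 + d / 2))//; last lra.
apply: nr_funAlg_le => [|x]; first by rewrite addr_ge0// ltW// divr_gt0.
rewrite fvalB (le_trans (nr_triangle (h x ⋅ T x ⋅ h x) _ _))// lerD ?FT//.
set w := quart x ⋅ (h x ⋅ c x); have wE : nr (h x - w) <= d' := cE x.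
have sq : (quart x)^† = quart x by rewrite quartE !starM !hs.
have -> : fval (hered_quart ⋅ B ⋅ hered_quart) x = w ⋅ T x ⋅ w^†.
  rewrite /w -[LHS]/(quart x ⋅ (h x ⋅ (c x ⋅ T x ⋅ (c x)^†) ⋅ h x) ⋅ quart x).
  by move: (quart x) sq => q sq; rewrite !starM hs sq !amulA.
clearbody w.
have -> : h x ⋅ T x ⋅ h x - w ⋅ T x ⋅ w^† =
    (h x - w) ⋅ T x ⋅ h x + w ⋅ T x ⋅ (h x - w)^†.
  by rewrite starD starN hs !amulDl !amulNl !amulDr !amulNr; lin.
have w2 : nr w <= 2.
  rewrite (le_trans (nrDB _ (h x)))// (_ : 2 = 1 + 1)// lerD// nrB (le_trans wE)//.
  by rewrite ge_min lexx.
have T1 : nr (T x) <= `|C| + 1.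
  by rewrite (le_trans (TC x))// (le_trans (ler_norm _))// lerDl ler01.
have dT : d' * (`|C| + 1) <= d / 8 by rewrite -ler_pdivlMr// ge_min lexx orbT.
have t1 : nr ((h x - w) ⋅ T x ⋅ h x) <= d / 8.
  rewrite (le_trans (nrM _ _))// (le_trans (ler_piMr _ (h1 x))) ?nr_ge0//.
  by rewrite (le_trans (nrM _ _))// (le_trans _ dT)// ler_pM ?nr_ge0.
have t2 : nr (w ⋅ T x ⋅ (h x - w)^†) <= 2 * (d / 8).
  rewrite -amulA (le_trans (nrM _ _))// ler_pM ?nr_ge0// (le_trans (nrM _ _))// nr_star.
  by rewrite (le_trans _ dT)// mulrC ler_pM ?nr_ge0.
by rewrite (le_trans (nrD _ _))// (le_trans (lerD t1 t2))//; lra.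
Qed.

End StrictPositivity.

Lemma countable_enum (T : Type) (D : set T) (t0 : T) : countable D ->
  exists f : nat -> T, forall t, D t -> exists n, f n = t.
Proof.
move=> /countable_injP[g g_inj].
have ex n : exists t, (exists2 t, D t & g t = n) -> D t /\ g t = n.
  have [[t Dt gt]|no] := pselect (exists2 t, D t & g t = n); first by exists t.
  by exists t0 => /no.
have [f fE] := choice ex; exists f => t Dt; exists (g t).
have [|Df gf] := fE (g t); first by exists t.
by apply: g_inj; rewrite ?inE.
Qed.

(** * Separability over a second countable compact space *)

Section Separability.
Context {R : realType} {X : ptopologicalType} {U : cstarAlgType R}.
Hypothesis Xc : compact [set: X].
Variable M : funSubalg X U.
Hypothesis Mc : forall F, M F -> continuous F.

(* To each finite list of pairs (basic open set, approximate value), and each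
   tolerance, attach one element of the algebra matching these data. *)
Lemma funAlg_separable (D : set U) : @second_countable X -> countable D ->
  (forall F : funAlg M, forall x (e : R), 0 < e -> exists2 u, D u & nr (fval F x - u) < e) ->
  separable (funAlg M).
Proof.
move=> [B Bcnt [Bo Bb]] Dcnt DA.
have [b bE] := countable_enum set0 Bcnt; have [d dE] := countable_enum 0 Dcnt.
pose tol n : R := n.+1%:R^-1.
pose P (i : seq (nat * nat) * nat) (F : funAlg M) :=
  (forall x, exists2 p, p \in i.1 & b p.1 x) /\
  (forall x p, p \in i.1 -> b p.1 x -> nr (fval F x - d p.2) < tol i.2).
have ex i : exists F, (exists F, P i F) -> P i F.
  have [[F PF]|no] := pselect (exists F, P i F); first by exists F.
  by exists 0 => /no.
have [G GE] := choice ex; exists (range G).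
  by apply: sub_countable (card_image_le _ _) _; exact: countableP.
apply: nr_dense => F e e0; have e4 : 0 < e / 4 by rewrite divr_gt0.
have [n] := ltr_add_invr e4; rewrite add0r -/(tol n) => ne.
have n0 : 0 < tol n by rewrite invr_gt0.
have n2 : 0 < tol n / 2 by rewrite divr_gt0.
have [L PL] : exists L, P (L, n) F.
  pose good : set (nat * nat) := [set p | open (b p.1) /\
    forall y, b p.1 y -> nr (fval F y - d p.2) < tol n].
  have /nr_continuousP Fc := Mc (fvalP F).
  have := Xc; rewrite compact_cover => /(_ _ good (b \o fst)) [|x _|L Lgood Lcov].
  - by move=> p [].
  - have [u /dE[m <-] um] := DA F x _ n2.
    have [V /= [/[dup] /Bo oV /bE[k kE] Vx] VF] := Bb x _ (Fc x _ n2).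
    rewrite -kE in oV Vx VF; exists (k, m) => //; split=> //= y Vy.
    by rewrite (le_lt_trans (nr_triangle (fval F x) _ _))// (splitr (tol n)) ltrD//; exact: VF.
  - exists (finmap.enum_fset L); split=> [x|x p pL].
      by have [p pL px] := Lcov x I; exists p.
    by have [|_] := set_mem (Lgood p _); [exact: pL|exact].
have [Gcov GL] := GE (L, n) (ex_intro _ F PL); have [_ FL] := PL.
exists (G (L, n)); first by exists (L, n).
rewrite (@le_lt_trans _ _ (e / 2))//; last by rewrite ltr_pdivrMr// ltr_pMr// ltr1n.
apply: nr_funAlg_le => [|x]; first by rewrite ltW// divr_gt0.
rewrite fvalB; have [p pL px] := Gcov x.
rewrite (le_trans (nr_triangle (d p.2) _ _))// (_ : e / 2 = e / 4 + e / 4); last by lra.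
rewrite lerD//; first by rewrite ltW// (lt_trans (GL x p pL px)).
by rewrite nrB ltW// (lt_trans (FL x p pL px)).
Qed.

End Separability.

(** * The Dixmier-Douady bundle *)

Section Sums.
Context {R : realType} {U : normedStarAlgType R} {I : Type}.
Implicit Types (r : seq I) (P : pred I) (F : I -> U) (a : U).

Lemma amul_sumr a r P F : a ⋅ \sum_(i <- r | P i) F i = \sum_(i <- r | P i) a ⋅ F i.
Proof. by apply: big_morph; [exact: amulDr|exact: amulr0]. Qed.

Lemma amul_suml a r P F : (\sum_(i <- r | P i) F i) ⋅ a = \sum_(i <- r | P i) F i ⋅ a.
Proof. by apply: (big_morph (amul^~ a)) => [x y|]; [exact: amulDl|exact: amul0r]. Qed.

Lemma star_sum r P F : (\sum_(i <- r | P i) F i)^† = \sum_(i <- r | P i) (F i)^†.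
Proof. by apply: big_morph; [exact: starD|exact: star0]. Qed.

End Sums.

Section CompactDiagonal.
Context {R : realType}.
Notation e_ := (@l2_basis R).
Notation op := (adj (@l2_form R)).
Notation one := (adj_one (@l2_form R)).

Lemma ap_sum (I : Type) (r : seq I) (P : pred I) (F : I -> op) (x : l2 R) :
  (\sum_(i <- r | P i) F i) x = \sum_(i <- r | P i) F i x.
Proof. exact: (big_morph (fun T : op => T x)). Qed.

Lemma self_adjoint_ker (T : op) x : T^† = T -> T (T x) = 0 -> T x = 0.
Proof.
move=> sT Tx; apply: nr_eq0; apply/eqP; rewrite -sqrf_eq0 -nr_ip_l2xx bop_adj sT Tx.
by rewrite ip_l20r nr0.
Qed.

Lemma continuous_theta (X : topologicalType) (f g : X -> l2 R) :
  continuous f -> continuous g -> continuous (fun x => theta (f x) (g x)).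
Proof.
move=> fc gc s; apply: cvg_biadditive (fc s) (gc s) => [x y z|x y z|]; last exact: nr_theta.
  by apply: adj_ext => t /=; rewrite scalerDr.
by apply: adj_ext => t /=; rewrite ip_l2Dl scalerDl.
Qed.

Lemma truncT N : trunc N = \sum_(j < N) theta (e_ j) (e_ j) :> op.
Proof.
apply: adj_ext => x; rewrite ap_sum trunc_sum; apply: eq_bigr => j _ /=.
by rewrite ip_basisl.
Qed.

Lemma trunc_mul N (T : op) : trunc N ⋅ T ⋅ trunc N =
  \sum_(i < N) \sum_(j < N) ip_l2 (T^† (e_ i)) (e_ j) *: theta (e_ i) (e_ j).
Proof.
rewrite truncT !amul_suml; apply: eq_bigr => i _; rewrite amul_sumr.
by apply: eq_bigr => j _; rewrite theta_mul theta_theta.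
Qed.

Lemma nr_trunc N (x : l2 R) : nr (trunc N x) <= nr x.
Proof.
rewrite -[leRHS]mul1r; apply: diag_bound_le => // k; right; exact: trunc_bound.
Qed.

Definition hdiag : op := diag harm_bound.

Lemma hdiagE x k : hdiag x k = (harm k)%:C * x k. Proof. by []. Qed.

Lemma hdiag_star : hdiag^† = hdiag.
Proof. by apply: adj_ext => x; exact: l2_ext. Qed.

Lemma hdiag_ip (x y : l2 R) : ip_l2 (hdiag x) y = ip_l2 x (hdiag y).
Proof. by rewrite bop_adj hdiag_star. Qed.

Lemma hdiag_eq0 x : hdiag x = 0 -> x = 0.
Proof.
move=> Gx; apply: l2_ext => k; have := congr1 (fun y : l2 R => y k) Gx.
rewrite hdiagE => /eqP; rewrite mulf_eq0 => /orP[|/eqP //].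
by move=> /eqP/complexI/eqP; rewrite gt_eqF// harm_gt0.
Qed.

Lemma nr_hdiag : nr hdiag <= 1.
Proof.
apply: nr_adj_le => // x; apply: diag_bound_le => // k; right; exact: harm_bound.
Qed.

Lemma hdiag_tail_vec N x : nr (hdiag x - trunc N (hdiag x)) <= harm N * nr x.
Proof.
pose g k : R := if (k < N)%N then 0 else harm k.
have g1 k : `|g k| <= 1 by rewrite /g; case: ifP => _; rewrite ?normr0// harm_bound.
have -> : hdiag x - trunc N (hdiag x) = diag g1 x.
  apply: l2_ext => k; rewrite l2DE l2NE truncE -[diag g1 x k]/((g k)%:C * x k) hdiagE /g.
  by case: ifP => _; rewrite ?subr0// subrr mul0r.
apply: diag_bound_le => [|k]; [exact/ltW/harm_gt0|right].
rewrite /g; case: ltnP => kN; first by rewrite normr0 ltW// harm_gt0.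
by rewrite ger0_norm ?(ltW (harm_gt0 k))// harm_anti.
Qed.

Lemma hdiag_tail N : nr (hdiag - trunc N ⋅ hdiag) <= harm N.
Proof. by apply: nr_adj_le => [|x]; [exact/ltW/harm_gt0|exact: hdiag_tail_vec]. Qed.

End CompactDiagonal.

Section HilbertBundle.
Context {R : realType}.
Notation e_ := (@l2_basis R).
Notation op := (adj (@l2_form R)).
Notation one := (adj_one (@l2_form R)).
Implicit Types (z : hball R) (x : l2 R).

Lemma sum_even_odd (V : zmodType) (f : nat -> V) n :
  \sum_(i < n.*2) f i = \sum_(k < n) (f k.*2 + f k.*2.+1).
Proof.
elim: n => [|n IH]; first by rewrite !big_ord0.
by rewrite doubleS !big_ord_recr /= IH addrA.
Qed.

Lemma zeta_sqsum z n :
  sqsum (fun k => bcoord k.*2 z +i* bcoord k.*2.+1 z) n = \sum_(i < n.*2) bcoord i z ^+ 2.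
Proof.
by rewrite (sum_even_odd (fun i => bcoord i z ^+ 2)); apply: eq_bigr => k _; rewrite nr_sqrE.
Qed.

Lemma zeta_bounded z : exists C, forall n,
  sqsum (fun k => bcoord k.*2 z +i* bcoord k.*2.+1 z) n <= C.
Proof. by exists 1 => n; rewrite zeta_sqsum bcoord_bound. Qed.

Definition zeta z : l2 R := L2 (zeta_bounded z).

Lemma nr_zeta z : nr (zeta z) <= 1.
Proof.
apply: l2_nr_le => n; rewrite -[leRHS]sqrtr1 ler_wsqrtr//.
by rewrite (le_trans (y := 1))// zeta_sqsum bcoord_bound.
Qed.

Lemma zeta_coord_continuous k : continuous (fun z => zeta z k).
Proof.
apply/nr_continuousP => z e e0; have e2 : 0 < e / 2 by rewrite divr_gt0.
have near_coord j : \forall y \near z, `|bcoord j y - bcoord j z| < e / 2.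
  have /cvgrPdist_lt/(_ _ e2) := @bcoord_continuous R j z.
  by apply: filterS => y; rewrite distrC.
apply: filterS2 (near_coord k.*2) (near_coord k.*2.+1) => y y1 y2.
rewrite (le_lt_trans (nr_le_ReIm _))// (splitr e) /=.
by rewrite ltrD.
Qed.

Definition gzeta z : l2 R := hdiag (zeta z).

(** Compactness of G: up to [harm N] the vector [gzeta z] depends only on N coordinates of [zeta z],
    and these are continuous, though [zeta] is not norm continuous. *)
Lemma gzeta_continuous : continuous gzeta.
Proof.
apply: continuous_uniform_limit => e /harm_small[N Ne].
exists (fun z => trunc N (gzeta z)) => [|z]; last first.
  rewrite (le_trans (hdiag_tail_vec _ _))// (le_trans _ (ltW Ne))//.
  by rewrite ler_piMr ?nr_zeta// ltW// harm_gt0.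
under eq_fun do rewrite trunc_sum.
apply: continuous_sum => j _.
apply: (continuous_scalev (f := fun z => gzeta z j) (F := fun=> e_ j)).
  apply: (continuous_scalev (V := R[i]) (f := fun=> (harm j)%:C) (F := fun z => zeta z j)).
    exact: continuous_cst.
  exact: zeta_coord_continuous.
exact: continuous_cst.
Qed.

Definition zproj z : op := one - theta (zeta z) (zeta z).

Lemma zprojE z x : zproj z x = x - ip_l2 (zeta z) x *: zeta z. Proof. by []. Qed.

Lemma nr_zproj z : nr (zproj z) <= 1.
Proof.
have [z0|z0] := eqVneq (nr (zeta z)) 0.
  rewrite /zproj (nr_eq0 z0) theta0l subr0.
  by apply: nr_unit; [exact: one_amul|exact: amul_one].
(* [zeta z] need not be a unit vector, so [zproj z] need not be a projection; but it is e - T^2 with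
   T a self-adjoint contraction, to which [nr_sub_sqr] applies. *)
pose t := (nr (zeta z))^-1; pose T : op := t%:C *: theta (zeta z) (zeta z).
have t0 : 0 <= t by rewrite invr_ge0 nr_ge0.
rewrite /zproj (_ : theta (zeta z) (zeta z) = T ⋅ T); last first.
  rewrite amulZl amulZr theta_theta ip_l2xx !scalerA -!rmorphM /=.
  by rewrite -expr2 -exprMn mulVf// expr1n rmorph1 scale1r.
apply: nr_sub_sqr; [exact: one_amul|exact: amul_one| |].
  by rewrite /T starZ theta_star conj_real.
rewrite nrZR ger0_norm// (le_trans (ler_wpM2l t0 (nr_theta _ _)))//.
by rewrite mulrA mulVf// mul1r nr_zeta.
Qed.

Lemma zproj_eq0 z x : zproj z x = 0 -> x = ip_l2 (zeta z) x *: zeta z.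
Proof. by rewrite zprojE => /eqP; rewrite subr_eq0 => /eqP. Qed.

(** The operator G (1 - |zeta><zeta|) G in a form where only the norm continuous [gzeta] enters. *)
Definition bundle_op z : op := hdiag ⋅ hdiag - theta (gzeta z) (gzeta z).

Lemma bundle_opE z : bundle_op z = hdiag ⋅ zproj z ⋅ hdiag.
Proof.
rewrite /zproj amulDr amulDl amul_one amulNr amulNl; congr (_ - _).
by rewrite mul_theta theta_mul hdiag_star.
Qed.

Lemma bundle_op_ap z x : bundle_op z x = hdiag (zproj z (hdiag x)).
Proof. by rewrite bundle_opE. Qed.

Lemma bundle_op_continuous : continuous bundle_op.
Proof.
apply: (continuous_addv (F := fun=> hdiag ⋅ hdiag)); first exact: continuous_cst.
apply: (continuous_oppv (F := fun z => theta (gzeta z) (gzeta z))).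
by apply: continuous_theta; exact: gzeta_continuous.
Qed.

Lemma bundle_op_star z : (bundle_op z)^† = bundle_op z.
Proof. by rewrite starD starN starM hdiag_star theta_star. Qed.

Lemma nr_bundle_op z : nr (bundle_op z) <= 1.
Proof.
rewrite bundle_opE (le_trans (nrM _ _))// mulr_ile1 ?nr_ge0 ?nr_hdiag//.
by rewrite (le_trans (nrM _ _))// mulr_ile1 ?nr_ge0 ?nr_hdiag ?nr_zproj.
Qed.

Lemma bundle_op_ip z x y : ip_l2 (bundle_op z x) y = ip_l2 x (bundle_op z y).
Proof. by rewrite bop_adj bundle_op_star. Qed.

Lemma bundle_op_ker z x : bundle_op z x = 0 -> hdiag x = ip_l2 (gzeta z) x *: zeta z.
Proof.
by rewrite bundle_op_ap => /hdiag_eq0 /zproj_eq0 {1}->; rewrite /gzeta hdiag_ip.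
Qed.

Lemma bundle_op_eq0 z x : ip_l2 (gzeta z) x = 0 -> bundle_op z x = 0 -> x = 0.
Proof. by move=> zx /bundle_op_ker; rewrite zx scale0r => /hdiag_eq0. Qed.

Lemma bundle_op_inj2 z x : bundle_op z (bundle_op z x) = 0 -> bundle_op z x = 0.
Proof. by apply: self_adjoint_ker; exact: bundle_op_star. Qed.

(** Otherwise G e_0 and G e_1 would both be multiples of the one vector [zeta z]. *)
Lemma bundle_op_basis z : bundle_op z (e_ 0) = 0 -> bundle_op z (e_ 1) <> 0.
Proof.
move=> /bundle_op_ker E0 /bundle_op_ker E1.
have := congr1 (fun y : l2 R => y 1%N) E0; have := congr1 (fun y : l2 R => y 0%N) E1.
have := congr1 (fun y : l2 R => y 1%N) E1.
rewrite !l2ZE !hdiagE /= mulr1 !mulr0 => E11 E10 /esym/eqP; rewrite mulf_eq0 => /orP[|] /eqP c0.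
  have := congr1 (fun y : l2 R => y 0%N) E0.
  rewrite l2ZE hdiagE /= c0 mul0r mulr1 => /complexI/eqP.
  by rewrite gt_eqF// harm_gt0.
by move: E11; rewrite c0 mulr0 => /complexI/eqP; rewrite gt_eqF// harm_gt0.
Qed.


End HilbertBundle.

Section BundleAlgebra.
Context {R : realType}.
Notation e_ := (@l2_basis R).
Notation op := (adj (@l2_form R)).
Notation one := (adj_one (@l2_form R)).
Implicit Types (z : hball R) (x : l2 R).

Definition bundleCx : cxAlgType R (hball R) :=
  heredCx (@hball_compact R) bundle_op_continuous bundle_op_star.

Definition units (k : nat) : unit -> op := fun=>
  if choice.unpickle k is Some (i, j) then theta (e_ i) (e_ j) else 0.

Lemma units_bounded k : fbounded (units k).
Proof. by exists (nr (units k tt)) => -[]. Qed.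

Lemma gen_unit i j : gen_alg units (fun=> theta (e_ i) (e_ j)).
Proof.
by have := gen_alg_gen units (choice.pickle (i, j)); rewrite /units choice.pickleK.
Qed.

Lemma gen_sum n (F : 'I_n -> op) : (forall i, gen_alg units (fun=> F i)) ->
  gen_alg units (fun=> \sum_i F i).
Proof.
move=> gF; elim/big_ind: _ => // [|S T gS gT]; first exact: gen_alg0.
exact: (gen_alg_add gS gT).
Qed.

Lemma gen_trunc N (T : op) : gen_alg units (fun=> trunc N ⋅ T ⋅ trunc N).
Proof.
rewrite trunc_mul; apply: gen_sum => i; apply: gen_sum => j.
exact/gen_alg_scale/gen_unit.
Qed.

Definition rat_units : set op := [set F tt | F in rat_alg units].

Lemma rat_units_dense N (T : op) (e : R) : 0 < e ->
  exists2 S, rat_units S & nr (trunc N ⋅ T ⋅ trunc N - S) <= e.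
Proof.
move=> e0; have [F FS /(_ tt) TF] := rat_alg_dense units_bounded (gen_trunc N T) e0.
by exists (F tt) => //; exists F.
Qed.

Lemma nr_op_trunc N : nr (trunc N : op) <= 1.
Proof. by apply: nr_adj_le => // x; rewrite mul1r nr_trunc. Qed.

Lemma bundle_op_tail N z : nr (bundle_op z - trunc N ⋅ bundle_op z) <= harm N.
Proof.
rewrite bundle_opE (_ : _ - _ = (hdiag - trunc N ⋅ hdiag) ⋅ zproj z ⋅ hdiag); last first.
  by rewrite !amulDl !amulNl !amulA.
rewrite (le_trans (nrM _ _))// (le_trans (ler_piMr (nr_ge0 _) nr_hdiag))//.
rewrite (le_trans (nrM _ _))// (le_trans (ler_piMr (nr_ge0 _) (nr_zproj z)))//.
exact: hdiag_tail.
Qed.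

Lemma bundle_op_tailr N z : nr (bundle_op z - bundle_op z ⋅ trunc N) <= harm N.
Proof.
by rewrite -nr_star starD starN starM trunc_star bundle_op_star bundle_op_tail.
Qed.

(** The values are compact operators: h is within [harm N] of its truncations from either side, so h
    T h is near a finite matrix, and finite matrices are approximated by the countable set
    [rat_units]. *)
Lemma bundle_separable : separable bundleCx.
Proof.
apply: (@funAlg_separable _ _ _ (@hball_compact R) _ _ rat_units).
- by move=> F MF; exact: (@fval_continuous _ _ _ _ _ bundle_op_continuous bundle_op_star (FunAlg MF)).
- exact: hball_second_countable.
- by apply: sub_countable (card_image_le _ _) _; exact: rat_alg_countable.
move=> F z e e0; have e4 : 0 < e / 4 by rewrite divr_gt0.
have eE : e = e / 4 + e / 4 + e / 4 + e / 4 by lra.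
have [T _ /(_ z) FT] := hered_approx F e4.
have [N Ne] := harm_mul_small (nr (T z)) e4.
have [S SD TS] := rat_units_dense N (bundle_op z ⋅ T z ⋅ bundle_op z) e4.
have b1 := nr_bundle_op z; have P1 := nr_op_trunc N.
have bP := bundle_op_tail N z; have bPr := bundle_op_tailr N z.
exists S => //; set b := bundle_op z in FT TS b1 bP bPr; set P : op := trunc N in TS P1 bP bPr.
clearbody b P.
have -> : F z - S = (F z - b ⋅ T z ⋅ b) + (b - P ⋅ b) ⋅ T z ⋅ b +
    P ⋅ b ⋅ T z ⋅ (b - b ⋅ P) + (P ⋅ (b ⋅ T z ⋅ b) ⋅ P - S).
  by rewrite !amulDl !amulDr !amulNl !amulNr !amulA; lin.
have t1 : nr ((b - P ⋅ b) ⋅ T z ⋅ b) < e / 4.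
  rewrite (le_lt_trans _ Ne)// (le_trans (nrM _ _))// (le_trans (ler_piMr (nr_ge0 _) b1))//.
  by rewrite (le_trans (nrM _ _))// mulrC ler_wpM2l ?nr_ge0.
have t2 : nr (P ⋅ b ⋅ T z ⋅ (b - b ⋅ P)) < e / 4.
  rewrite (le_lt_trans _ Ne)// (le_trans (nrM _ _))// ler_pM ?nr_ge0//.
  rewrite (le_trans (nrM _ _))// ler_piMl ?nr_ge0//.
  by rewrite (le_trans (nrM _ _))// mulr_ile1 ?nr_ge0.
rewrite eE (le_lt_trans (nrD _ _))// ltr_leD// (le_lt_trans (nrD _ _))// ltrD//.
by rewrite (le_lt_trans (nrD _ _))// ler_ltD.
Qed.

Definition bundle_el : bundleCx := hered_quart one (@hball_compact R) bundle_op_continuous bundle_op_star.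

Lemma bundle_elE z : fval bundle_el z = bundle_op z ⋅ bundle_op z ⋅ (bundle_op z ⋅ bundle_op z).
Proof. by rewrite -[LHS]/(quart one (@bundle_op R) z) quartE//; exact: amul_one. Qed.

Lemma bundle_el_star : bundle_el^† = bundle_el.
Proof. by apply: hered_quart_star; exact: amul_one. Qed.

Lemma bundle_op_neq0 z : exists x, bundle_op z (bundle_op z (bundle_op z (bundle_op z x))) <> 0.
Proof.
have [h0|h0] := pselect (bundle_op z (e_ 0) = 0).
  by exists (e_ 1) => /bundle_op_inj2/bundle_op_inj2/bundle_op_inj2; exact: bundle_op_basis.
by exists (e_ 0) => /bundle_op_inj2/bundle_op_inj2/bundle_op_inj2.
Qed.

Lemma bundle_el_neq0 z : fval bundle_el z != 0.
Proof.
apply/negP => /eqP; rewrite bundle_elE => h0; have [x] := bundle_op_neq0 z; apply.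
by have := congr1 (fun T : op => T x) h0.
Qed.

Lemma bundle_standing_hyp : standing_hyp bundle_el.
Proof.
have one_l : forall x : op, one ⋅ x = x := one_amul.
have one_r : forall x : op, x ⋅ one = x := amul_one.
split.
- split; [by exists point|exact: hball_second_countable|exact: hball_compact|exact: hball_hausdorff].
- exact: bundle_separable.
- exact: heredCx_continuous.
- move=> z; exists (fibre_pi z bundle_el); apply: fibre_pi_neq0; exact: bundle_el_neq0.
- split; first by apply: hered_quart_strictly_positive => //; exact: nr_bundle_op.
  rewrite -[X in _ <= X](rmorph1 (real_complex R)) -nr_le.
  by apply: nr_hered_quart => //; exact: nr_bundle_op.
Qed.

End BundleAlgebra.

(** * Proper infiniteness of every fibre *)

Lemma ip_l2_sumr (R : realType) (I : Type) (r : seq I) (u : l2 R) (f : I -> l2 R) :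
  ip_l2 u (\sum_(i <- r) f i) = \sum_(i <- r) ip_l2 u (f i).
Proof. by apply: big_morph; [exact: ip_l2Dr|exact: ip_l20r]. Qed.

(** Among m + 1 basis vectors, m linear conditions leave a nonzero combination. *)
Lemma exists_orthogonal (R : realType) m (b : 'I_m -> l2 R) :
  exists2 y : l2 R, y <> 0 & forall i, ip_l2 (b i) y = 0.
Proof.
pose B : 'M[R[i]]_(m.+1, m) := \matrix_(k, i) Num.conj (b i k).
have kB : kermx B != 0.
  rewrite -mxrank_eq0 mxrank_ker subn_eq0 -ltnNge ltnS.
  exact: rank_leq_col.
have [v vB v0] : exists2 v : 'rV[R[i]]_m.+1, v *m B = 0 & v != 0.
  exists (nz_row (kermx B)); last by rewrite nz_row_eq0.
  by apply/sub_kermxP; exact: nz_row_sub.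
exists (\sum_(k < m.+1) v ord0 k *: @l2_basis R k).
  move=> y0; case/negP: v0; apply/eqP/rowP => k; rewrite mxE.
  have := congr1 (ip_l2 (@l2_basis R k)) y0.
  rewrite ip_l2_sumr ip_l20r (bigD1 k)//= big1 ?addr0.
    by rewrite ip_l2Zr ip_basis eqxx /GRing.scale/= mulr1.
  move=> j jk; rewrite ip_l2Zr ip_basis (_ : (_ == _) = false) ?scaler0//.
  by rewrite eq_sym; exact: negbTE.
move=> i; have := congr1 (fun w : 'rV_m => w ord0 i) vB; rewrite !mxE => <-.
by rewrite ip_l2_sumr; apply: eq_bigr => k _; rewrite ip_l2Zr ip_basisr mxE.
Qed.

Lemma exists_orthonormal (R : realType) (h : adj (@l2_form R)) (c : l2 R) N : h^† = h ->
  (forall x, ip_l2 c x = 0 -> h x = 0 -> x = 0) -> exists y : nat -> l2 R, forall i j, (i < N)%N -> (j < N)%N ->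
  ip_l2 (h (h (h (y i)))) (h (h (h (y j)))) = (i == j)%:R.
Proof.
move=> sh hc; have hip u v : ip_l2 (h u) v = ip_l2 u (h v) by rewrite bop_adj sh.
elim: N => [|N [y yN]]; first by exists (fun=> 0).
(* The inner product of h^3 y_i with h^3 v is that of h^6 y_i with v. Orthogonality to [c] excludes
   h v = 0 for nonzero v, hence also h^3 v = 0. *)
pose b (i : 'I_N.+1) : l2 R := if (i < N)%N then h (h (h (h (h (h (y i)))))) else c.
have [v v0 bv] := exists_orthogonal b.
have yv i : (i < N)%N -> ip_l2 (h (h (h (y i)))) (h (h (h v))) = 0.
  move=> iN; have := bv (Ordinal (ltnW iN : (i < N.+1)%N)).
  by rewrite /b [nat_of_ord _]/= iN 3!hip.
have hv : h (h (h v)) <> 0.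
  move=> /(self_adjoint_ker sh)/(self_adjoint_ker sh) hv0; apply: v0; apply: hc hv0.
  by have := bv ord_max; rewrite /b [nat_of_ord _]/= ltnn.
pose t := (nr (h (h (h v))))^-1.
have t1 : t ^+ 2 * nr (h (h (h v))) ^+ 2 = 1.
  by rewrite -exprMn mulVf ?expr1n//; apply/eqP => /nr_eq0.
pose y' i := if (i < N)%N then y i else t%:C *: v.
have y'N : y' N = t%:C *: v by rewrite /y' ltnn.
have y'lt i : (i < N)%N -> y' i = y i by rewrite /y' => ->.
exists y'; clearbody y' => i j.
rewrite !ltnS (leq_eqVlt i) (leq_eqVlt j).
have [-> _|iN iN'] := eqVneq i N; have [-> _|jN jN'] := eqVneq j N.
- rewrite y'N !apZ ip_l2Zl ip_l2Zr conj_real ip_l2xx.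
  move: (nr (h (h (h v)))) t1 => r t1.
  by rewrite -[LHS]/(t%:C * (t%:C * (r ^+ 2)%:C)) -!rmorphM mulrA -expr2 t1.
- by rewrite y'N (y'lt _ jN') !apZ ip_l2Zl -ip_l2_conj yv// rmorph0 scaler0.
- by rewrite y'N (y'lt _ iN') !apZ ip_l2Zr (yv _ iN') scaler0 (negbTE iN).
- rewrite (y'lt _ iN') (y'lt _ jN'); exact: yN.
Qed.

Section FibrewiseProperInfiniteness.
Context {R : realType}.
Notation e_ := (@l2_basis R).
Notation op := (adj (@l2_form R)).
Variable z : hball R.
Notation h := (bundle_op z).

Definition frame N (w : nat -> l2 R) : op := \sum_(j < N) theta (e_ j) (w j).

Lemma frame_mul N (v w : nat -> l2 R) (c : R[i]) :
  (forall i j, (i < N)%N -> (j < N)%N ->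
    ip_l2 (h (h (h (v i)))) (h (h (h (w j)))) = if i == j then c else 0) ->
  frame N v ⋅ h ⋅ (h ⋅ h ⋅ (h ⋅ h)) ⋅ (frame N w ⋅ h)^† = c *: trunc N.
Proof.
have sh : h^† = h := bundle_op_star z.
have hip x y : ip_l2 (h x) y = ip_l2 x (h y) := bundle_op_ip z x y.
move: (bundle_op z) sh hip => k sk kip vw.
have apM (S T : op) x : (S ⋅ T) x = S (T x) by [].
rewrite starM sk /frame star_sum !amul_suml truncT scaler_sumr; apply: eq_bigr => i _.
have E j : theta (e_ i) (v i) ⋅ k ⋅ (k ⋅ k ⋅ (k ⋅ k)) ⋅ (k ⋅ (theta (e_ j) (w j))^†) =
    ip_l2 (k (k (k (v i)))) (k (k (k (w j)))) *: theta (e_ i) (e_ j).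
  by rewrite theta_star mul_theta 2!theta_mul theta_theta !starM !sk !apM !kip.
rewrite !amul_sumr (bigD1 i)//= big1 ?addr0 => [|j ji].
  by rewrite E vw// eqxx.
rewrite E vw// (_ : (_ == _) = false) ?scale0r//; rewrite eq_sym; exact: negbTE.
Qed.

(** At z this is h^2 W h with W the frame. Conjugating h^4 gives h^2 (V h^6 W^†) h^2, and V h^6 W^†
    is the Gram matrix of the h^3 v_i and h^3 w_j. For orthonormal vectors one gets h^2 P h^2 with P
    a truncation, which tends to h^4. *)
Definition frame_el N w : bundleCx (R := R) :=
  hered_el (@hball_compact R) bundle_op_continuous bundle_op_star
    (@continuous_cst (hball R) op (h ⋅ frame N w)).

Lemma frame_el_mul N (v w : nat -> l2 R) (c : R[i]) :
  (forall i j, (i < N)%N -> (j < N)%N ->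
    ip_l2 (h (h (h (v i)))) (h (h (h (w j)))) = if i == j then c else 0) ->
  fval (frame_el N v ⋅ bundle_el ⋅ (frame_el N w)^†) z = c *: (h ⋅ (h ⋅ trunc N) ⋅ (h ⋅ h)).
Proof.
move=> /frame_mul vw.
rewrite -[LHS]/(h ⋅ (h ⋅ frame N v) ⋅ h ⋅ fval bundle_el z ⋅ (h ⋅ (h ⋅ frame N w) ⋅ h)^†).
rewrite bundle_elE.
have sh : h^† = h := bundle_op_star z.
move: (bundle_op z) sh (frame N v) (frame N w) (trunc N) vw => k sk V W P vw.
rewrite -amulZl -amulZr -amulZr -vw !starM sk !amulA.
by [].
Qed.

Lemma fibre_pi_properly_infinite : properly_infinite (fibre_pi z (bundle_el (R := R))).
Proof.
have sa : (fibre_pi z (bundle_el (R := R)))^† = fibre_pi z bundle_el.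
  by rewrite -quot_piS bundle_el_star.
apply/properly_infiniteP => //; split; first by apply: fibre_pi_neq0; exact: bundle_el_neq0.
have [y yE] := choice (fun N => exists_orthonormal (N + N)
  (bundle_op_star z) (@bundle_op_eq0 R z)).
(* The two halves of a family of size 2N, so that the mixed terms vanish. *)
pose u N := frame_el N (y N); pose v N := frame_el N (fun j => y N (N + j)%N).
have E (f g : nat -> bundleCx) :
    (fun n => fibre_pi z (f n) ⋅ fibre_pi z bundle_el ⋅ (fibre_pi z (g n))^†) =
    (fun n => fibre_pi z (f n ⋅ bundle_el ⋅ (g n)^†)).
  by apply/funext => n; rewrite /fibre_pi !quot_piM quot_piS.
have cv (f g : nat -> bundleCx) :
    (forall N, fval (f N ⋅ bundle_el ⋅ (g N)^†) z = h ⋅ (h ⋅ trunc N) ⋅ (h ⋅ h)) ->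
    (fun n => fibre_pi z (f n ⋅ bundle_el ⋅ (g n)^†)) @ \oo --> fibre_pi z bundle_el.
  move=> fg; apply/nr_cvgnP => e /harm_small[N Ne]; exists N => n Nn.
  rewrite /fibre_pi -quot_piN -quot_piD nr_fibre_pi fvalB fg bundle_elE.
  rewrite (le_lt_trans _ Ne)// (le_trans _ (harm_anti Nn))//.
  have h1 := nr_bundle_op z; have := bundle_op_tailr n z.
  move: (bundle_op z) (trunc n) h1 => k P k1; rewrite nrB.
  have -> : k ⋅ (k ⋅ P) ⋅ (k ⋅ k) - k ⋅ k ⋅ (k ⋅ k) = k ⋅ ((k ⋅ P - k) ⋅ (k ⋅ k)).
    by rewrite !amulDl amulDr amulNl amulNr !amulA.
  apply: le_trans; rewrite (le_trans (nrM _ _))// (le_trans (ler_piMl (nr_ge0 _) k1))//.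
  rewrite (le_trans (nrM _ _))// ler_piMr ?nr_ge0// (le_trans (nrM _ _))//.
  by rewrite mulr_ile1 ?nr_ge0.
exists (fun n => fibre_pi z (u n)), (fun n => fibre_pi z (v n)); rewrite !E; split.
- apply: cv => N; rewrite (@frame_el_mul N _ _ 1) ?scale1r// => i j iN jN.
  by rewrite yE ?ltn_addr//; case: eqP.
- apply: cv => N; rewrite (@frame_el_mul N _ _ 1) ?scale1r// => i j iN jN.
  by rewrite yE ?ltn_add2l// eqn_add2l; case: eqP.
- rewrite (_ : (fun n => _) = fun=> 0); first exact: cvg_cst.
  apply/funext => N; apply: nr_eq0; rewrite nr_fibre_pi (@frame_el_mul N _ _ 0).
    by rewrite scale0r nr0.
  move=> i j iN jN; rewrite yE ?ltn_add2l// ?(ltn_addr _ iN)//.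
  rewrite (_ : (i == _) = false) ?if_same//.
  by apply/negbTE; rewrite neq_ltn (leq_trans iN) ?leq_addr.
Qed.

End FibrewiseProperInfiniteness.

Lemma continuous_add (R : realType) (X : topologicalType) (f g : X -> R) :
  continuous f -> continuous g -> continuous (fun x => f x + g x).
Proof. by move=> fc gc x; apply: cvgD; [exact: fc|exact: gc]. Qed.

Lemma continuous_sub (R : realType) (X : topologicalType) (f g : X -> R) :
  continuous f -> continuous g -> continuous (fun x => f x - g x).
Proof. by move=> fc gc x; apply: cvgB; [exact: fc|exact: gc]. Qed.

Lemma continuous_div (R : realType) (X : topologicalType) (f g : X -> R) :
  continuous f -> continuous g -> (forall x, g x != 0) -> continuous (fun x => f x / g x).
Proof.
move=> fc gc g0 x; apply: (@cvgM R X _ _ f (fun x => (g x)^-1)); first exact: fc.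
by apply: cvgV; [exact: g0|exact: gc].
Qed.

(** * Real coordinates and retractions onto finite-dimensional balls *)

Section RealCoordinates.
Context {R : realType}.

Definition rcoord i (v : l2 R) : R :=
  if odd i then complex.Im (v i./2) else complex.Re (v i./2).

Lemma rcoord_even k v : rcoord k.*2 v = complex.Re (v k).
Proof. by rewrite /rcoord odd_double doubleK. Qed.

Lemma rcoord_odd k v : rcoord k.*2.+1 v = complex.Im (v k).
Proof. by rewrite /rcoord /= odd_double /= uphalf_double. Qed.

Lemma rcoordB i (u v : l2 R) : rcoord i (u - v) = rcoord i u - rcoord i v.
Proof. by rewrite /rcoord l2DE l2NE; case: (u _) (v _) => a b [c d]; case: odd. Qed.

Lemma rcoord_le i (v : l2 R) : `|rcoord i v| <= nr v.
Proof.
apply: (le_trans _ (coord_le v i./2)); rewrite /rcoord; case: odd.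
  exact: Im_le_nr.
exact: Re_le_nr.
Qed.

Lemma rcoord_sqsum (v : l2 R) N : \sum_(i < N.*2) rcoord i v ^+ 2 = sqsum v N.
Proof.
rewrite (sum_even_odd (fun i => rcoord i v ^+ 2)); apply: eq_bigr => k _.
by rewrite rcoord_even rcoord_odd nr_sqrE.
Qed.

Lemma rcoord_continuous i (X : topologicalType) (f : X -> l2 R) :
  continuous f -> continuous (fun x => rcoord i (f x)).
Proof.
move=> /nr_continuousP fc x; apply/cvgrPdist_lt => e /(fc x); apply: filterS => y.
by rewrite distrC -rcoordB; apply: le_lt_trans; exact: rcoord_le.
Qed.

Lemma sum_cutoff (f : nat -> R) N n : (forall k, 0 <= f k) ->
  (forall k, (N <= k)%N -> f k = 0) -> \sum_(k < n) f k <= \sum_(k < N) f k.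
Proof.
move=> f0 fN; have [nN|Nn] := leqP n N.
  rewrite -(subnKC nN) big_split_ord /= lerDl.
  by apply: sumr_ge0 => k _; exact: f0.
rewrite -(subnKC (ltnW Nn)) big_split_ord /= [X in _ + X]big1 ?addr0// => k _.
by rewrite fN// leq_addr.
Qed.

Lemma nr_sqsum (v : l2 R) N : (forall k, (N <= k)%N -> v k = 0) -> nr v ^+ 2 = sqsum v N.
Proof.
move=> vN; have -> : nr v = Num.sqrt (sqsum v N).
  apply/eqP; rewrite eq_le [X in _ && X]sqsum_le andbT.
  have -> : nr v = l2_nr v by [].
  apply: l2_nr_le => n; rewrite ler_wsqrtr//.
  apply: (@sum_cutoff (fun k => nr (v k) ^+ 2)) => k; first exact: sqr_ge0.
  by move=> /vN ->; rewrite nr0 expr0n.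
by rewrite sqr_sqrtr// sqsum_ge0.
Qed.

End RealCoordinates.

Section FiniteBalls.
Context {R : realType} (M : nat).
Implicit Types x : 'rV[R]_M.

(** Division by this number is the radial retraction onto the Euclidean unit ball, which [retract]
    embeds into the Hilbert ball by padding with zeros. *)
Definition rnorm2 x : R := Num.max 1 (Num.sqrt (\sum_i x ord0 i ^+ 2)).

Lemma rnorm2_gt0 x : 0 < rnorm2 x.
Proof. by rewrite lt_max ltr01. Qed.

Lemma rnorm2_eq1 x : \sum_i x ord0 i ^+ 2 = 1 -> rnorm2 x = 1.
Proof. by rewrite /rnorm2 => ->; rewrite sqrtr1 maxxx. Qed.

Definition pad x (k : nat) : R := if insub k is Some i then x ord0 i / rnorm2 x else 0.

Lemma pad_ord x (i : 'I_M) : pad x i = x ord0 i / rnorm2 x.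
Proof. by rewrite /pad valK. Qed.

Lemma pad0 x k : (M <= k)%N -> pad x k = 0.
Proof. by move=> Mk; rewrite /pad insubF// ltnNge Mk. Qed.

Lemma pad_ball x : @unit_ball_set R (pad x).
Proof.
move=> n; rewrite (le_trans (@sum_cutoff _ (fun k => pad x k ^+ 2) M n _ _))//.
- by move=> k; exact: sqr_ge0.
- by move=> k /pad0 ->; rewrite expr0n.
under eq_bigr do rewrite pad_ord expr_div_n.
rewrite -mulr_suml ler_pdivrMr ?exprn_gt0 ?rnorm2_gt0// mul1r.
have s0 : 0 <= \sum_i x ord0 i ^+ 2 by apply: sumr_ge0 => i _; exact: sqr_ge0.
rewrite -[leLHS]sqr_sqrtr// ler_sqr ?nnegrE ?sqrtr_ge0 ?(ltW (rnorm2_gt0 x))//.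
by rewrite /rnorm2 le_max lexx orbT.
Qed.

Definition retract x : hball R := mk_hball (pad_ball x).

Lemma rnorm2_continuous : continuous rnorm2.
Proof.
have qc : continuous (fun x : 'rV[R]_M => \sum_i x ord0 i ^+ 2).
  apply: (@continuous_sum R R _ _ _ _ (fun i (x : 'rV[R]_M) => x ord0 i ^+ 2)) => i _ y.
  apply: (@continuous_comp _ R R (fun x : 'rV[R]_M => x ord0 i) (fun r => r ^+ 2)).
    exact: coord_continuous.
  exact: exprn_continuous.
move=> x; apply: (@continuous_max _ _ (fun=> 1) (fun x : 'rV[R]_M => Num.sqrt (\sum_i x ord0 i ^+ 2))).
  exact: (@continuous_cst _ R 1).
apply: (@continuous_comp _ R R (fun x : 'rV[R]_M => \sum_i x ord0 i ^+ 2) Num.sqrt).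
  exact: qc.
exact: sqrt_continuous.
Qed.

Lemma retract_continuous : continuous retract.
Proof.
apply: hball_continuous => k.
have [kM|Mk] := ltnP k M; last first.
  rewrite (_ : _ \o _ = fun=> 0); first exact: continuous_cst.
  by apply/funext => x; exact: pad0.
rewrite (_ : _ \o _ = fun x => x ord0 (Ordinal kM) / rnorm2 x); last first.
  by apply/funext => x; exact: (pad_ord x (Ordinal kM)).
apply: continuous_div; [exact: coord_continuous|exact: rnorm2_continuous|].
by move=> x; rewrite gt_eqF// rnorm2_gt0.
Qed.

End FiniteBalls.

(* A section of the trivial bundle must somewhere be proportional to the tautological one:
   otherwise the normalised section maps the sphere of a finite-dimensional ball to itself
   without a fixed point. *)
Lemma section_collinear (R : realType) (eta : hball R -> l2 R) N : continuous eta ->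
  (forall z k, (N <= k)%N -> eta z k = 0) -> exists z, zproj z (eta z) = 0.
Proof.
move=> etac etaN; apply: contrapT => no.
have eta0 z : 0 < nr (eta z).
  rewrite lt_def nr_ge0 andbT; apply/eqP => /nr_eq0 z0.
  by apply: no; exists z; rewrite z0 ap0.
pose e (x : 'rV[R]_N.*2) := eta (retract x).
have ec : continuous e.
  move=> x; apply: (@continuous_comp _ (hball R) (l2 R) (@retract R N.*2) eta).
    exact: retract_continuous.
  exact: etac.
pose g (i : 'I_N.*2) (x : 'rV[R]_N.*2) : R := rcoord i (e x) / nr (e x).
have gc i : continuous (g i).
  apply: (@continuous_div R _ (fun x => rcoord i (e x)) (fun x => nr (e x))).
  - exact: rcoord_continuous.
  - exact: continuous_nr.
  - by move=> x; rewrite gt_eqF// eta0.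
have g1 i x : `|g i x| <= 1.
  rewrite normrM normfV (ger0_norm (nr_ge0 _)) ler_pdivrMr ?eta0// mul1r.
  exact: rcoord_le.
(* The components of g lie in [-1, 1], which gives the signs on opposite faces of the cube. *)
have [|i x _ ->|i x _ ->|x _ xg] := @poincare_miranda R N.*2 (fun i x => x ord0 i - g i x).
- by move=> i; apply: (@continuous_sub R _ (fun x : 'rV[R]_N.*2 => x ord0 i));
  [exact: coord_continuous|exact: gc].
- by have := g1 i x; rewrite ler_norml => /andP[]; lra.
- by have := g1 i x; rewrite ler_norml => /andP[]; lra.
have xE i : x ord0 i = rcoord i (e x) / nr (e x).
  by apply/eqP; rewrite -subr_eq0; apply/eqP; exact: xg.
set r := nr (e x) in xE; have r0 : 0 < r := eta0 _.
(* x equals the normalised section, a unit vector of dimension 2N because [eta] has no coordinates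
   beyond N; on unit vectors the retraction is the identity. *)
have x1 : rnorm2 x = 1.
  apply: rnorm2_eq1; under eq_bigr do rewrite xE expr_div_n.
  rewrite -mulr_suml rcoord_sqsum -nr_sqsum; last exact: etaN.
  by rewrite mulfV// expf_neq0// gt_eqF.
have zE : e x = r%:C *: zeta (retract x).
  have cE k : r * bcoord k (retract x) = rcoord k (e x).
    have [kN|Nk] := ltnP k N.*2.
      rewrite -[bcoord k _]/(pad x (Ordinal kN)) pad_ord x1 divr1 xE.
      by rewrite mulrC divfK// gt_eqF.
    rewrite -[bcoord k _]/(pad x k) pad0// mulr0 /rcoord /e etaN; first by case: odd.
    by rewrite -[X in (X <= _)%N]doubleK half_leq.
  apply: l2_ext => k; rewrite l2ZE.
  have -> : zeta (retract x) k =
    bcoord k.*2 (retract x) +i* bcoord k.*2.+1 (retract x) by [].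
  have := cE k.*2.+1; have := cE k.*2; rewrite rcoord_even rcoord_odd.
  by case: (e x k) => a b /= <- <-; congr (_ +i* _); rewrite !(mul0r, subr0, addr0).
apply: no; exists (retract x); rewrite -/(e x) zprojE.
suff -> : ip_l2 (zeta (retract x)) (e x) = r%:C by rewrite {1}zE subrr.
have z1 : nr (zeta (retract x)) = 1.
  have : nr (e x) = r * nr (zeta (retract x)) by rewrite {1}zE nrZR ger0_norm// ltW.
  by rewrite -/r => /(congr1 (fun t => r^-1 * t)); rewrite mulKf ?mulVf ?gt_eqF.
by rewrite zE ip_l2Zr ip_l2xx z1 expr1n rmorph1 -[LHS]/(_ * _) mulr1.
Qed.

(** * Failure of proper infiniteness over the whole ball *)

Section NotProperlyInfinite.
Context {R : realType}.
Notation e_ := (@l2_basis R).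
Notation op := (adj (@l2_form R)).
Notation A := (@bundleCx R).
Notation a := (@bundle_el R).

Lemma continuous_ap (X : topologicalType) (F : X -> op) (f : X -> l2 R) :
  continuous F -> continuous f -> continuous (fun x => F x (f x)).
Proof.
move=> Fc fc s.
apply: (cvg_biadditive (m := fun (T : op) (x : l2 R) => T x)) (Fc s) (fc s) => [//|T x y|T x].
  exact: apD.
exact: nr_ap.
Qed.

Lemma star_conj (B : normedStarAlgType R) (x y b : B) :
  b^† = b -> (x ⋅ b ⋅ y^†)^† = y ⋅ b ⋅ x^†.
Proof. by move=> sb; rewrite !starM starK sb amulA. Qed.

Lemma nr_cancel_le (V : normedModType R[i]) (x p q : V) (t : R) :
  p + q = 0 -> nr (p - x) <= t -> nr q <= t -> nr x <= t + t.
Proof.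
move=> /eqP; rewrite addr_eq0 => /eqP -> px qt.
by rewrite (le_trans (nrDB _ (- q)))// nrN nrB lerD.
Qed.

Lemma conj_ap_sum (S T P Q : op) (x y : l2 R) :
  (S ⋅ T ⋅ P^†) x + (S ⋅ T ⋅ Q^†) y = S (T (P^† x + Q^† y)).
Proof. by rewrite !apD. Qed.

Lemma positive_lower_bound (f : hball R -> R) : continuous f -> (forall z, 0 < f z) ->
  exists2 d : R, 0 < d & forall z, d <= f z.
Proof.
move=> fc f0; have [z zmin] := continuous_attains_min (@hball_compact R) point fc.
by exists (f z).
Qed.

Lemma bundle_el_basis_bound : exists2 d : R, 0 < d &
  forall z, d <= nr (fval a z (e_ 0)) + nr (fval a z (e_ 1)).
Proof.
have ac i : continuous (fun z => nr (fval a z (e_ i)) : R).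
  apply: continuous_nr; apply: (@continuous_ap _ (fval a) (fun=> e_ i)).
    exact: fval_continuous.
  exact: continuous_cst.
apply: positive_lower_bound => [|z].
  exact: (continuous_add (ac 0%N) (ac 1%N)).
rewrite lt_def addr_ge0 ?nr_ge0// andbT paddr_eq0 ?nr_ge0//.
apply/negP => /andP[/eqP/nr_eq0 a0 /eqP/nr_eq0 a1].
have az x : fval a z x = bundle_op z (bundle_op z (bundle_op z (bundle_op z x))).
  by rewrite bundle_elE.
move: a0 a1; rewrite !az => /bundle_op_inj2/bundle_op_inj2/bundle_op_inj2 h0.
by move=> /bundle_op_inj2/bundle_op_inj2/bundle_op_inj2; exact: bundle_op_basis.
Qed.

Lemma bundle_not_properly_infinite : ~ properly_infinite a.
Proof.
move=> /(properly_infiniteP bundle_el_star)[_ [u' [v' [uu vv uv]]]].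
have [d d0 ad] := bundle_el_basis_bound.
(* a e_0 and a e_1 will each be bounded by two errors; four times d/5 stays below d. *)
have d5 : 0 < d / 5 by rewrite divr_gt0.
have d45 : d / 5 + d / 5 + (d / 5 + d / 5) < d by lra.
have [N1 uu1] := iffLR (nr_cvgnP _ _) uu _ d5.
have [N2 vv1] := iffLR (nr_cvgnP _ _) vv _ d5.
have [N3 uv1] := iffLR (nr_cvgnP _ _) uv _ d5.
pose n := maxn N1 (maxn N2 N3).
have {uu1}uu1 := uu1 n (leq_maxl _ _).
have {vv1}vv1 := vv1 n (leq_trans (leq_maxl _ _) (leq_maxr _ _)).
have {uv1}uv1 := uv1 n (leq_trans (leq_maxr _ _) (leq_maxr _ _)).
move: (u' n) (v' n) uu1 vv1 uv1 => u v uu1 vv1; rewrite subr0 => uv1.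
(* Up to small errors u a w = a e_0 and v a w = a e_1, the mixed products being close to 0. So a w =
   0 at some point would contradict [bundle_el_basis_bound]. *)
pose w z : l2 R := (fval u z)^† (e_ 0) + (fval v z)^† (e_ 1).
have wc : continuous w.
  have sc (f : A) i : continuous (fun z => (fval f z)^† (e_ i)).
    apply: (@continuous_ap _ (fun z => (fval f z)^†) (fun=> e_ i)).
      by apply: continuous_star; exact: fval_continuous.
    exact: continuous_cst.
  exact: (continuous_addv (sc u 0%N) (sc v 1%N)).
have small (f : A) z (x : l2 R) e : nr f < e -> nr x = 1 -> nr (fval f z x) <= e.
  move=> fe x1; rewrite (le_trans (nr_ap _ _))// x1 mulr1 (le_trans (nr_fval f z))//.
  exact: ltW.
have aw z : fval a z (w z) <> 0.
  move=> aw0.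
  have uaw : fval (u ⋅ a ⋅ u^†) z (e_ 0) + fval (u ⋅ a ⋅ v^†) z (e_ 1) = 0.
    transitivity (fval u z (fval a z (w z))); last by rewrite aw0 ap0.
    exact: (conj_ap_sum (fval u z) (fval a z) (fval u z) (fval v z) (e_ 0) (e_ 1)).
  have vaw : fval (v ⋅ a ⋅ u^†) z (e_ 0) + fval (v ⋅ a ⋅ v^†) z (e_ 1) = 0.
    transitivity (fval v z (fval a z (w z))); last by rewrite aw0 ap0.
    exact: (conj_ap_sum (fval v z) (fval a z) (fval u z) (fval v z) (e_ 0) (e_ 1)).
  have vu1 : nr (v ⋅ a ⋅ u^†) < d / 5.
    by rewrite -(star_conj u v bundle_el_star) nr_star.
  have s1 : nr (fval a z (e_ 0)) <= d / 5 + d / 5.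
    by apply: (nr_cancel_le uaw); [exact: small _ z _ _ uu1 (nr_basis 0)|
      exact: small _ z _ _ uv1 (nr_basis 1)].
  have s2 : nr (fval a z (e_ 1)) <= d / 5 + d / 5.
    rewrite addrC in vaw; apply: (nr_cancel_le vaw).
      exact: small _ z _ _ vv1 (nr_basis 1).
    exact: small _ z _ _ vu1 (nr_basis 0).
  have := le_trans (ad z) (lerD s1 s2); rewrite leNgt; apply/negP/negPn.
  by rewrite d45.
have hw z : bundle_op z (w z) <> 0.
  move=> hw0; apply: (aw z); rewrite bundle_elE.
  by rewrite -[LHS]/(bundle_op z (bundle_op z (bundle_op z (bundle_op z (w z))))) hw0 !ap0.
have hwc : continuous (fun z => bundle_op z (w z)).
  by apply: continuous_ap => //; exact: bundle_op_continuous.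
have [|d' d'0 hwd] := positive_lower_bound (continuous_nr hwc).
  by move=> z; rewrite lt_def nr_ge0 andbT; apply/eqP => /nr_eq0; exact: hw.
have [C wC] := continuous_bounded (@hball_compact R) wc.
have [N CN] := harm_mul_small C d'0.
(* Truncation makes [section_collinear] applicable. Where [zproj] kills [eta], h w = G zproj (G w -
   eta) is at most C times [harm N], below its lower bound d'. *)
pose eta z := trunc N (hdiag (w z)).
have etac : continuous eta.
  apply: (@continuous_ap _ (fun=> trunc N) (fun z => hdiag (w z))); first exact: continuous_cst.
  by apply: (@continuous_ap _ (fun=> hdiag) w) => //; exact: continuous_cst.
have [|z z0] := section_collinear (N := N) etac.
  by move=> z k Nk; rewrite truncE ltnNge Nk.
have := hwd z; rewrite leNgt => /negP; apply; rewrite (le_lt_trans _ CN)//.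
have -> : bundle_op z (w z) = hdiag (zproj z (hdiag (w z) - eta z)).
  by rewrite bundle_op_ap apB z0 subr0.
rewrite (le_trans (nr_ap _ _))// (le_trans (ler_piMl (nr_ge0 _) nr_hdiag))//.
rewrite (le_trans (nr_ap _ _))// (le_trans (ler_piMl (nr_ge0 _) (nr_zproj z)))//.
rewrite (le_trans (hdiag_tail_vec _ _))// mulrC ler_wpM2r ?(ltW (harm_gt0 N))//.
Qed.

Lemma first_example : exists (X : topologicalType) (A : cxAlgType R X) (a : A),
  [/\ standing_hyp a, (forall x : X, properly_infinite (fibre_pi x a)) &
      ~ properly_infinite a].
Proof.
exists (hball R), A, a; split.
- exact: bundle_standing_hyp.
- exact: fibre_pi_properly_infinite.
- exact: bundle_not_properly_infinite.
Qed.

End NotProperlyInfinite.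

Theorem proposition4p3 (R : realType) :
  (forall (X : topologicalType) (A : cxAlgType R X) (a : A),
     standing_hyp a ->
     (multiplier_properly_infinite A -> properly_infinite a) /\
     (properly_infinite a ->
        forall x : X, properly_infinite (fibre_pi x a))) /\
  (exists (X : topologicalType) (A : cxAlgType R X) (a : A),
     [/\ standing_hyp a,
         (forall x : X, properly_infinite (fibre_pi x a)) &
         ~ properly_infinite a]) /\
  (exists (X : topologicalType) (A : cxAlgType R X) (a : A),
     [/\ standing_hyp a,
         properly_infinite a &
         ~ multiplier_properly_infinite A]).
Proof.
split; first exact: proposition4p3_implications.
by split; [exact: first_example|exact: second_example].
Qed.
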